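(* Let $n$ be an even positive integer, let $\sigma\in\mathbb{C}$, and let $u\in\mathbb{C}$ with $\Re(u)>0$. Then $$K_{\sigma+\frac{n-1}{2}}(u)=(2u)^{-\frac{\sigma+1}{2}}\,\pi^{\frac12}\sum_{i=0}^{\infty}\frac{(-\sigma)_i\left(1-\sigma-\frac n2\right)_i}{i!}\;W_{\frac{\sigma}{2}-i,\;\frac{\sigma+n-1}{2}}(2u).$$
   Context: $K_\nu$ is the Macdonald function (modified Bessel function, often called of the second or third kind), $K_\nu(z)=\frac{\pi\,[I_{-\nu}(z)-I_\nu(z)]}{2\sin(\nu\pi)}$ for $\nu\notin\mathbb{Z}$ (extended to integer $\nu$ by continuity), where $I_\nu$ is the modified Bessel function of the first kind. $(\lambda)_i=\lambda(\lambda+1)\cdots(\lambda+i-1)$, $(\lambda)_0=1$ (also for $\lambda=0$), is the Pochhammer symbol. $W_{\kappa,\mu}$ is the Whittaker function of the second kind, $W_{\kappa,\mu}(z)=z^{\mu+\frac12}e^{-z/2}\,\Psi\left(\tfrac12-\kappa+\mu,\,2\mu+1;\,z\right)$, where $\Psi(a,b;z)$ is Tricomi's confluent hypergeometric function (also denoted $U(a,b,z)$), given for $\Re(a)>0$, $\Re(z)>0$ by $\Psi(a,b;z)=\frac1{\Gamma(a)}\int_0^\infty e^{-zt}t^{a-1}(1+t)^{b-a-1}\,dt$. Complex powers are principal branches. *)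

(* Defs.v *)
From Stdlib Require Import Reals ZArith ClassicalEpsilon.
From Coquelicot Require Import Coquelicot.

Local Open Scope C_scope.

Definition natC (k : nat) : C := RtoC (INR k).

Definition Cexp (z : C) : C :=
  ((exp (Re z) * cos (Im z))%R, (exp (Re z) * sin (Im z))%R).

Definition Csin (z : C) : C :=
  (Cexp (Ci * z) - Cexp (- (Ci * z))) / (2 * Ci).

(* Principal argument, with values in ]-PI, PI]; meaningful for z <> 0. *)
Definition Carg (z : C) : R :=
  if Rle_dec 0 (Im z) then acos (Re z / Cmod z)
  else (- acos (Re z / Cmod z))%R.

Definition Clog (z : C) : C := (ln (Cmod z), Carg z).

(* Principal branch of z ^ a; meaningful for z <> 0. *)
Definition Cpower (z a : C) : C := Cexp (a * Clog z).

Fixpoint Cpochhammer (l : C) (i : nat) : C :=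
  match i with
  | O => 1
  | S j => Cpochhammer l j * (l + natC j)
  end.

(* Improper integral of a complex-valued function over ]0, +oo[. *)
Definition Cint_0_oo (f : R -> C) : C :=
  RInt_gen (V := C_R_CompleteNormedModule) f (at_right 0) (Rbar_locally p_infty).

(* Euler's integral, convergent for Re z > 0. *)
Definition Gamma_Euler (z : C) : C :=
  Cint_0_oo (fun t => Cpower (RtoC t) (z - 1) * Cexp (- RtoC t)).

(* Continuation to the whole plane by Gamma (z + m) = (z)_m Gamma z, where m is
   least with Re (z + m) > 0 (so m = 0 and Gamma z is Euler's integral when
   Re z > 0).  At the poles 0, -1, -2, ... the Pochhammer symbol is 0; as
   / 0 = 0 in C, there Gamma z = 0 and / Gamma z = 0, so that / Gamma z is the
   entire reciprocal Gamma function for every z. *)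
Definition Gamma (z : C) : C :=
  let m := Z.to_nat (up (- Re z)) in
  Gamma_Euler (z + natC m) / Cpochhammer z m.

(* Sum of a convergent complex series. *)
Definition CSeries (a : nat -> C) : C :=
  (Series (fun k => Re (a k)), Series (fun k => Im (a k))).

Definition BesselI (nu z : C) : C :=
  CSeries (fun k =>
    Cpower (z / 2) (2 * natC k + nu)
    / (RtoC (INR (fact k)) * Gamma (natC k + nu + 1))).

Definition BesselK_nonint (nu z : C) : C :=
  RtoC PI * (BesselI (- nu) z - BesselI nu z) / (2 * Csin (nu * RtoC PI)).

(* C_lim is the limit along punctured neighbourhoods, so for integer nu the
   formula is only used at nearby non-integer orders. *)
Definition BesselK (nu z : C) : C :=
  if excluded_middle_informative (exists k : Z, nu = RtoC (IZR k))
  then C_lim (fun nu' => BesselK_nonint nu' z) nu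
  else BesselK_nonint nu z.

(* Tricomi's function, by its integral representation: meaningful for
   Re a > 0 and Re z > 0. *)
Definition TricomiPsi (a b z : C) : C :=
  / Gamma a *
  Cint_0_oo (fun t =>
    Cexp (- (z * RtoC t)) * Cpower (RtoC t) (a - 1)
    * Cpower (1 + RtoC t) (b - a - 1)).

(* Inherits the range Re (1/2 - kappa + mu) > 0, Re z > 0 of TricomiPsi. *)
Definition WhittakerW (kappa mu z : C) : C :=
  Cpower z (mu + 1 / 2) * Cexp (- z / 2)
  * TricomiPsi (1 / 2 - kappa + mu) (2 * mu + 1) z.

(* Main.v *)
(** Put [m = n/2], [z = 2u], [nu = sigma + m - 1/2] and, for [c > 0],
    [S(c) = sum_i (c-1/2-nu)_i (1/2-nu)_i / (i! Gamma(c+i)) J(c+i, nu-1/2-i)] with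
    [J(a, r) = int_0^oo e^{-zt} t^{a-1} (1+t)^r dt]; up to elementary factors the series
    of the theorem is [S(m)].

    If [Re nu < 1/2], Kummer's transformation (exchange of two integrations) applied to
    each [J(c+i, .)] turns the hypergeometric sum into a binomial one, so that [z^c S(c)]
    does not depend on [c].  For [c = 1/2] the 2F1 in the integrand is the even part of a
    binomial series, and [S(1/2)] is the integral of [e^{-u cosh s} cosh(nu s)] in the
    variable [t = sinh^2(s/2)].  Euler's transformation of 2F1 shows that the integrand of
    [S(m)] is even in [nu], which removes the restriction on [nu].

    The definition of K by [I_{-nu} - I_nu] is matched with that integral as follows.  With
    [w = e^s], expand [e^{-u/(2w)}] in [int_1^oo e^{-u(w+1/w)/2} w^{-nu-1} dw]; each term is
    a complete Gamma integral minus a power series.  By the reflection formula the Gamma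
    terms add up to a multiple of [I_nu], and the remaining double series is odd in [nu], so
    it cancels when the integrals for [nu] and [-nu] are added. *)
Require Import Defs.
From Stdlib Require Import Reals ZArith Factorial Lra Lia ClassicalEpsilon.
From Coquelicot Require Import Coquelicot.

Local Open Scope C_scope.

(** * Calculus of complex functions of a real variable *)

(** The range of the integral defining Tricomi's function shapes the argument. Kummer's
    transformation puts [q = 1/2 - nu] in the place of the first parameter, so it can only be
    applied when [Re q > 0]; the parity of the integrand in [nu], rather than a continuation in
    [sigma], takes over beyond that half-plane. K is given by series off the integers and by a limit
    at the integers. The series are unsuitable for that limit, because the quotient by the sine
    degenerates, whereas the integral in [t] depends on the order through a dominated integrand; the
    value at an integer order is therefore reached from the integral. Gamma is Euler's integral, so
    the reflection formula is derived from it: [Gamma(n+1+z)] is compared with [n! n^z], and the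
    integrals of [cos(2zx) (cos x)^(2n)] over [[0, PI/2]] supply Euler's product for the sine. All
    exchanges of limits, sums and integrals rest on one family of majorants with closed-form
    primitives, so that the error of truncating an integral to [[p, q]] is explicit and uniform over
    all integrands with the same majorant. *)

Definition is_Cderive (f : R -> C) (x : R) (l : C) : Prop :=
  is_derive (K := R_AbsRing) (V := C_R_NormedModule) f x l.

Definition Ccont {T : UniformSpace} (f : T -> C) (x : T) : Prop :=
  continuous (U := C_UniformSpace) f x.

Lemma C_ext (a b : C) : Re a = Re b -> Im a = Im b -> a = b.
Proof. destruct a, b; unfold Re, Im; simpl; intros; subst; reflexivity. Qed.

Lemma is_derive_val (f : R -> R) (x l l' : R) : is_derive f x l -> l = l' -> is_derive f x l'.
Proof. intros H <-; exact H. Qed.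

(** Reduces complex-valued derivatives to real ones: pairing is a linear map into
    [C_R_NormedModule], so the chain rule applies. The differentiation rules for sums, products and
    exponentials go through it. *)
Lemma is_Cderive_pair (f : R -> C) x l :
  is_derive (fun t => Re (f t)) x (Re l) -> is_derive (fun t => Im (f t)) x (Im l) ->
  is_Cderive f x l.
Proof.
  intros H1 H2. 
  apply (filterdiff_ext_lin _ (fun y : R => (scal y (Re l), scal y (Im l)) : C_R_NormedModule)).
  2:{ intros y. reflexivity. }
  apply (filterdiff_ext_loc (K:=R_AbsRing) (V:=C_R_NormedModule) (fun t => (Re (f t), Im (f t)))).
  { apply filter_forall. intros y. destruct (f y); reflexivity. }
  { intros y _. destruct (f y); reflexivity. }
  apply (filterdiff_comp'_2 (K:=R_AbsRing) (W:=C_R_NormedModule) (fun t => Re (f t)) (fun t => Im (f t)) (fun a b => (a,b)) x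
    (fun y => scal y (Re l)) (fun y => scal y (Im l)) (fun a b => (a,b)) H1 H2).
  apply (filterdiff_linear (K:=R_AbsRing) (U:=prod_NormedModule R_AbsRing R_NormedModule R_NormedModule) (V:=C_R_NormedModule)
    (fun t => (fst t, snd t))).
  split.
  - intros [a b] [c d]; reflexivity.
  - intros k [a b]; reflexivity.
  - exists 1%R. split; [lra|]. intros [a b]. rewrite Rmult_1_l. apply Rle_refl.
Qed.

Lemma is_Cderive_Re (f : R -> C) x l : is_Cderive f x l -> is_derive (fun t => Re (f t)) x (Re l).
Proof.
  intros H. 
  apply (filterdiff_ext_lin _ (fun y : R => fst (scal y l : C_R_NormedModule))).
  - apply (filterdiff_comp' (K:=R_AbsRing) (V:=C_R_NormedModule) f (fun z : C => fst z) x _ (fun z => fst z) H).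
    apply filterdiff_linear. apply is_linear_fst.
  - intros y. reflexivity.
Qed.

Lemma is_Cderive_Im (f : R -> C) x l : is_Cderive f x l -> is_derive (fun t => Im (f t)) x (Im l).
Proof.
  intros H. 
  apply (filterdiff_ext_lin _ (fun y : R => snd (scal y l : C_R_NormedModule))).
  - apply (filterdiff_comp' (K:=R_AbsRing) (V:=C_R_NormedModule) f (fun z : C => snd z) x _ (fun z => snd z) H).
    apply filterdiff_linear. apply is_linear_snd.
  - intros y. reflexivity.
Qed.

Lemma Ccont_pair {T : UniformSpace} (f : T -> C) (x : T) :
  continuous (fun t => Re (f t)) x -> continuous (fun t => Im (f t)) x -> Ccont f x.
Proof.
  intros H1 H2. 
  apply (continuous_ext (fun t => (Re (f t), Im (f t)) : C_UniformSpace)).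
  { intros t. destruct (f t); reflexivity. }
  apply (continuous_comp_2 (fun t => Re (f t)) (fun t => Im (f t)) (fun a b => (a,b) : C_UniformSpace)); auto.
  apply (continuous_ext (fun t => t)). intros [a b]; reflexivity. apply continuous_id.
Qed.

Lemma Ccont_Re {T : UniformSpace} (f : T -> C) (x : T) : Ccont f x -> continuous (fun t => Re (f t)) x.
Proof.
  intros H. apply (continuous_comp (V:=C_UniformSpace) f (fun z : C => fst z)); auto.
  destruct (f x). apply continuous_fst.
Qed.

Lemma Ccont_Im {T : UniformSpace} (f : T -> C) (x : T) : Ccont f x -> continuous (fun t => Im (f t)) x.
Proof.
  intros H. apply (continuous_comp (V:=C_UniformSpace) f (fun z : C => snd z)); auto.
  destruct (f x). apply continuous_snd.
Qed.

Lemma Ccont_const {T : UniformSpace} (c : C) (x : T) : Ccont (fun _ => c) x.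
Proof. apply continuous_const. Qed.

Lemma Ccont_RtoC {T : UniformSpace} (f : T -> R) (x : T) : continuous f x -> Ccont (fun t => RtoC (f t)) x.
Proof. intros H. apply Ccont_pair; simpl; auto. apply continuous_const. Qed.

Lemma Ccont_plus {T : UniformSpace} (f g : T -> C) (x : T) : Ccont f x -> Ccont g x -> Ccont (fun t => f t + g t) x.
Proof.
  intros Hf Hg. apply Ccont_pair; simpl.
  - apply (continuous_plus (V:=R_NormedModule) (fun t => Re (f t)) (fun t => Re (g t))); apply Ccont_Re; auto.
  - apply (continuous_plus (V:=R_NormedModule) (fun t => Im (f t)) (fun t => Im (g t))); apply Ccont_Im; auto.
Qed.

Lemma Ccont_mult {T : UniformSpace} (f g : T -> C) (x : T) : Ccont f x -> Ccont g x -> Ccont (fun t => f t * g t) x.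
Proof.
  intros Hf Hg.
  pose proof (Ccont_Re _ _ Hf); pose proof (Ccont_Im _ _ Hf).
  pose proof (Ccont_Re _ _ Hg); pose proof (Ccont_Im _ _ Hg).
  apply Ccont_pair; simpl.
  - apply (continuous_minus (V:=R_NormedModule) (fun t => (Re (f t) * Re (g t))%R) (fun t => (Im (f t) * Im (g t))%R));
      apply (continuous_mult (K:=R_AbsRing)); auto.
  - apply (continuous_plus (V:=R_NormedModule) (fun t => (Re (f t) * Im (g t))%R) (fun t => (Im (f t) * Re (g t))%R));
      apply (continuous_mult (K:=R_AbsRing)); auto.
Qed.

Lemma Ccont_opp {T : UniformSpace} (f : T -> C) (x : T) : Ccont f x -> Ccont (fun t => - f t) x.
Proof.
  intros Hf. apply (continuous_ext (T:=T) (U:=C_UniformSpace) (fun t => RtoC (-1) * f t)).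
  intros t. apply C_ext; unfold Re, Im; simpl; ring.
  apply Ccont_mult; auto. apply Ccont_const.
Qed.

Lemma is_Cderive_cont f x l : is_Cderive f x l -> Ccont f x.
Proof.
  intros H. apply Ccont_pair.
  - apply (ex_derive_continuous (K:=R_AbsRing) (V:=R_NormedModule)). eexists; apply (is_Cderive_Re _ _ _ H).
  - apply (ex_derive_continuous (K:=R_AbsRing) (V:=R_NormedModule)). eexists; apply (is_Cderive_Im _ _ _ H).
Qed.

Lemma is_Cderive_eq f x l l' : is_Cderive f x l -> l = l' -> is_Cderive f x l'.
Proof. intros H <-; exact H. Qed.

Lemma is_Cderive_ext f g x l : (forall t, f t = g t) -> is_Cderive f x l -> is_Cderive g x l.
Proof. intros H. apply is_derive_ext; auto. Qed.

Lemma is_Cderive_const (c : C) x : is_Cderive (fun _ => c) x 0.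
Proof. apply is_Cderive_pair; simpl; apply @is_derive_const. Qed.

Lemma is_Cderive_RtoC (f : R -> R) x l : is_derive f x l -> is_Cderive (fun t => RtoC (f t)) x (RtoC l).
Proof. intros H. apply is_Cderive_pair; simpl; auto. apply @is_derive_const. Qed.

Lemma is_Cderive_plus f g x l m : is_Cderive f x l -> is_Cderive g x m -> is_Cderive (fun t => f t + g t) x (l + m).
Proof.
  intros Hf Hg. apply is_Cderive_pair; simpl.
  - apply (is_derive_plus (V:=R_NormedModule) (fun t => Re (f t)) (fun t => Re (g t))); apply is_Cderive_Re; auto.
  - apply (is_derive_plus (V:=R_NormedModule) (fun t => Im (f t)) (fun t => Im (g t))); apply is_Cderive_Im; auto.
Qed.

Lemma is_Cderive_mult f g x l m : is_Cderive f x l -> is_Cderive g x m ->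
  is_Cderive (fun t => f t * g t) x (l * g x + f x * m).
Proof.
  intros Hf Hg.
  pose proof (is_Cderive_Re _ _ _ Hf) as F1; pose proof (is_Cderive_Im _ _ _ Hf) as F2.
  pose proof (is_Cderive_Re _ _ _ Hg) as G1; pose proof (is_Cderive_Im _ _ _ Hg) as G2.
  apply is_Cderive_pair.
  - pose proof (is_derive_minus (V:=R_NormedModule) _ _ x _ _ (Derive.is_derive_mult _ _ _ _ _ F1 G1)
      (Derive.is_derive_mult _ _ _ _ _ F2 G2)) as D.
    eapply is_derive_ext; [|eapply is_derive_val; [exact D|]].
    intros; reflexivity.
    unfold minus, plus, opp; simpl; unfold Re, Im; ring.
  - pose proof (is_derive_plus (V:=R_NormedModule) _ _ x _ _ (Derive.is_derive_mult _ _ _ _ _ F1 G2)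
      (Derive.is_derive_mult _ _ _ _ _ F2 G1)) as D.
    eapply is_derive_ext; [|eapply is_derive_val; [exact D|]].
    intros; reflexivity.
    unfold plus; simpl; unfold Re, Im; ring.
Qed.

Lemma is_Cderive_scal (c : C) f x l : is_Cderive f x l -> is_Cderive (fun t => c * f t) x (c * l).
Proof.
  intros H. eapply is_Cderive_eq. apply is_Cderive_mult; [apply is_Cderive_const|exact H]. simpl. ring.
Qed.

Lemma is_Cderive_opp f x l : is_Cderive f x l -> is_Cderive (fun t => - f t) x (- l).
Proof.
  intros H. eapply is_Cderive_ext. 2: eapply is_Cderive_eq. 2: apply (is_Cderive_scal (RtoC (-1)) _ _ _ H).
  intros; apply C_ext; unfold Re, Im; simpl; ring.
  apply C_ext; unfold Re, Im; simpl; ring.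
Qed.

Lemma is_Cderive_minus f g x l m : is_Cderive f x l -> is_Cderive g x m -> is_Cderive (fun t => f t - g t) x (l - m).
Proof. intros Hf Hg. apply is_Cderive_plus; auto. apply is_Cderive_opp; auto. Qed.

Lemma is_Cderive_comp (f : R -> C) (h : R -> R) x l m :
  is_Cderive f (h x) l -> is_derive h x m -> is_Cderive (fun t => f (h t)) x (RtoC m * l).
Proof.
  intros Hf Hh. eapply is_Cderive_eq.
  apply (is_derive_comp (K:=R_AbsRing) (V:=C_R_NormedModule) f h x l m Hf Hh).
  apply C_ext; unfold Re, Im; simpl; unfold scal; simpl; unfold mult; simpl; ring.
Qed.

(** * Complex exponential and powers with a positive base *)

Lemma Cexp_add a b : Cexp (a + b) = Cexp a * Cexp b.
Proof.
  destruct a as [a1 a2], b as [b1 b2].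
  apply C_ext; unfold Cexp, Re, Im; simpl; rewrite exp_plus; rewrite ?cos_plus, ?sin_plus; ring.
Qed.

Lemma Cexp_0 : Cexp 0 = 1.
Proof. apply C_ext; unfold Cexp, Re, Im; simpl; rewrite exp_0; rewrite ?cos_0, ?sin_0; ring. Qed.

Lemma Cexp_opp a : Cexp (- a) * Cexp a = 1.
Proof. rewrite <- Cexp_add, <- Cexp_0. f_equal. ring. Qed.

Lemma Cexp_neq_0 a : Cexp a <> 0.
Proof.
  intros H. pose proof (Cexp_opp a) as E. rewrite H in E. rewrite Cmult_0_r in E.
  apply (f_equal Re) in E. unfold Re in E; simpl in E. lra.
Qed.

Lemma Cexp_inv a : Cexp (- a) = / Cexp a.
Proof. pose proof (Cexp_neq_0 a). pose proof (Cexp_opp a). 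
  replace (/ Cexp a) with (Cexp (-a) * Cexp a * / Cexp a). field; auto. rewrite H0; ring. Qed.

Lemma Cexp_RtoC (x : R) : Cexp (RtoC x) = RtoC (exp x).
Proof. apply C_ext; unfold Cexp, Re, Im; simpl; rewrite ?cos_0, ?sin_0; ring. Qed.

Lemma Cmod_sqr (z : C) : (Cmod z * Cmod z = Re z * Re z + Im z * Im z)%R.
Proof. pose proof (Cmod2_alt z). lra. Qed.

Lemma Cmod_Cexp a : Cmod (Cexp a) = exp (Re a).
Proof.
  apply Rsqr_inj; [apply Cmod_ge_0|left; apply exp_pos|].
  unfold Rsqr. rewrite Cmod_sqr. unfold Cexp, Re at 1 2, Im at 1 2; simpl.
  pose proof (sin2_cos2 (Im a)) as E. unfold Rsqr in E.
  transitivity (exp (Re a) * exp (Re a) * (sin (Im a) * sin (Im a) + cos (Im a) * cos (Im a)))%R.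
  unfold Re, Im; simpl; ring. rewrite E; ring.
Qed.

Lemma is_Cderive_Cexp (g : R -> C) x l : is_Cderive g x l -> is_Cderive (fun t => Cexp (g t)) x (l * Cexp (g x)).
Proof.
  intros H. pose proof (is_Cderive_Re _ _ _ H) as H1. pose proof (is_Cderive_Im _ _ _ H) as H2.
  pose proof (is_derive_comp (V:=R_NormedModule) exp _ x _ _ (is_derive_exp _) H1) as E1.
  pose proof (is_derive_comp (V:=R_NormedModule) cos _ x _ _ (is_derive_cos _) H2) as C1.
  pose proof (is_derive_comp (V:=R_NormedModule) sin _ x _ _ (is_derive_sin _) H2) as S1.
  apply is_Cderive_pair.
  - eapply is_derive_val. exact (Derive.is_derive_mult _ _ _ _ _ E1 C1).
    unfold scal; simpl; unfold mult, Re, Im; simpl; unfold Re, Im; ring.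
  - eapply is_derive_val. exact (Derive.is_derive_mult _ _ _ _ _ E1 S1).
    unfold scal; simpl; unfold mult, Re, Im; simpl; unfold Re, Im; ring.
Qed.

Lemma Ccont_Cexp {T : UniformSpace} (g : T -> C) (x : T) : Ccont g x -> Ccont (fun t => Cexp (g t)) x.
Proof.
  intros H. pose proof (Ccont_Re _ _ H) as H1. pose proof (Ccont_Im _ _ H) as H2.
  apply Ccont_pair; unfold Cexp, Re at 1, Im at 1; simpl.
  - apply (continuous_mult (K:=R_AbsRing) (fun t => exp (Re (g t))) (fun t => cos (Im (g t)))).
    apply (continuous_comp (fun t => Re (g t)) exp); auto. apply continuous_exp.
    apply (continuous_comp (fun t => Im (g t)) cos); auto. apply continuous_cos.
  - apply (continuous_mult (K:=R_AbsRing) (fun t => exp (Re (g t))) (fun t => sin (Im (g t)))).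
    apply (continuous_comp (fun t => Re (g t)) exp); auto. apply continuous_exp.
    apply (continuous_comp (fun t => Im (g t)) sin); auto. apply continuous_sin.
Qed.

(* For [t <= 0] this is the junk value [1], since then [ln t = 0]. *)
Definition rpow (t : R) (a : C) : C := Cexp (a * RtoC (ln t)).

Lemma Carg_pos (t : R) : (0 < t)%R -> Carg (RtoC t) = 0%R.
Proof.
  intros Ht. unfold Carg. simpl. destruct (Rle_dec 0 0); [|lra].
  rewrite Cmod_R, Rabs_pos_eq by lra. replace (t / t)%R with 1%R by (field; lra). apply acos_1.
Qed.

(** The argument of a positive real is zero, so principal powers can be replaced by [rpow], whose
    rules involve no choice of branch. *)
Lemma Cpower_RtoC (t : R) (a : C) : (0 < t)%R -> Cpower (RtoC t) a = rpow t a.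
Proof.
  intros Ht. unfold Cpower, Clog, rpow. rewrite Carg_pos by auto.
  rewrite Cmod_R, Rabs_pos_eq by lra. reflexivity.
Qed.

Lemma rpow_add t a b : rpow t (a + b) = rpow t a * rpow t b.
Proof. unfold rpow. rewrite <- Cexp_add. f_equal. ring. Qed.

Lemma rpow_opp t a : rpow t (- a) = / rpow t a.
Proof. unfold rpow. rewrite <- Cexp_inv. f_equal. ring. Qed.

Lemma rpow_neq_0 t a : rpow t a <> 0.
Proof. apply Cexp_neq_0. Qed.

Lemma rpow_0 t : rpow t 0 = 1.
Proof. unfold rpow. rewrite Cmult_0_l. apply Cexp_0. Qed.

Lemma rpow_1_l a : rpow 1 a = 1.
Proof. unfold rpow. rewrite ln_1, Cmult_0_r. apply Cexp_0. Qed.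

Lemma rpow_mult_base s t a : (0 < s)%R -> (0 < t)%R -> rpow (s * t) a = rpow s a * rpow t a.
Proof. intros Hs Ht. unfold rpow. rewrite ln_mult by auto. rewrite RtoC_plus, <- Cexp_add. f_equal. ring. Qed.

Lemma rpow_inv_base t a : (0 < t)%R -> rpow (/ t) a = rpow t (- a).
Proof. intros Ht. unfold rpow. rewrite ln_Rinv by auto. f_equal. rewrite RtoC_opp. ring. Qed.

Lemma rpow_RtoC t (a : R) : (0 < t)%R -> rpow t (RtoC a) = RtoC (Rpower t a).
Proof. intros Ht. unfold rpow, Rpower. rewrite <- RtoC_mult, Cexp_RtoC. reflexivity. Qed.

Lemma rpow_1 t : (0 < t)%R -> rpow t 1 = RtoC t.
Proof. intros Ht. rewrite rpow_RtoC, Rpower_1; auto. Qed.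

Lemma rpow_natC t n : (0 < t)%R -> rpow t (natC n) = RtoC (t ^ n).
Proof. intros Ht. unfold natC. rewrite rpow_RtoC, Rpower_pow; auto. Qed.

Lemma Cmod_rpow t a : (0 < t)%R -> Cmod (rpow t a) = Rpower t (Re a).
Proof. intros Ht. unfold rpow, Rpower. rewrite Cmod_Cexp. f_equal. unfold Re; simpl; ring. Qed.

Lemma is_Cderive_rpow t a : (0 < t)%R -> is_Cderive (fun s => rpow s a) t (a * rpow t (a - 1)).
Proof.
  intros Ht. eapply is_Cderive_eq.
  apply is_Cderive_Cexp. apply is_Cderive_scal. apply is_Cderive_RtoC. apply is_derive_ln; auto.
  replace (a - 1) with (a + - (1)) by ring. rewrite rpow_add, rpow_opp, rpow_1 by auto.
  rewrite RtoC_inv. unfold rpow. ring. lra.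
Qed.

Lemma Ccont_rpow t a : (0 < t)%R -> Ccont (fun s => rpow s a) t.
Proof. intros Ht. eapply is_Cderive_cont. apply is_Cderive_rpow; auto. Qed.

Lemma Ccont_comp {T : UniformSpace} (f : R -> C) (h : T -> R) (x : T) : continuous h x -> Ccont f (h x) -> Ccont (fun t => f (h t)) x.
Proof. intros. apply (continuous_comp (V:=R_UniformSpace) h f); auto. Qed.

Lemma Rpower_pos t a : (0 < Rpower t a)%R.
Proof. apply exp_pos. Qed.

Notation C_RCN := C_R_CompleteNormedModule.

(** Turns the norm estimates for integrals into estimates on moduli. *)
Lemma norm_CR (z : C) : norm (z : C_R_NormedModule) = Cmod z.
Proof.
  destruct z as [x y]. unfold norm; simpl. unfold prod_norm, Cmod; simpl.
  f_equal. 
  rewrite !Rmult_1_r, <- !Rabs_mult. rewrite !Rabs_pos_eq; auto; apply Rle_0_sqr.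
Qed.

Lemma RtoC_m1 : RtoC (-1) = - (1).
Proof. apply C_ext; unfold Re, Im; simpl; lra. Qed.

(** * Complex sequences and series *)

(** Convergence in elementary form, independent of whether C is seen as a real or as a complex
    normed module. *)
Definition is_Clim (s : nat -> C) (l : C) : Prop :=
  forall eps : R, (0 < eps)%R -> exists N : nat, forall n, (N <= n)%nat -> (Cmod (s n - l) < eps)%R.

Lemma Cmod_minus_sym a b : Cmod (a - b) = Cmod (b - a).
Proof. rewrite <- Cmod_opp. f_equal. ring. Qed.

Lemma is_Clim_ext s t l : (forall n, s n = t n) -> is_Clim s l -> is_Clim t l.
Proof. intros E H eps He. destruct (H eps He) as [N HN]. exists N; intros n Hn. rewrite <- E; auto. Qed.

Lemma is_Clim_const c : is_Clim (fun _ => c) c.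
Proof. intros eps He. exists O. intros n _. replace (c - c) with (RtoC 0) by ring. rewrite Cmod_0; auto. Qed.

Lemma is_Clim_plus s t l m : is_Clim s l -> is_Clim t m -> is_Clim (fun n => s n + t n) (l + m).
Proof.
  intros H1 H2 eps He. destruct (H1 (eps/2)%R ltac:(lra)) as [N1 HN1].
  destruct (H2 (eps/2)%R ltac:(lra)) as [N2 HN2]. exists (max N1 N2). intros n Hn.
  replace (s n + t n - (l + m)) with ((s n - l) + (t n - m)) by ring.
  eapply Rle_lt_trans. apply Cmod_triangle. specialize (HN1 n ltac:(lia)). specialize (HN2 n ltac:(lia)). lra.
Qed.

Lemma is_Clim_scal c s l : is_Clim s l -> is_Clim (fun n => c * s n) (c * l).
Proof.
  intros H eps He. pose proof (Cmod_ge_0 c).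
  assert (Hd : (0 < eps / (Cmod c + 1))%R) by (apply Rdiv_lt_0_compat; lra).
  destruct (H _ Hd) as [N HN]. exists N; intros n Hn. specialize (HN n Hn).
  replace (c * s n - c * l) with (c * (s n - l)) by ring. rewrite Cmod_mult.
  apply Rle_lt_trans with ((Cmod c + 1) * Cmod (s n - l))%R.
  apply Rmult_le_compat_r; [apply Cmod_ge_0|lra].
  apply (Rmult_lt_compat_l (Cmod c + 1)) in HN; [|lra].
  replace ((Cmod c + 1) * (eps / (Cmod c + 1)))%R with eps in HN by (field; lra). auto.
Qed.

Lemma is_Clim_minus s t l m : is_Clim s l -> is_Clim t m -> is_Clim (fun n => s n - t n) (l - m).
Proof.
  intros H1 H2. apply (is_Clim_ext (fun n => s n + RtoC (-1) * t n)).
  { intros n. rewrite RtoC_m1. ring. }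
  replace (l - m) with (l + RtoC (-1) * m) by (rewrite RtoC_m1; ring).
  apply is_Clim_plus; auto. apply is_Clim_scal; auto.
Qed.

Lemma is_Clim_unique s l m : is_Clim s l -> is_Clim s m -> l = m.
Proof.
  intros H1 H2. assert (E : Cmod (l - m) = 0%R).
  { apply Rle_antisym; [|apply Cmod_ge_0]. apply Rnot_lt_le; intros Hlt.
    destruct (H1 (Cmod (l-m)/2)%R ltac:(lra)) as [N1 HN1].
    destruct (H2 (Cmod (l-m)/2)%R ltac:(lra)) as [N2 HN2].
    specialize (HN1 (max N1 N2) ltac:(lia)). specialize (HN2 (max N1 N2) ltac:(lia)).
    pose proof (Cmod_triangle (l - s (max N1 N2)) (s (max N1 N2) - m)).
    replace (l - s (max N1 N2) + (s (max N1 N2) - m)) with (l - m) in H by ring.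
    rewrite (Cmod_minus_sym l (s _)) in H. lra. }
  apply Cmod_eq_0 in E. replace l with (l - m + m) by ring. rewrite E; ring.
Qed.

Lemma is_Clim_le (s : nat -> C) l (b : nat -> R) :
  (forall n, (Cmod (s n - l) <= b n)%R) -> is_lim_seq b 0%R -> is_Clim s l.
Proof.
  intros Hb Hl eps He. apply is_lim_seq_spec in Hl. destruct (Hl (mkposreal eps He)) as [N HN].
  exists N; intros n Hn. specialize (HN n Hn). simpl in HN.
  specialize (Hb n). pose proof (Rle_abs (b n - 0)). lra.
Qed.

Lemma is_Clim_shift s l k : is_Clim s l -> is_Clim (fun n => s (n + k)%nat) l.
Proof. intros H eps He. destruct (H eps He) as [N HN]. exists N; intros; apply HN; lia. Qed.

Lemma is_Clim_unshift s l k : is_Clim (fun n => s (n + k)%nat) l -> is_Clim s l.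
Proof. intros H eps He. destruct (H eps He) as [N HN]. exists (N + k)%nat; intros n Hn.
  replace n with ((n - k) + k)%nat by lia. apply HN; lia. Qed.

Lemma is_Clim_bounded s l : is_Clim s l -> exists M, forall n, (Cmod (s n) <= M)%R.
Proof.
  intros H. destruct (H 1%R ltac:(lra)) as [N HN].
  assert (Hfin : forall k, exists M, forall n, (n < k)%nat -> (Cmod (s n) <= M)%R).
  { induction k. exists 0%R. intros; lia. destruct IHk as [M HM]. exists (Rmax M (Cmod (s k))).
    intros n Hn. destruct (Nat.eq_dec n k). subst. apply Rmax_r. eapply Rle_trans; [apply HM; lia|apply Rmax_l]. }
  destruct (Hfin N) as [M HM]. exists (Rmax M (Cmod l + 1)). intros n.
  destruct (Nat.lt_ge_cases n N). eapply Rle_trans; [apply HM; auto|apply Rmax_l].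
  eapply Rle_trans; [|apply Rmax_r]. specialize (HN n H0).
  pose proof (Cmod_triangle (s n - l) l). replace (s n - l + l) with (s n) in H1 by ring. lra.
Qed.

Lemma is_Clim_mult s t l m : is_Clim s l -> is_Clim t m -> is_Clim (fun n => s n * t n) (l * m).
Proof.
  intros H1 H2. destruct (is_Clim_bounded _ _ H2) as [M HM].
  assert (HM0 : (0 <= M)%R) by (eapply Rle_trans; [apply Cmod_ge_0|apply (HM O)]).
  intros eps He. pose proof (Cmod_ge_0 l).
  assert (Hd : (0 < eps / (M + Cmod l + 1))%R) by (apply Rdiv_lt_0_compat; lra).
  destruct (H1 _ Hd) as [N1 HN1]. destruct (H2 _ Hd) as [N2 HN2]. exists (max N1 N2). intros n Hn.
  specialize (HN1 n ltac:(lia)). specialize (HN2 n ltac:(lia)).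
  replace (s n * t n - l * m) with ((s n - l) * t n + l * (t n - m)) by ring.
  eapply Rle_lt_trans. apply Cmod_triangle. rewrite !Cmod_mult.
  set (d := (eps / (M + Cmod l + 1))%R) in *.
  assert (Ed : (eps = d * (M + Cmod l + 1))%R) by (unfold d; field; lra).
  specialize (HM n). pose proof (Cmod_ge_0 (s n - l)). pose proof (Cmod_ge_0 (t n)).
  rewrite Ed.
  
  
  nra.
Qed.

Lemma Cmod_le_sum z : (Cmod z <= Rabs (Re z) + Rabs (Im z))%R.
Proof.
  apply Rsqr_incr_0; [|apply Cmod_ge_0|pose proof (Rabs_pos (Re z)); pose proof (Rabs_pos (Im z)); lra].
  unfold Rsqr. rewrite Cmod_sqr. pose proof (Rabs_pos (Re z)); pose proof (Rabs_pos (Im z)).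
  assert (forall x, Rabs x * Rabs x = x * x)%R. { intros x. rewrite <- Rabs_mult. apply Rabs_pos_eq. apply Rle_0_sqr. }
  pose proof (H1 (Re z)); pose proof (H1 (Im z)). nra.
Qed.

Lemma im_le_Cmod z : (Rabs (Im z) <= Cmod z)%R.
Proof. pose proof (Rmax_Cmod z). eapply Rle_trans; [|apply H]. apply Rmax_r. Qed.

Lemma is_Clim_Cauchy (s : nat -> C) :
  (forall eps, (0 < eps)%R -> exists N, forall n m, (N <= n)%nat -> (N <= m)%nat -> (Cmod (s n - s m) < eps)%R) ->
  exists l, is_Clim s l.
Proof.
  intros H.
  assert (H1 : ex_finite_lim_seq (fun n => Re (s n))).
  { apply ex_lim_seq_cauchy_corr. intros eps. destruct (H eps (cond_pos eps)) as [N HN]. exists N. intros n m Hn Hm.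
    eapply Rle_lt_trans; [|apply (HN n m Hn Hm)]. apply (re_le_Cmod (s n - s m)). }
  assert (H2 : ex_finite_lim_seq (fun n => Im (s n))).
  { apply ex_lim_seq_cauchy_corr. intros eps. destruct (H eps (cond_pos eps)) as [N HN]. exists N. intros n m Hn Hm.
    eapply Rle_lt_trans; [|apply (HN n m Hn Hm)]. apply (im_le_Cmod (s n - s m)). }
  destruct H1 as [a Ha]. destruct H2 as [b Hb]. exists (a, b). intros eps He.
  apply is_lim_seq_spec in Ha. apply is_lim_seq_spec in Hb.
  destruct (Ha (mkposreal (eps/2) ltac:(lra))) as [N1 HN1].
  destruct (Hb (mkposreal (eps/2) ltac:(lra))) as [N2 HN2]. exists (max N1 N2). intros n Hn.
  specialize (HN1 n ltac:(lia)). specialize (HN2 n ltac:(lia)). simpl in *.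
  eapply Rle_lt_trans. apply Cmod_le_sum. unfold Re, Im in *; simpl. unfold Rminus in *. lra.
Qed.

Lemma is_Clim_Re s l : is_Clim s l -> is_lim_seq (fun n => Re (s n)) (Re l).
Proof.
  intros H. apply is_lim_seq_spec. intros eps. destruct (H eps (cond_pos eps)) as [N HN]. exists N. intros n Hn.
  eapply Rle_lt_trans; [|apply (HN n Hn)]. apply (re_le_Cmod (s n - l)).
Qed.

Lemma is_Clim_Im s l : is_Clim s l -> is_lim_seq (fun n => Im (s n)) (Im l).
Proof.
  intros H. apply is_lim_seq_spec. intros eps. destruct (H eps (cond_pos eps)) as [N HN]. exists N. intros n Hn.
  eapply Rle_lt_trans; [|apply (HN n Hn)]. apply (im_le_Cmod (s n - l)).
Qed.

(** The upper bound is exclusive and the empty sum is allowed; [sum_n] includes its last index,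
    hence the successors in the conversions. *)
Fixpoint Csum (a : nat -> C) (n : nat) : C :=
  match n with O => 0 | S k => Csum a k + a k end.

Lemma Csum_ext a b n : (forall i, (i < n)%nat -> a i = b i) -> Csum a n = Csum b n.
Proof. induction n; simpl; intros; auto. rewrite IHn, H; auto. Qed.

Lemma Csum_scal c a n : Csum (fun i => c * a i) n = c * Csum a n.
Proof. induction n; simpl. ring. rewrite IHn; ring. Qed.

Lemma Csum_plus a b n : Csum (fun i => a i + b i) n = Csum a n + Csum b n.
Proof. induction n; simpl. ring. rewrite IHn; ring. Qed.

Lemma Csum_Cmod a b n : (forall i, (i < n)%nat -> (Cmod (a i) <= b i)%R) -> (Cmod (Csum a n) <= Re (Csum (fun i => RtoC (b i)) n))%R.
Proof.
  induction n; intros; simpl. rewrite Cmod_0; apply Rle_refl.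
  eapply Rle_trans. apply Cmod_triangle. specialize (IHn ltac:(auto)). specialize (H n ltac:(auto)). unfold Re in *; lra.
Qed.

Definition is_Cseries (a : nat -> C) (l : C) := is_Clim (Csum a) l.

Lemma Csum_sum_n a n : Csum a (S n) = sum_n (G := C_AbelianGroup) a n.
Proof.
  induction n. simpl. rewrite sum_O. ring.
  rewrite sum_Sn, <- IHn. reflexivity.
Qed.

Lemma is_Cseries_is_series (a : nat -> C) (l : C) : is_Cseries a l -> is_series (V := C_NormedModule) a l.
Proof.
  intros H. apply filterlim_locally. intros eps.
  destruct (H eps (cond_pos eps)) as [N HN]. exists N. intros n Hn.
  rewrite <- Csum_sum_n. specialize (HN (S n) ltac:(lia)).
  apply C_NormedModule_mixin_compat1. exact HN.
Qed.

Lemma Csum_Re a n : Re (Csum a (S n)) = sum_n (fun i => Re (a i)) n.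
Proof.
  induction n. rewrite sum_O. unfold Re; simpl; ring.
  rewrite sum_Sn, <- IHn. reflexivity.
Qed.
Lemma Csum_Im a n : Im (Csum a (S n)) = sum_n (fun i => Im (a i)) n.
Proof.
  induction n. rewrite sum_O. unfold Im; simpl; ring.
  rewrite sum_Sn, <- IHn. reflexivity.
Qed.

Lemma is_lim_seq_S (s : nat -> R) (l : R) : is_lim_seq s l -> is_lim_seq (fun n => s (S n)) l.
Proof. apply is_lim_seq_incr_1. Qed.

Lemma is_Cseries_Re a l : is_Cseries a l -> is_series (fun i => Re (a i)) (Re l).
Proof.
  intros H. change (is_lim_seq (sum_n (fun i => Re (a i))) (Re l)). apply (is_lim_seq_ext (fun n => Re (Csum a (S n)))). intros n. apply Csum_Re.
  apply (is_lim_seq_S (fun n => Re (Csum a n))). apply is_Clim_Re; auto.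
Qed.
Lemma is_Cseries_Im a l : is_Cseries a l -> is_series (fun i => Im (a i)) (Im l).
Proof.
  intros H. change (is_lim_seq (sum_n (fun i => Im (a i))) (Im l)). apply (is_lim_seq_ext (fun n => Im (Csum a (S n)))). intros n. apply Csum_Im.
  apply (is_lim_seq_S (fun n => Im (Csum a n))). apply is_Clim_Im; auto.
Qed.

Lemma is_Cseries_CSeries a l : is_Cseries a l -> CSeries a = l.
Proof.
  intros H. apply C_ext; unfold CSeries; simpl; apply is_series_unique.
  apply is_Cseries_Re; auto. apply is_Cseries_Im; auto.
Qed.

Lemma is_Cseries_parts a l : is_series (fun i => Re (a i)) (Re l) -> is_series (fun i => Im (a i)) (Im l) -> is_Cseries a l.
Proof.
  intros H1 H2. apply (is_Clim_unshift _ _ 1). 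
  assert (K1 : is_lim_seq (fun n => Re (Csum a (S n))) (Re l)).
  { eapply is_lim_seq_ext; [|exact H1]. intros n; symmetry. apply Csum_Re. }
  assert (K2 : is_lim_seq (fun n => Im (Csum a (S n))) (Im l)).
  { eapply is_lim_seq_ext; [|exact H2]. intros n; symmetry. apply Csum_Im. }
  apply is_lim_seq_spec in K1. apply is_lim_seq_spec in K2. intros eps He.
  destruct (K1 (mkposreal (eps/2) ltac:(lra))) as [N1 HN1].
  destruct (K2 (mkposreal (eps/2) ltac:(lra))) as [N2 HN2]. exists (max N1 N2). intros n Hn.
  specialize (HN1 n ltac:(lia)). specialize (HN2 n ltac:(lia)). simpl in HN1, HN2.
  replace (n + 1)%nat with (S n) by lia.
  eapply Rle_lt_trans. apply Cmod_le_sum. unfold Re, Im in *; simpl. unfold Rminus in *. lra.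
Qed.

Lemma is_Cseries_abs (a : nat -> C) (b : nat -> R) :
  (forall n, (Cmod (a n) <= b n)%R) -> ex_series b -> exists l, is_Cseries a l.
Proof.
  intros Hb Hs.
  destruct (ex_series_le (V:=R_CompleteNormedModule) (fun i => Re (a i)) b) as [x Hx]; auto.
  { intros n. eapply Rle_trans; [|apply Hb]. apply re_le_Cmod. }
  destruct (ex_series_le (V:=R_CompleteNormedModule) (fun i => Im (a i)) b) as [y Hy]; auto.
  { intros n. eapply Rle_trans; [|apply Hb]. apply im_le_Cmod. }
  exists (x, y). apply is_Cseries_parts; auto.
Qed.

Lemma is_Cseries_ext a b l : (forall n, a n = b n) -> is_Cseries a l -> is_Cseries b l.
Proof. intros E. apply is_Clim_ext. intros n. apply Csum_ext. auto. Qed.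
Lemma is_Cseries_scal c a l : is_Cseries a l -> is_Cseries (fun n => c * a n) (c * l).
Proof. intros H. apply (is_Clim_ext (fun n => c * Csum a n)). intros; symmetry; apply Csum_scal. apply is_Clim_scal; auto. Qed.
Lemma is_Cseries_plus a b l m : is_Cseries a l -> is_Cseries b m -> is_Cseries (fun n => a n + b n) (l + m).
Proof. intros H K. apply (is_Clim_ext (fun n => Csum a n + Csum b n)). intros; symmetry; apply Csum_plus. apply is_Clim_plus; auto. Qed.

Lemma is_Clim_Cmod_le s l M : is_Clim s l -> (forall n, (Cmod (s n) <= M)%R) -> (Cmod l <= M)%R.
Proof.
  intros H HM. apply Rnot_lt_le; intros Hlt. destruct (H (Cmod l - M)%R ltac:(lra)) as [N HN].
  specialize (HN N (le_n _)). specialize (HM N). pose proof (Cmod_triangle (l - s N) (s N)).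
  replace (l - s N + s N) with l in H0 by ring. rewrite Cmod_minus_sym in H0. lra.
Qed.

Lemma Csum_le_series (b : nat -> R) S n : (forall i, (0 <= b i)%R) -> is_series b S -> (Re (Csum (fun i => RtoC (b i)) n) <= S)%R.
Proof.
  intros Hp Hs. 
  assert (Hmono : forall k, (Re (Csum (fun i => RtoC (b i)) n) <= Re (Csum (fun i => RtoC (b i)) (n + k)))%R).
  { induction k. rewrite Nat.add_0_r; apply Rle_refl. rewrite Nat.add_succ_r. 
    specialize (Hp (n+k)%nat). unfold Re in *; simpl. lra. }
  assert (L : is_lim_seq (fun k => sum_n b (n + k)) S).
  { apply (is_lim_seq_ext (fun k => sum_n b (k + n))). intros; f_equal; lia. apply is_lim_seq_incr_n. exact Hs. }
  apply (is_lim_seq_le (fun _ => Re (Csum (fun i => RtoC (b i)) n)) (fun k => sum_n b (n + k)) (Finite (Re (Csum (fun i => RtoC (b i)) n))) (Finite S)).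
  2: apply is_lim_seq_const. 2: exact L.
  intros k. eapply Rle_trans. apply (Hmono (Datatypes.S k)).
  rewrite Nat.add_succ_r, Csum_Re. apply Req_le. apply sum_n_ext. reflexivity.
Qed.

Lemma is_Cseries_Cmod_le a l (b : nat -> R) S : is_Cseries a l -> (forall n, (Cmod (a n) <= b n)%R) -> is_series b S -> (Cmod l <= S)%R.
Proof.
  intros H Hb Hs. apply (is_Clim_Cmod_le _ _ _ H). intros n. eapply Rle_trans. apply Csum_Cmod. intros; apply Hb.
  apply Csum_le_series; auto. intros i. eapply Rle_trans; [apply Cmod_ge_0|apply Hb].
Qed.

Lemma Csum_add_tail a n k : Csum a (n + k) = Csum a n + Csum (fun i => a (n + i)%nat) k.
Proof. induction k. rewrite Nat.add_0_r; simpl; ring. rewrite Nat.add_succ_r. simpl. rewrite IHk. ring. Qed.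

(** Weierstrass test with its remainder: the bound depends on the majorant only, so convergence is
    uniform in any parameter contained in [a]. *)
Lemma is_Cseries_tail_le a l (b : nat -> R) S n : is_Cseries a l -> (forall n, (Cmod (a n) <= b n)%R) -> is_series b S ->
  (Cmod (l - Csum a n) <= S - Re (Csum (fun i => RtoC (b i)) n))%R.
Proof.
  intros H Hb Hs.
  assert (H' : is_Clim (fun k => Csum a (k + n) - Csum a n) (l - Csum a n)).
  { apply is_Clim_minus. apply is_Clim_shift; auto. apply is_Clim_const. }
  apply (is_Clim_Cmod_le _ _ _ H'). intros k. rewrite Nat.add_comm, Csum_add_tail.
  replace (Csum a n + Csum (fun i => a (n + i)%nat) k - Csum a n) with (Csum (fun i => a (n + i)%nat) k) by ring.
  eapply Rle_trans. apply Csum_Cmod. intros; apply Hb.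
  assert (Hpos : forall i, (0 <= b i)%R) by (intros i; eapply Rle_trans; [apply Cmod_ge_0|apply Hb]).
  pose proof (Csum_le_series b S (n + k) Hpos Hs). rewrite Csum_add_tail in H0. unfold Re in *; simpl in *. lra.
Qed.

(** * Improper integrals on the half-line *)

(** Only the open half-line is concerned, since the integrands may be singular at 0. *)
Definition Ccont_pos (f : R -> C) : Prop := forall t : R, (0 < t)%R -> Ccont f t.

Definition CRInt (f : R -> C) (p q : R) : C := RInt (V := C_RCN) f p q.

Definition is_CInt (f : R -> C) (l : C) : Prop :=
  is_RInt_gen (V := C_R_NormedModule) f (at_right 0) (Rbar_locally p_infty) l.

Lemma is_CInt_Cint f l : is_CInt f l -> Cint_0_oo f = l.
Proof. intros H. unfold Cint_0_oo. apply (is_RInt_gen_unique (V:=C_RCN)); auto. Qed.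

Lemma is_CInt_unique f l m : is_CInt f l -> is_CInt f m -> l = m.
Proof. intros H K. rewrite <- (is_CInt_Cint _ _ H). apply is_CInt_Cint; auto. Qed.

Lemma is_CInt_ext f g l : (forall t, (0 < t)%R -> f t = g t) -> is_CInt f l -> is_CInt g l.
Proof.
  intros E H. unfold is_CInt in *. eapply (is_RInt_gen_ext (V:=C_R_NormedModule)); [|exact H].
  exists (fun x => (0 < x)%R) (fun x => (0 < x)%R).
  - exists (mkposreal 1 Rlt_0_1). intros y _ Hy; auto.
  - exists 0%R. intros; auto.
  - intros x y Hx Hy t Ht. simpl in Ht. apply E. assert (0 < Rmin x y)%R by (apply Rmin_glb_lt; auto). lra.
Qed.

Lemma Ccont_pos_ex f p q : Ccont_pos f -> (0 < p)%R -> (0 < q)%R -> ex_RInt (V := C_R_NormedModule) f p q.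
Proof.
  intros Hf Hp Hq. apply (ex_RInt_continuous (V:=C_RCN)). intros z Hz. apply Hf.
  assert (0 < Rmin p q)%R by (apply Rmin_glb_lt; auto). lra.
Qed.

Lemma Ccont_pos_is f p q : Ccont_pos f -> (0 < p)%R -> (0 < q)%R -> is_RInt (V := C_R_NormedModule) f p q (CRInt f p q).
Proof. intros. apply (RInt_correct (V:=C_RCN)). apply Ccont_pos_ex; auto. Qed.

(** The product of the filters at the two ends, unfolded into inequalities on the end points;
    [is_CInt_elim] is the converse. *)
Lemma is_CInt_intro f l : Ccont_pos f ->
  (forall eps, (0 < eps)%R -> exists d M, (0 < d)%R /\ forall p q, (0 < p < d)%R -> (M < q)%R -> (0 < q)%R -> (Cmod (CRInt f p q - l) < eps)%R) ->
  is_CInt f l.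
Proof.
  intros Hf H P HP. destruct HP as [eps HP].
  destruct (H eps (cond_pos eps)) as (d & M & Hd & HM).
  exists (fun x => 0 < x < d)%R (fun x => Rmax M 0 < x)%R.
  - exists (mkposreal d Hd). intros y Hy Hy0. split; auto.
    unfold ball in Hy; simpl in Hy. unfold AbsRing_ball, abs, minus, plus, opp in Hy; simpl in Hy.
    rewrite Ropp_0, Rplus_0_r, Rabs_pos_eq in Hy; lra.
  - exists (Rmax M 0). auto.
  - intros p q Hp Hq. exists (CRInt f p q). 
    pose proof (Rmax_l M 0); pose proof (Rmax_r M 0). split.
    apply Ccont_pos_is; auto; lra. apply HP. apply C_NormedModule_mixin_compat1.
    apply HM; auto; lra.
Qed.

Lemma is_CInt_elim f l : Ccont_pos f -> is_CInt f l ->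
  forall eps, (0 < eps)%R -> exists d M, (0 < d)%R /\ forall p q, (0 < p < d)%R -> (M < q)%R -> (0 < q)%R -> (Cmod (CRInt f p q - l) < eps)%R.
Proof.
  intros Hf H eps He.
  (* Balls of [C_UniformSpace] are products of real balls, so each component is required to within
     [eps / 2]. *)
  assert (He2 : (0 < eps / 2)%R) by lra.
  destruct (H (ball (M := C_UniformSpace) l (mkposreal _ He2))) as [P Q HP HQ HPQ].
  { exists (mkposreal _ He2). auto. }
  destruct HP as [d HP]. destruct HQ as [M HQ].
  exists d, M. split. apply cond_pos. intros p q Hp Hq Hq0.
  destruct (HPQ p q) as [y [Hy1 Hy2]].
  - apply HP; [|lra]. unfold ball; simpl. unfold AbsRing_ball, abs, minus, plus, opp; simpl.
    rewrite Ropp_0, Rplus_0_r, Rabs_pos_eq; lra.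
  - apply HQ; auto.
  - simpl in Hy1. apply (is_RInt_unique (V:=C_RCN)) in Hy1. unfold CRInt. rewrite Hy1.
    destruct l as [l1 l2], y as [y1 y2]. destruct Hy2 as [B1 B2]. 
    unfold ball in B1, B2; simpl in B1, B2. unfold AbsRing_ball, abs, minus, plus, opp in B1, B2; simpl in B1, B2.
    eapply Rle_lt_trans. apply Cmod_le_sum. unfold Re, Im; simpl. lra.
Qed.

Lemma CRInt_Chasles f p q r : Ccont_pos f -> (0 < p)%R -> (0 < q)%R -> (0 < r)%R -> CRInt f p q + CRInt f q r = CRInt f p r.
Proof. intros. apply (RInt_Chasles (V:=C_RCN)); apply Ccont_pos_ex; auto. Qed.

Lemma Ccont_pos_const c : Ccont_pos (fun _ => c).
Proof. intros t _. apply Ccont_const. Qed.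
Lemma Ccont_pos_mult f g : Ccont_pos f -> Ccont_pos g -> Ccont_pos (fun t => f t * g t).
Proof. intros Hf Hg t Ht. apply Ccont_mult; auto. Qed.
Lemma Ccont_pos_plus f g : Ccont_pos f -> Ccont_pos g -> Ccont_pos (fun t => f t + g t).
Proof. intros Hf Hg t Ht. apply Ccont_plus; auto. Qed.
Lemma Ccont_pos_scal c f : Ccont_pos f -> Ccont_pos (fun t => c * f t).
Proof. intros Hf. apply Ccont_pos_mult; auto. apply Ccont_pos_const. Qed.
Lemma Ccont_pos_rpow a : Ccont_pos (fun t => rpow t a).
Proof. intros t Ht. apply Ccont_rpow; auto. Qed.
Lemma Ccont_pos_rpow1 a : Ccont_pos (fun t => rpow (1 + t) a).
Proof. intros t Ht. apply (Ccont_comp (fun t => rpow t a) (fun t => (1 + t)%R)). 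
  apply (continuous_plus (V:=R_NormedModule)). apply continuous_const. apply continuous_id. apply Ccont_rpow; lra. Qed.
Lemma Ccont_pos_Cexp g : Ccont_pos g -> Ccont_pos (fun t => Cexp (g t)).
Proof. intros Hg t Ht. apply Ccont_Cexp; auto. Qed.
Lemma Ccont_pos_id : Ccont_pos (fun t => RtoC t).
Proof. intros t _. apply (Ccont_RtoC (fun t => t)). apply continuous_id. Qed.
Lemma Ccont_pos_sum (f : nat -> R -> C) n : (forall i, Ccont_pos (f i)) -> Ccont_pos (fun t => Csum (fun i => f i t) n).
Proof. intros H. induction n; simpl. apply Ccont_pos_const. apply Ccont_pos_plus; auto. Qed.

(** [C_R_NormedModule] has real scalars only; a complex factor is therefore moved through the
    integral by components. *)
Lemma is_RInt_cmult (c : C) f p q l : is_RInt (V := C_R_NormedModule) f p q l ->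
  is_RInt (V := C_R_NormedModule) (fun t => c * f t) p q (c * l).
Proof.
  intros H.
  pose proof (is_RInt_fct_extend_fst (U:=R_NormedModule) (V:=R_NormedModule) f p q l H) as H1.
  pose proof (is_RInt_fct_extend_snd (U:=R_NormedModule) (V:=R_NormedModule) f p q l H) as H2.
  destruct c as [c1 c2].
  apply (is_RInt_fct_extend_pair (U:=R_NormedModule) (V:=R_NormedModule)).
  - apply (is_RInt_minus (V:=R_NormedModule) (fun t => (c1 * fst (f t))%R) (fun t => (c2 * snd (f t))%R));
    apply (is_RInt_scal (V:=R_NormedModule)); auto.
  - apply (is_RInt_plus (V:=R_NormedModule) (fun t => (c1 * snd (f t))%R) (fun t => (c2 * fst (f t))%R));
    apply (is_RInt_scal (V:=R_NormedModule)); auto.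
Qed.

Lemma CRInt_scal c f p q : Ccont_pos f -> (0 < p)%R -> (0 < q)%R -> CRInt (fun t => c * f t) p q = c * CRInt f p q.
Proof. intros. apply (is_RInt_unique (V:=C_RCN)). apply is_RInt_cmult. apply Ccont_pos_is; auto. Qed.

Lemma CRInt_plus f g p q : Ccont_pos f -> Ccont_pos g -> (0 < p)%R -> (0 < q)%R -> CRInt (fun t => f t + g t) p q = CRInt f p q + CRInt g p q.
Proof. intros. apply (is_RInt_unique (V:=C_RCN)). apply (is_RInt_plus (V:=C_R_NormedModule)); apply Ccont_pos_is; auto. Qed.

Lemma is_CInt_scal c f l : Ccont_pos f -> is_CInt f l -> is_CInt (fun t => c * f t) (c * l).
Proof.
  intros Hf H. apply is_CInt_intro. apply Ccont_pos_scal; auto. intros eps He.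
  pose proof (Cmod_ge_0 c).
  assert (Hd : (0 < eps / (Cmod c + 1))%R) by (apply Rdiv_lt_0_compat; lra).
  destruct (is_CInt_elim f l Hf H _ Hd) as (d & M & Hd0 & HM). exists d, M. split; auto.
  intros p q Hp Hq Hq0. rewrite CRInt_scal by (auto; lra).
  replace (c * CRInt f p q - c * l) with (c * (CRInt f p q - l)) by ring. rewrite Cmod_mult.
  specialize (HM p q Hp Hq Hq0).
  apply Rle_lt_trans with ((Cmod c + 1) * Cmod (CRInt f p q - l))%R.
  apply Rmult_le_compat_r; [apply Cmod_ge_0|lra].
  apply (Rmult_lt_compat_l (Cmod c + 1)) in HM; [|lra].
  replace ((Cmod c + 1) * (eps / (Cmod c + 1)))%R with eps in HM by (field; lra). auto.
Qed.

Lemma is_CInt_plus f g l m : is_CInt f l -> is_CInt g m -> is_CInt (fun t => f t + g t) (l + m).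
Proof. intros Hf Hg. exact (@is_RInt_gen_plus C_R_NormedModule _ _ _ _ f g l m Hf Hg). Qed.

Lemma is_CInt_0 : is_CInt (fun _ => 0) 0.
Proof.
  apply is_CInt_intro. apply Ccont_pos_const. intros eps He. exists 1%R, 1%R. split. lra. intros p q Hp Hq Hq0.
  rewrite (is_RInt_unique (V:=C_RCN) _ p q (RtoC 0)).
  replace (0 - 0) with (RtoC 0) by ring. rewrite Cmod_0. auto.
  eapply (is_RInt_ext (V:=C_R_NormedModule)). 2: replace (RtoC 0) with (scal (q - p)%R (RtoC 0 : C_R_NormedModule)).
  2: apply (is_RInt_const (V:=C_R_NormedModule)). intros; reflexivity. 
  apply (scal_zero_r (V:=C_R_NormedModule)).
Qed.

Lemma is_CInt_csum (f : nat -> R -> C) (l : nat -> C) n : (forall i, is_CInt (f i) (l i)) ->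
  is_CInt (fun t => Csum (fun i => f i t) n) (Csum l n).
Proof. intros H. induction n; simpl. apply is_CInt_0. apply is_CInt_plus; auto. Qed.

(* Every integrand below is bounded by a multiple of the derivative [dsat a] of the bounded
   increasing function [t^a / (1 + t^a)]: tails are then controlled by explicit values. *)
Definition sat (a t : R) : R := (Rpower t a / (1 + Rpower t a))%R.
Definition dsat (a t : R) : R := (a * Rpower t (a - 1) / ((1 + Rpower t a) * (1 + Rpower t a)))%R.

Lemma sat_derive a t : (0 < t)%R -> is_derive (sat a) t (dsat a t).
Proof.
  intros Ht. unfold sat, dsat. pose proof (Rpower_pos t a).
  assert (D : is_derive (fun s => Rpower s a) t (a * Rpower t (a - 1))%R).
  { apply is_derive_Reals. apply derivable_pt_lim_power; auto. }
  assert (D1 : is_derive (fun s => (1 + Rpower s a)%R) t (a * Rpower t (a - 1))%R).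
  { eapply is_derive_val. apply (is_derive_plus (V:=R_NormedModule) (fun _ => 1%R)). apply @is_derive_const. exact D.
    unfold plus, zero; simpl; ring. }
  eapply is_derive_val. apply is_derive_div. exact D. exact D1. lra. cbv beta. field. lra.
Qed.

Lemma Rpower_cont a t : (0 < t)%R -> continuous (fun s => Rpower s a) t.
Proof.
  intros Ht. apply (ex_derive_continuous (K:=R_AbsRing) (V:=R_NormedModule)).
  eexists. apply is_derive_Reals. apply derivable_pt_lim_power; auto.
Qed.

Lemma dsat_cont a t : (0 < t)%R -> continuous (dsat a) t.
Proof.
  intros Ht. pose proof (Rpower_pos t a).
  assert (K : continuous (fun s => (1 + Rpower s a)%R) t).
  { apply (continuous_plus (V:=R_NormedModule)). apply continuous_const. apply Rpower_cont; auto. }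
  apply (continuous_mult (K:=R_AbsRing)). apply (continuous_mult (K:=R_AbsRing)).
  apply continuous_const. apply Rpower_cont; auto.
  apply (continuous_comp _ Rinv). apply (continuous_mult (K:=R_AbsRing)); auto.
  apply continuous_Rinv. nra.
Qed.

Lemma sat_bounds a t : (0 < sat a t < 1)%R.
Proof.
  unfold sat. pose proof (Rpower_pos t a). split. apply Rdiv_lt_0_compat; lra.
  apply Rmult_lt_reg_r with (1 + Rpower t a)%R. lra. field_simplify; lra.
Qed.

Lemma Rpower_incr_base a s t : (0 <= a)%R -> (0 < s <= t)%R -> (Rpower s a <= Rpower t a)%R.
Proof. intros Ha Hs. apply Rle_Rpower_l; auto. Qed.

Lemma sat_mono a s t : (0 <= a)%R -> (0 < s <= t)%R -> (sat a s <= sat a t)%R.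
Proof.
  intros Ha Hs. pose proof (Rpower_incr_base a s t Ha Hs). unfold sat.
  pose proof (Rpower_pos s a). 
  apply Rmult_le_reg_r with ((1 + Rpower s a) * (1 + Rpower t a))%R. nra. field_simplify; try lra. 
Qed.

Lemma sat_at_0 a eps : (0 < a)%R -> (0 < eps)%R -> exists d, (0 < d)%R /\ forall p, (0 < p < d)%R -> (sat a p < eps)%R.
Proof.
  (* This is [eps^(1/a)], the point where [t^a] reaches [eps]; its counterpart at infinity is
     [eps^(-1/a)]. *)
  intros Ha He. exists (exp (ln eps / a)). split. apply exp_pos. intros p Hp.
  apply Rle_lt_trans with (Rpower p a).
  - unfold sat. pose proof (Rpower_pos p a). apply Rmult_le_reg_r with (1 + Rpower p a)%R. lra. field_simplify; nra.
  - rewrite <- (exp_ln eps) by auto. apply exp_increasing.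
    assert (ln p < ln eps / a)%R. { rewrite <- (ln_exp (ln eps / a)). apply ln_increasing; lra. }
    apply (Rmult_lt_compat_l a) in H; auto. replace (a * (ln eps / a))%R with (ln eps) in H by (field; lra). lra.
Qed.

Lemma sat_at_oo a eps : (0 < a)%R -> (0 < eps)%R -> exists M, (0 < M)%R /\ forall q, (M < q)%R -> (1 - sat a q < eps)%R.
Proof.
  intros Ha He. exists (exp (- ln eps / a)). split. apply exp_pos. intros q Hq.
  
  assert (K : (/ eps < Rpower q a)%R).
  { rewrite <- (exp_ln (/ eps)) by (apply Rinv_0_lt_compat; auto). apply exp_increasing.
    rewrite ln_Rinv by auto. assert (- ln eps / a < ln q)%R. { rewrite <- (ln_exp (- ln eps / a)). apply ln_increasing; auto. apply exp_pos. }
    apply (Rmult_lt_compat_l a) in H; auto. replace (a * (- ln eps / a))%R with (- ln eps)%R in H by (field; lra). lra. }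
  unfold sat. pose proof (Rpower_pos q a). apply Rmult_lt_reg_r with (1 + Rpower q a)%R. lra.
  replace ((1 - Rpower q a / (1 + Rpower q a)) * (1 + Rpower q a))%R with 1%R by (field; lra).
  apply (Rmult_lt_compat_l eps) in K; auto. rewrite Rinv_r in K by lra. nra.
Qed.

Definition dominated (a K : R) (f : R -> C) : Prop := forall t, (0 < t)%R -> (Cmod (f t) <= K * dsat a t)%R.

Lemma dsat_pos a t : (0 < a)%R -> (0 < dsat a t)%R.
Proof. intros. pose proof (Rpower_pos t a). pose proof (Rpower_pos t (a-1)). apply Rdiv_lt_0_compat; nra. Qed.

Lemma dominated_K_pos a K f : (0 < a)%R -> dominated a K f -> (0 <= K)%R.
Proof.
  intros Ha H. specialize (H 1%R Rlt_0_1). pose proof (dsat_pos a 1 Ha). pose proof (Cmod_ge_0 (f 1%R)).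
  apply Rnot_lt_le; intros Hlt. nra.
Qed.

(** A majorant given as a derivative bounds the integral by an increment of its primitive, so no
    integral of the majorant has to be computed. *)
Lemma CRInt_norm_le f (g dg : R -> R) p q : Ccont_pos f -> (0 < p <= q)%R ->
  (forall t, (p <= t <= q)%R -> is_derive g t (dg t)) -> (forall t, (p <= t <= q)%R -> continuous dg t) ->
  (forall t, (p <= t <= q)%R -> (Cmod (f t) <= dg t)%R) -> (Cmod (CRInt f p q) <= g q - g p)%R.
Proof.
  intros Hf Hp Hg Hdg H. rewrite <- norm_CR.
  apply (norm_RInt_le (V:=C_R_NormedModule) f dg p q).
  - lra.
  - intros x Hx. rewrite norm_CR. auto.
  - apply Ccont_pos_is; auto; lra.
  - apply (is_RInt_derive (V:=R_CompleteNormedModule)); rewrite Rmin_left, Rmax_right by lra; auto.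
Qed.

Lemma CRInt_dominated_le f a K p q : Ccont_pos f -> (0 < a)%R -> dominated a K f -> (0 < p <= q)%R -> (Cmod (CRInt f p q) <= K * (sat a q - sat a p))%R.
Proof.
  intros Hf Ha Hd Hp. replace (K * (sat a q - sat a p))%R with (K * sat a q - K * sat a p)%R by ring.
  apply (CRInt_norm_le f (fun t => K * sat a t)%R (fun t => K * dsat a t)%R); auto.
  - intros t Ht. apply (is_derive_scal (sat a) t K). apply sat_derive; lra.
  - intros t Ht. apply (continuous_mult (K:=R_AbsRing)). apply continuous_const. apply dsat_cont; lra.
  - intros t Ht. apply Hd; lra.
Qed.

(** The pieces cut off cost at most [K * sat a p] near 0 and [K * (1 - sat a q)] near infinity,
    whatever [p'] and [q'] are. *)
Lemma CRInt_dominated_diff f a K p q p' q' : Ccont_pos f -> (0 < a)%R -> dominated a K f -> (0 < p' <= p)%R -> (p <= q <= q')%R ->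
  (Cmod (CRInt f p' q' - CRInt f p q) <= K * (sat a p + 1 - sat a q))%R.
Proof.
  intros Hf Ha Hd Hp Hq. pose proof (dominated_K_pos a K f Ha Hd).
  replace (CRInt f p' q' - CRInt f p q) with (CRInt f p' p + CRInt f q q').
  2:{ rewrite <- (CRInt_Chasles f p' p q'), <- (CRInt_Chasles f p q q') by (auto; lra). ring. }
  eapply Rle_trans. apply Cmod_triangle.
  pose proof (CRInt_dominated_le f a K p' p Hf Ha Hd ltac:(lra)). pose proof (CRInt_dominated_le f a K q q' Hf Ha Hd ltac:(lra)).
  pose proof (sat_bounds a p'). pose proof (sat_bounds a q'). nra.
Qed.

(** The integrals over [[1/(n+1), n+1]] form a Cauchy sequence. The truncation error is kept in the
    conclusion because it is the same for all functions sharing [a] and [K]. *)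
Lemma dominated_ex_CInt_strong f a K : Ccont_pos f -> (0 < a)%R -> dominated a K f ->
  exists l, is_CInt f l /\ forall p q, (0 < p <= q)%R -> (Cmod (l - CRInt f p q) <= K * (sat a p + 1 - sat a q))%R.
Proof.
  intros Hf Ha Hd. pose proof (dominated_K_pos a K f Ha Hd) as HK.
  set (s := fun n : nat => CRInt f (/ (INR n + 1)) (INR n + 1)).
  assert (Hs : forall p q, (0 < p <= q)%R -> exists N, forall n, (N <= n)%nat -> (Cmod (s n - CRInt f p q) <= K * (sat a p + 1 - sat a q))%R).
  { intros p q Hp. destruct (nfloor_ex (Rmax (/ p) q)) as [N HN].
    { apply Rle_trans with q. lra. apply Rmax_r. }
    exists N. intros n Hn. apply le_INR in Hn. pose proof (Rmax_l (/p) q). pose proof (Rmax_r (/p) q).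
    
    apply CRInt_dominated_diff; auto; [split|lra]. apply Rinv_0_lt_compat; lra.
    rewrite <- (Rinv_inv p). apply Rinv_le_contravar. apply Rinv_0_lt_compat; lra. lra. }
  assert (Hpq : forall eps, (0 < eps)%R -> exists p q, (0 < p <= q)%R /\ (K * (sat a p + 1 - sat a q) < eps)%R
     /\ forall p' q', (0 < p' <= p)%R -> (q <= q')%R -> (K * (sat a p' + 1 - sat a q') < eps)%R).
  { intros eps He. assert (He' : (0 < eps / (4 * (K + 1)))%R) by (apply Rdiv_lt_0_compat; lra).
    destruct (sat_at_0 a _ Ha He') as (d & Hd0 & Hdd). destruct (sat_at_oo a _ Ha He') as (M & HM0 & HM).
    assert (X : forall p' q', (0 < p' < d)%R -> (M < q')%R -> (K * (sat a p' + 1 - sat a q') < eps)%R).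
    { intros p' q' Hp' Hq'. specialize (Hdd p' Hp'). specialize (HM q' Hq').
      set (e := (eps / (4 * (K + 1)))%R) in *. assert (eps = e * (4 * (K + 1)))%R by (unfold e; field; lra).
      nra. }
    exists (Rmin (d / 2) 1), (Rmax (M + 1) 1). 
    pose proof (Rmin_l (d/2) 1). pose proof (Rmin_r (d/2) 1). pose proof (Rmax_l (M+1) 1). 
    assert (0 < Rmin (d/2) 1)%R by (apply Rmin_glb_lt; lra).
    repeat split; try lra. apply X; lra. intros; apply X; lra. }
  destruct (is_Clim_Cauchy s) as [l Hl].
  { intros eps He. destruct (Hpq (eps / 2)%R ltac:(lra)) as (p & q & Hpq0 & Hlt & _).
    destruct (Hs p q Hpq0) as [N HN]. exists N. intros n m Hn Hm.
    pose proof (HN n Hn). pose proof (HN m Hm).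
    replace (s n - s m) with ((s n - CRInt f p q) + (CRInt f p q - s m)) by ring.
    eapply Rle_lt_trans. apply Cmod_triangle. rewrite (Cmod_minus_sym (CRInt f p q)). lra. }
  assert (Hle : forall p q, (0 < p <= q)%R -> (Cmod (l - CRInt f p q) <= K * (sat a p + 1 - sat a q))%R).
  { intros p q Hp. destruct (Hs p q Hp) as [N HN].
    apply (is_Clim_Cmod_le (fun n => s (n + N)%nat - CRInt f p q)).
    apply is_Clim_minus. apply is_Clim_shift; auto. apply is_Clim_const. intros n. apply HN. lia. }
  exists l. split; auto.
  apply is_CInt_intro; auto. intros eps He. destruct (Hpq eps He) as (p & q & Hpq0 & Hlt & Hall).
  exists p, q. split. lra. intros p' q' Hp' Hq' _. rewrite Cmod_minus_sym.
  eapply Rle_lt_trans. apply Hle. lra. apply Hall; lra.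
Qed.

Lemma dominated_ex_CInt f a K : Ccont_pos f -> (0 < a)%R -> dominated a K f -> exists l, is_CInt f l.
Proof. intros Hf Ha Hd. destruct (dominated_ex_CInt_strong f a K Hf Ha Hd) as [l [H _]]. exists l; auto. Qed.

Lemma dominated_CInt_error f a K l : Ccont_pos f -> (0 < a)%R -> dominated a K f -> is_CInt f l ->
  forall p q, (0 < p <= q)%R -> (Cmod (l - CRInt f p q) <= K * (sat a p + 1 - sat a q))%R.
Proof.
  intros Hf Ha Hd H. destruct (dominated_ex_CInt_strong f a K Hf Ha Hd) as [l' [H' E]].
  rewrite (is_CInt_unique _ _ _ H H'). auto.
Qed.

Lemma sat_tail_small a K : (0 < a)%R -> (0 <= K)%R -> forall eps, (0 < eps)%R ->
  exists p q, (0 < p <= q)%R /\ (K * (sat a p + 1 - sat a q) < eps)%R.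
Proof.
  intros Ha HK eps He. assert (He' : (0 < eps / (4 * (K + 1)))%R) by (apply Rdiv_lt_0_compat; lra).
  destruct (sat_at_0 a _ Ha He') as (d & Hd0 & Hdd). destruct (sat_at_oo a _ Ha He') as (M & HM0 & HM).
  exists (Rmin (d / 2) 1), (Rmax (M + 1) 1). 
  pose proof (Rmin_l (d/2) 1). pose proof (Rmin_r (d/2) 1). pose proof (Rmax_l (M+1) 1). 
  assert (0 < Rmin (d/2) 1)%R by (apply Rmin_glb_lt; lra). split. lra.
  specialize (Hdd (Rmin (d/2) 1) ltac:(lra)). specialize (HM (Rmax (M+1) 1) ltac:(lra)).
  set (e := (eps / (4 * (K + 1)))%R) in *. assert (eps = e * (4 * (K + 1)))%R by (unfold e; field; lra).
  nra.
Qed.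

Lemma dominated_CInt_le f a K l : Ccont_pos f -> (0 < a)%R -> dominated a K f -> is_CInt f l -> (Cmod l <= K)%R.
Proof.
  intros Hf Ha Hd H. pose proof (dominated_K_pos a K f Ha Hd) as HK. apply Rnot_lt_le; intros Hlt.
  destruct (is_CInt_elim f l Hf H (Cmod l - K)%R ltac:(lra)) as (d & M & Hd0 & HM).
  pose proof (Rmin_l (d/2) 1). pose proof (Rmin_r (d/2) 1). pose proof (Rmax_l (M+1) 1). pose proof (Rmax_r (M+1) 1).
  assert (0 < Rmin (d/2) 1)%R by (apply Rmin_glb_lt; lra).
  specialize (HM (Rmin (d/2) 1) (Rmax (M+1) 1) ltac:(lra) ltac:(lra) ltac:(lra)).
  pose proof (CRInt_dominated_le f a K (Rmin (d/2) 1) (Rmax (M+1) 1) Hf Ha Hd ltac:(lra)).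
  pose proof (sat_bounds a (Rmin (d/2) 1)). pose proof (sat_bounds a (Rmax (M+1) 1)).
  pose proof (Cmod_triangle (l - CRInt f (Rmin (d/2) 1) (Rmax (M+1) 1)) (CRInt f (Rmin (d/2) 1) (Rmax (M+1) 1))) as T.
  replace (l - CRInt f (Rmin (d/2) 1) (Rmax (M+1) 1) + CRInt f (Rmin (d/2) 1) (Rmax (M+1) 1)) with l in T by ring.
  rewrite Cmod_minus_sym in T. nra.
Qed.

(** Dominated convergence for locally uniform limits: outside [[p, q]] the error is small uniformly
    in [n], and on [[p, q]] uniform convergence suffices. *)
Lemma is_CInt_dominated_cvg (s : nat -> R -> C) (f : R -> C) (l : nat -> C) a K :
  (0 < a)%R -> (forall n, Ccont_pos (s n)) -> Ccont_pos f -> (forall n, dominated a K (s n)) ->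
  (forall p q eps, (0 < p <= q)%R -> (0 < eps)%R -> exists N, forall n t, (N <= n)%nat -> (p <= t <= q)%R -> (Cmod (s n t - f t) <= eps)%R) ->
  (forall n, is_CInt (s n) (l n)) ->
  exists m, is_CInt f m /\ is_Clim l m.
Proof.
  intros Ha Hs Hf Hd Hu Hl. pose proof (dominated_K_pos a K _ Ha (Hd O)) as HK.
  assert (Hdf : dominated a K f).
  { intros t Ht. apply (is_Clim_Cmod_le (fun n => s n t)).
    (* Uniform convergence on the degenerate interval [[t, t]] is pointwise convergence, so the
       domination passes to the limit. *)
    - intros eps He. destruct (Hu t t (eps/2)%R ltac:(lra) ltac:(lra)) as [N HN]. exists N. intros n Hn.
      specialize (HN n t Hn ltac:(lra)). lra.
    - intros n. apply Hd; auto. }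
  destruct (dominated_ex_CInt f a K Hf Ha Hdf) as [m Hm]. exists m. split; auto.
  intros eps He. destruct (sat_tail_small a K Ha HK (eps/3)%R ltac:(lra)) as (p & q & Hpq & Hsm).
  destruct (Hu p q (eps / (3 * (q - p + 1)))%R Hpq) as [N HN].
  { apply Rdiv_lt_0_compat; lra. }
  exists N. intros n Hn.
  replace (l n - m) with ((l n - CRInt (s n) p q) + (CRInt (s n) p q - CRInt f p q) + (CRInt f p q - m)) by ring.
  eapply Rle_lt_trans. apply Cmod_triangle. eapply Rle_lt_trans. apply Rplus_le_compat_r. apply Cmod_triangle.
  pose proof (dominated_CInt_error _ _ _ _ (Hs n) Ha (Hd n) (Hl n) p q Hpq).
  pose proof (dominated_CInt_error _ _ _ _ Hf Ha Hdf Hm p q Hpq). rewrite (Cmod_minus_sym (CRInt f p q) m).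
  assert ((Cmod (CRInt (s n) p q - CRInt f p q) <= eps / 3)%R).
  { replace (CRInt (s n) p q - CRInt f p q) with (CRInt (fun t => s n t + (RtoC (-1)) * f t) p q).
    2:{ rewrite CRInt_plus, CRInt_scal by (auto; try (apply Ccont_pos_scal; auto); lra). rewrite RtoC_m1. ring. }
    set (e := (eps / (3 * (q - p + 1)))%R) in *.
    assert (E : (eps / 3 = e * (q - p + 1))%R) by (unfold e; field; lra).
    
    apply Rle_trans with (e * q - e * p)%R; [|nra].
    apply (CRInt_norm_le _ (fun t => e * t)%R (fun _ => e)); auto.
    - apply Ccont_pos_plus; auto. apply Ccont_pos_scal; auto.
    - intros t Ht. auto_derive; auto. ring.
    - intros. apply continuous_const.
    - intros t Ht. rewrite RtoC_m1. replace (s n t + - (1) * f t) with (s n t - f t) by ring. apply HN; auto. }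
  lra.
Qed.

Lemma CRInt_FTC F f p q : (forall t, (0 < t)%R -> is_Cderive F t (f t)) -> Ccont_pos f -> (0 < p)%R -> (0 < q)%R -> CRInt f p q = F q - F p.
Proof.
  intros HF Hf Hp Hq. apply (is_RInt_unique (V:=C_RCN)).
  apply (is_RInt_derive (V:=C_RCN) F f); intros t Ht; assert (0 < Rmin p q)%R by (apply Rmin_glb_lt; auto).
  apply HF; lra. apply Hf; lra.
Qed.

Lemma is_CInt_FTC F f l0 l1 : (forall t, (0 < t)%R -> is_Cderive F t (f t)) -> Ccont_pos f ->
  (forall eps, (0 < eps)%R -> exists d, (0 < d)%R /\ forall p, (0 < p < d)%R -> (Cmod (F p - l0) < eps)%R) ->
  (forall eps, (0 < eps)%R -> exists M, forall q, (M < q)%R -> (0 < q)%R -> (Cmod (F q - l1) < eps)%R) ->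
  is_CInt f (l1 - l0).
Proof.
  intros HF Hf H0 H1. apply is_CInt_intro; auto. intros eps He.
  destruct (H0 (eps/2)%R ltac:(lra)) as (d & Hd & Hdd). destruct (H1 (eps/2)%R ltac:(lra)) as (M & HM).
  exists d, M. split; auto. intros p q Hp Hq Hq0. rewrite (CRInt_FTC F f p q) by (auto; lra).
  replace (F q - F p - (l1 - l0)) with ((F q - l1) + - (F p - l0)) by ring.
  eapply Rle_lt_trans. apply Cmod_triangle. rewrite Cmod_opp. specialize (HM q Hq Hq0). specialize (Hdd p Hp). lra.
Qed.

(** The fundamental theorem used backwards: a known integral and the limit of the primitive at 0
    determine the limit of the primitive at infinity. *)
Lemma is_CInt_FTC_limit F f l l0 : (forall t, (0 < t)%R -> is_Cderive F t (f t)) -> Ccont_pos f -> is_CInt f l ->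
  (forall eps, (0 < eps)%R -> exists d, (0 < d)%R /\ forall p, (0 < p < d)%R -> (Cmod (F p - l0) < eps)%R) ->
  (forall eps, (0 < eps)%R -> exists M, forall q, (M < q)%R -> (0 < q)%R -> (Cmod (F q - (l + l0)) < eps)%R).
Proof.
  intros HF Hf Hl H0 eps He.
  destruct (H0 (eps/2)%R ltac:(lra)) as (d & Hd & Hdd).
  destruct (is_CInt_elim f l Hf Hl (eps/2)%R ltac:(lra)) as (d' & M & Hd' & HM).
  exists M. intros q Hq Hq0.
  assert (0 < Rmin d d')%R by (apply Rmin_glb_lt; auto). pose proof (Rmin_l d d'). pose proof (Rmin_r d d').
  specialize (HM (Rmin d d' / 2)%R q ltac:(lra) Hq Hq0). specialize (Hdd (Rmin d d'/2)%R ltac:(lra)).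
  rewrite (CRInt_FTC F f) in HM by (auto; lra).
  replace (F q - (l + l0)) with ((F q - F (Rmin d d' / 2)%R - l) + (F (Rmin d d' / 2)%R - l0)) by ring.
  eapply Rle_lt_trans. apply Cmod_triangle. lra.
Qed.

#[global] Opaque is_CInt.

(** * Exchange of integrations *)

Lemma continuity_2d_slice (f : R -> R -> R) t s : continuity_2d_pt f t s -> continuous (f t) s.
Proof.
  intros H. apply continuity_pt_filterlim. intros eps He.
  destruct (H (mkposreal eps He)) as [d Hd].
  exists d. split. apply cond_pos. intros y [_ Hy]. apply Hd; auto.
  replace (t - t)%R with 0%R by ring. rewrite Rabs_R0. apply cond_pos.
Qed.

(** Uniform continuity on the rectangle [[t0/2, 2 t0] x [p, q]], which stays inside the open
    quadrant. *)
Lemma RInt_param_cont (f : R -> R -> R) p q t0 : (0 < p <= q)%R -> (0 < t0)%R ->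
  (forall t s, (0 < t)%R -> (0 < s)%R -> continuity_2d_pt f t s) ->
  continuous (fun t => RInt (f t) p q) t0.
Proof.
  intros Hp Ht0 Hc.
  assert (Hex : forall t, (0 < t)%R -> ex_RInt (f t) p q).
  { intros t Ht. apply (ex_RInt_continuous (V:=R_CompleteNormedModule)). intros z Hz.
    rewrite Rmin_left, Rmax_right in Hz by lra.
    apply continuity_pt_filterlim. intros eps He.
    destruct (Hc t z Ht ltac:(lra) (mkposreal eps He)) as [d Hd].
    exists d. split. apply cond_pos. intros y [_ Hy]. apply Hd; auto.
    replace (t - t)%R with 0%R by ring. rewrite Rabs_R0. apply cond_pos. }
  apply continuity_pt_filterlim. intros eps He.
  assert (He' : (0 < eps / (q - p + 1))%R) by (apply Rdiv_lt_0_compat; lra).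
  destruct (uniform_continuity_2d f (t0/2) (2*t0) p q) with (eps := mkposreal _ He') as [d Hd].
  { intros x y Hx Hy. apply Hc; lra. }
  exists (Rmin d (t0/2)). split. apply Rmin_glb_lt. apply cond_pos. lra.
  intros t [_ Ht]. simpl. unfold Rdist in *. pose proof (Rmin_l d (t0/2)). pose proof (Rmin_r d (t0/2)).
  assert (Ht' : (Rabs (t - t0) < t0 / 2)%R) by (simpl in Ht; unfold R_dist in Ht; lra). apply Rabs_def2 in Ht'.
  rewrite <- (RInt_minus (V:=R_CompleteNormedModule)) by (apply Hex; lra).
  apply Rle_lt_trans with ((q - p) * (eps / (q - p + 1)))%R.
  - apply (norm_RInt_le_const (V:=R_NormedModule) (fun s => minus (f t s) (f t0 s)) p q); try lra.
    intros s Hs. left. apply (Hd t0 s t s); try lra.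
    simpl in Ht. unfold R_dist in Ht. lra. replace (s - s)%R with 0%R by ring. rewrite Rabs_R0. apply cond_pos.
    apply (RInt_correct (V:=R_CompleteNormedModule)). apply (ex_RInt_minus (V:=R_NormedModule)); apply Hex; lra.
  - set (e := (eps / (q - p + 1))%R) in *. assert (eps = e * (q - p + 1))%R by (unfold e; field; lra). nra.
Qed.

(** The end points may come in either order: in the proof of Fubini's theorem one of them varies on
    both sides of the other. *)
Lemma RInt_param_cont' (f : R -> R -> R) p q t0 : (0 < p)%R -> (0 < q)%R -> (0 < t0)%R ->
  (forall t s, (0 < t)%R -> (0 < s)%R -> continuity_2d_pt f t s) ->
  continuous (fun t => RInt (f t) p q) t0.
Proof.
  intros Hp Hq Ht0 Hc. destruct (Rle_lt_dec p q). apply RInt_param_cont; auto.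
  apply (continuous_ext_loc _ (fun t => opp (RInt (f t) q p))).
  - exists (mkposreal t0 Ht0). intros t Hv. unfold ball in Hv; simpl in Hv.
    unfold AbsRing_ball, abs, minus, plus, opp in Hv; simpl in Hv. apply Rabs_def2 in Hv.
    apply (opp_RInt_swap (V:=R_CompleteNormedModule)).
    apply (ex_RInt_continuous (V:=R_CompleteNormedModule)). intros z Hz.
    rewrite Rmin_left, Rmax_right in Hz by lra. apply continuity_2d_slice, Hc; lra.
  - apply (continuous_opp (V:=R_NormedModule)). apply RInt_param_cont; auto; lra.
Qed.

Lemma continuity_2d_swap (f : R -> R -> R) x y : continuity_2d_pt f x y -> continuity_2d_pt (fun u v => f v u) y x.
Proof. intros H eps. destruct (H eps) as [d Hd]. exists d. intros u v Hu Hv. apply Hd; auto. Qed.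

(** Replace the end point [s] by a variable [v]: both iterated integrals then have the derivative
    [RInt (fun x => f x v) p q], and both vanish at [v = r]. *)
Lemma RInt_fubini (f : R -> R -> R) p q r s : (0 < p <= q)%R -> (0 < r <= s)%R ->
  (forall t s, (0 < t)%R -> (0 < s)%R -> continuity_2d_pt f t s) ->
  RInt (fun x => RInt (f x) r s) p q = RInt (fun y => RInt (fun x => f x y) p q) r s.
Proof.
  intros Hp Hr Hc.
  assert (Hc' : forall t s, (0 < t)%R -> (0 < s)%R -> continuity_2d_pt (fun u v => f v u) t s).
  { intros. apply continuity_2d_swap. auto. }
  assert (Hexs : forall t u v, (0 < t)%R -> (0 < u)%R -> (0 < v)%R -> ex_RInt (f t) u v).
  { intros t u v Ht Hu Hv. apply (ex_RInt_continuous (V:=R_CompleteNormedModule)). intros z Hz.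
    apply continuity_2d_slice, Hc; auto. assert (0 < Rmin u v)%R by (apply Rmin_glb_lt; auto). lra. }
  assert (Hcy : forall y, (0 < y)%R -> continuous (fun y => RInt (fun x => f x y) p q) y).
  { intros y Hy. apply (RInt_param_cont (fun u v => f v u)); auto. }
  assert (Hloc : forall y, (0 < y)%R -> locally y (fun v => (0 < v)%R)).
  { intros y Hy. exists (mkposreal y Hy). intros v Hv. unfold ball in Hv; simpl in Hv.
    unfold AbsRing_ball, abs, minus, plus, opp in Hv; simpl in Hv. apply Rabs_def2 in Hv. lra. }
  (* The difference of the two iterated integrals as a function of [v]; this local name is unrelated
     to the primitive [exp_rpow_prim] defined later. *)
  set (exp_rpow_prim := fun v => (RInt (fun x => RInt (f x) r v) p q - RInt (fun y => RInt (fun x => f x y) p q) r v)%R).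
  assert (Hphi : forall v, (0 < v)%R -> is_derive exp_rpow_prim v 0%R).
  { intros v Hv. 
    replace 0%R with (minus (RInt (fun x => f x v) p q) (RInt (fun x => f x v) p q)) by (unfold minus, plus, opp; simpl; ring).
    assert (HD : forall x w, (0 < x)%R -> (0 < w)%R -> is_derive (fun z => RInt (f x) r z) w (f x w)).
    { intros x w Hx Hw. apply (is_derive_RInt (V:=R_NormedModule) (f x) _ r w).
      - apply (filter_imp (fun w => (0 < w)%R)). intros w' Hw'. apply (RInt_correct (V:=R_CompleteNormedModule)). apply Hexs; auto; lra.
        apply Hloc; auto.
      - apply continuity_2d_slice, Hc; auto. }
    apply (is_derive_minus (V:=R_NormedModule)).
    - replace (RInt (fun x => f x v) p q) with (RInt (fun t => Derive (fun z => RInt (f t) r z) v) p q).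
      2:{ apply RInt_ext. intros x Hx. rewrite Rmin_left, Rmax_right in Hx by lra. apply is_derive_unique. apply HD; lra. }
      apply (is_derive_RInt_param (fun v x => RInt (f x) r v) p q v).
      + apply (filter_imp (fun w => (0 < w)%R)); [|apply Hloc; auto]. intros w Hw t Ht. rewrite Rmin_left, Rmax_right in Ht by lra.
        eexists. apply HD; lra.
      + intros t Ht. rewrite Rmin_left, Rmax_right in Ht by lra.
        apply (continuity_2d_pt_ext_loc (fun u v => f v u)); [|apply Hc'; lra].
        (* The radius [Rmin v t] keeps both variables positive, where [Derive] is known to be
           [f]. *)
        assert (Hm : (0 < Rmin v t)%R) by (apply Rmin_glb_lt; lra).
        exists (mkposreal _ Hm). intros u w Hu Hw. simpl in Hu, Hw. pose proof (Rmin_l v t). pose proof (Rmin_r v t).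
        apply Rabs_def2 in Hu. apply Rabs_def2 in Hw. symmetry. apply is_derive_unique. apply HD; lra.
      + apply (filter_imp (fun w => (0 < w)%R)); [|apply Hloc; auto]. intros w Hw.
        apply (ex_RInt_continuous (V:=R_CompleteNormedModule)). intros z Hz. rewrite Rmin_left, Rmax_right in Hz by lra.
        apply RInt_param_cont'; auto; lra.
    - apply (is_derive_RInt (V:=R_NormedModule) (fun y => RInt (fun x => f x y) p q) _ r v); [|apply Hcy; auto].
      apply (filter_imp (fun w => (0 < w)%R)); [|apply Hloc; auto]. intros w Hw.
      apply (RInt_correct (V:=R_CompleteNormedModule)).
      apply (ex_RInt_continuous (V:=R_CompleteNormedModule)). intros z Hz. apply Hcy.
      assert (0 < Rmin r w)%R by (apply Rmin_glb_lt; lra). lra. }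
  assert (E : exp_rpow_prim r = exp_rpow_prim s).
  { destruct (Req_dec r s). subst; auto. apply (eq_is_derive (V:=R_NormedModule) exp_rpow_prim r s); [|lra].
    intros t Ht. apply Hphi. lra. }
  unfold exp_rpow_prim in E. rewrite RInt_point in E.
  rewrite (RInt_ext _ (fun _ => 0%R)) in E by (intros; exact (RInt_point (V:=R_CompleteNormedModule) _ _)).
  rewrite RInt_const in E. unfold zero, scal in E; simpl in E. unfold mult in E; simpl in E. lra.
Qed.

Lemma CRInt_parts f p q : Ccont_pos f -> (0 < p)%R -> (0 < q)%R ->
  CRInt f p q = (RInt (fun t => Re (f t)) p q, RInt (fun t => Im (f t)) p q).
Proof.
  intros Hf Hp Hq. apply (is_RInt_unique (V:=C_RCN)).
  pose proof (Ccont_pos_is f p q Hf Hp Hq) as H.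
  pose proof (is_RInt_fct_extend_fst (U:=R_NormedModule) (V:=R_NormedModule) f p q _ H) as H1.
  pose proof (is_RInt_fct_extend_snd (U:=R_NormedModule) (V:=R_NormedModule) f p q _ H) as H2.
  apply (is_RInt_fct_extend_pair (U:=R_NormedModule) (V:=R_NormedModule)); apply (RInt_correct (V:=R_CompleteNormedModule)); eexists; eauto.
Qed.

Definition Ccont_2d (f : R -> R -> C) : Prop := forall t s : R, (0 < t)%R -> (0 < s)%R ->
  Ccont (T := prod_UniformSpace R_UniformSpace R_UniformSpace) (fun p => f (fst p) (snd p)) (t, s).

Lemma Ccont_2d_Re f t s : Ccont_2d f -> (0 < t)%R -> (0 < s)%R -> continuity_2d_pt (fun u v => Re (f u v)) t s.
Proof. intros H Ht Hs. apply continuity_2d_pt_filterlim. apply (Ccont_Re _ _ (H t s Ht Hs)). Qed.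
Lemma Ccont_2d_Im f t s : Ccont_2d f -> (0 < t)%R -> (0 < s)%R -> continuity_2d_pt (fun u v => Im (f u v)) t s.
Proof. intros H Ht Hs. apply continuity_2d_pt_filterlim. apply (Ccont_Im _ _ (H t s Ht Hs)). Qed.

Lemma Ccont_2d_swap f : Ccont_2d f -> Ccont_2d (fun t s => f s t).
Proof.
  intros H t s Ht Hs. apply Ccont_pair.
  - apply (continuity_2d_pt_filterlim (fun u v => Re (f v u))). apply (continuity_2d_swap (fun u v => Re (f u v))). apply Ccont_2d_Re; auto.
  - apply (continuity_2d_pt_filterlim (fun u v => Im (f v u))). apply (continuity_2d_swap (fun u v => Im (f u v))). apply Ccont_2d_Im; auto.
Qed.

Lemma Ccont_2d_slice f t : Ccont_2d f -> (0 < t)%R -> Ccont_pos (f t).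
Proof.
  intros H Ht s Hs. apply Ccont_pair.
  - apply (continuity_2d_slice (fun u v => Re (f u v))). apply Ccont_2d_Re; auto.
  - apply (continuity_2d_slice (fun u v => Im (f u v))). apply Ccont_2d_Im; auto.
Qed.

Lemma Ccont_2d_param f p q : Ccont_2d f -> (0 < p)%R -> (0 < q)%R -> Ccont_pos (fun t => CRInt (f t) p q).
Proof.
  intros H Hp Hq t Ht.
  apply (continuous_ext_loc (U:=C_UniformSpace) _ (fun t => (RInt (fun s => Re (f t s)) p q, RInt (fun s => Im (f t s)) p q))).
  { exists (mkposreal t Ht). intros v Hv. unfold ball in Hv; simpl in Hv.
    unfold AbsRing_ball, abs, minus, plus, opp in Hv; simpl in Hv. apply Rabs_def2 in Hv.
    symmetry. apply CRInt_parts; auto. apply Ccont_2d_slice; auto. lra. }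
  apply Ccont_pair; simpl.
  - apply (RInt_param_cont' (fun t s => Re (f t s))); auto. intros; apply Ccont_2d_Re; auto.
  - apply (RInt_param_cont' (fun t s => Im (f t s))); auto. intros; apply Ccont_2d_Im; auto.
Qed.

Lemma CRInt_fubini f p q : Ccont_2d f -> (0 < p <= q)%R ->
  CRInt (fun t => CRInt (f t) p q) p q = CRInt (fun s => CRInt (fun t => f t s) p q) p q.
Proof.
  intros H Hp.
  rewrite (CRInt_parts (fun t => CRInt (f t) p q)) by (try lra; apply Ccont_2d_param; auto; lra).
  rewrite (CRInt_parts (fun s => CRInt (fun t => f t s) p q)) by (try lra; (apply (Ccont_2d_param (fun s t => f t s)); [apply Ccont_2d_swap; auto|lra|lra])).
  apply (f_equal2 pair).
  - rewrite (RInt_ext _ (fun t => RInt (fun s => Re (f t s)) p q)).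
    2:{ intros t Ht. rewrite Rmin_left, Rmax_right in Ht by lra. rewrite CRInt_parts; auto; try lra. apply Ccont_2d_slice; auto; lra. }
    rewrite (RInt_fubini (fun t s => Re (f t s))) by (auto; intros; apply Ccont_2d_Re; auto).
    apply RInt_ext. intros t Ht. rewrite Rmin_left, Rmax_right in Ht by lra.
    rewrite CRInt_parts; auto; try lra. apply (Ccont_2d_slice (fun s t => f t s)); [apply Ccont_2d_swap; auto|lra].
  - rewrite (RInt_ext _ (fun t => RInt (fun s => Im (f t s)) p q)).
    2:{ intros t Ht. rewrite Rmin_left, Rmax_right in Ht by lra. rewrite CRInt_parts; auto; try lra. apply Ccont_2d_slice; auto; lra. }
    rewrite (RInt_fubini (fun t s => Im (f t s))) by (auto; intros; apply Ccont_2d_Im; auto).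
    apply RInt_ext. intros t Ht. rewrite Rmin_left, Rmax_right in Ht by lra.
    rewrite CRInt_parts; auto; try lra. apply (Ccont_2d_slice (fun s t => f t s)); [apply Ccont_2d_swap; auto|lra].
Qed.

(** Compares the iterated improper integral with the proper one over the square [[p, q] x [p, q]].
    The error bound is symmetric in the two variables, so the same estimate serves both orders of
    integration. *)
Lemma fubini_half f F l a b K p q : Ccont_2d f -> (0 < a)%R -> (0 < b)%R -> (0 <= K)%R ->
  (forall t s, (0 < t)%R -> (0 < s)%R -> (Cmod (f t s) <= K * dsat a t * dsat b s)%R) ->
  Ccont_pos F -> (forall t, (0 < t)%R -> is_CInt (f t) (F t)) -> is_CInt F l -> (0 < p <= q)%R ->
  (Cmod (l - CRInt (fun t => CRInt (f t) p q) p q) <= K * (sat a p + 1 - sat a q) + K * (sat b p + 1 - sat b q))%R.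
Proof.
  intros H Ha Hb HK Hd HFc HF Hl Hp.
  assert (HdF : dominated a K F).
  { intros t Ht. apply (dominated_CInt_le (f t) b); auto. apply Ccont_2d_slice; auto. intros s Hs. apply Hd; auto. }
  pose proof (dominated_CInt_error _ _ _ _ HFc Ha HdF Hl p q Hp) as E1.
  assert (E2 : (Cmod (CRInt F p q - CRInt (fun t => CRInt (f t) p q) p q) <= K * (sat b p + 1 - sat b q))%R).
  { pose proof (Ccont_2d_param f p q H ltac:(lra) ltac:(lra)) as Hc.
    replace (CRInt F p q - CRInt (fun t => CRInt (f t) p q) p q) with (CRInt (fun t => F t + RtoC (-1) * CRInt (f t) p q) p q).
    2:{ rewrite CRInt_plus, CRInt_scal by (auto; try (apply Ccont_pos_scal; auto); lra). rewrite RtoC_m1. ring. }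
    set (e := (sat b p + 1 - sat b q)%R). assert (He : (0 <= e)%R).
    { unfold e. pose proof (sat_bounds b p). pose proof (sat_bounds b q). lra. }
    apply Rle_trans with (K * e * sat a q - K * e * sat a p)%R.
    2:{ pose proof (sat_bounds a p). pose proof (sat_bounds a q). assert (0 <= K * e)%R by nra. nra. }
    apply (CRInt_norm_le _ (fun t => K * e * sat a t)%R (fun t => K * e * dsat a t)%R); auto.
    - apply Ccont_pos_plus; auto. apply Ccont_pos_scal; auto.
    - intros t Ht. apply (is_derive_scal (sat a) t (K * e)). apply sat_derive; lra.
    - intros t Ht. apply (continuous_mult (K:=R_AbsRing)). apply continuous_const. apply dsat_cont; lra.
    - intros t Ht. rewrite RtoC_m1. replace (F t + - (1) * CRInt (f t) p q) with (F t - CRInt (f t) p q) by ring.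
      replace (K * e * dsat a t)%R with (K * dsat a t * e)%R by ring.
      apply (dominated_CInt_error (f t) b); auto; try lra. apply Ccont_2d_slice; auto; lra. intros s Hs. apply Hd; lra. apply HF; lra. }
  replace (l - CRInt (fun t => CRInt (f t) p q) p q) with ((l - CRInt F p q) + (CRInt F p q - CRInt (fun t => CRInt (f t) p q) p q)) by ring.
  eapply Rle_trans. apply Cmod_triangle. lra.
Qed.

(** Both iterated integrals are close to the integral over one and the same large square, where the
    order does not matter. *)
Lemma is_CInt_fubini f F H l m a b K : Ccont_2d f -> (0 < a)%R -> (0 < b)%R ->
  (forall t s, (0 < t)%R -> (0 < s)%R -> (Cmod (f t s) <= K * dsat a t * dsat b s)%R) ->
  Ccont_pos F -> (forall t, (0 < t)%R -> is_CInt (f t) (F t)) -> is_CInt F l ->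
  Ccont_pos H -> (forall s, (0 < s)%R -> is_CInt (fun t => f t s) (H s)) -> is_CInt H m -> l = m.
Proof.
  intros Hf Ha Hb Hd HFc HF Hl HHc HH Hm.
  assert (HK : (0 <= K)%R).
  { specialize (Hd 1%R 1%R Rlt_0_1 Rlt_0_1). pose proof (Cmod_ge_0 (f 1%R 1%R)). pose proof (dsat_pos a 1 Ha). pose proof (dsat_pos b 1 Hb).
    apply Rnot_lt_le; intros Hlt. assert (0 < dsat a 1 * dsat b 1)%R by nra. nra. }
  assert (E : Cmod (l - m) = 0%R).
  2:{ apply Cmod_eq_0 in E. replace l with (l - m + m) by ring. rewrite E; ring. }
  apply Rle_antisym; [|apply Cmod_ge_0]. apply Rnot_lt_le; intros Hlt.
  (* Each order of integration produces two errors; four of them below an eighth of the distance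
     contradict its being positive. *)
  destruct (sat_tail_small a K Ha HK (Cmod (l - m) / 8)%R ltac:(lra)) as (p1 & q1 & Hp1 & Hs1).
  destruct (sat_tail_small b K Hb HK (Cmod (l - m) / 8)%R ltac:(lra)) as (p2 & q2 & Hp2 & Hs2).
  set (p := Rmin p1 p2). set (q := Rmax q1 q2).
  assert (Hp : (0 < p)%R) by (apply Rmin_glb_lt; lra).
  pose proof (Rmin_l p1 p2 : (p <= p1)%R). pose proof (Rmin_r p1 p2 : (p <= p2)%R).
  pose proof (Rmax_l q1 q2 : (q1 <= q)%R). pose proof (Rmax_r q1 q2 : (q2 <= q)%R).
  pose proof (fubini_half f F l a b K p q Hf Ha Hb HK Hd HFc HF Hl ltac:(lra)) as E1.
  pose proof (fubini_half (fun s t => f t s) H m b a K p q (Ccont_2d_swap _ Hf) Hb Ha HK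
     ltac:(intros; replace (K * dsat b t * dsat a s)%R with (K * dsat a s * dsat b t)%R by ring; auto) HHc HH Hm ltac:(lra)) as E2.
  rewrite (CRInt_fubini f) in E1 by (auto; lra).
  pose proof (sat_mono a p p1 ltac:(lra) ltac:(lra)). pose proof (sat_mono b p p2 ltac:(lra) ltac:(lra)).
  pose proof (sat_mono a q1 q ltac:(lra) ltac:(lra)). pose proof (sat_mono b q2 q ltac:(lra) ltac:(lra)).
  set (D := CRInt (fun s => CRInt (fun t => f t s) p q) p q) in *.
  pose proof (Cmod_triangle (l - D) (D - m)) as T. replace (l - D + (D - m)) with (l - m) in T by ring.
  rewrite (Cmod_minus_sym D m) in T. nra.
Qed.

(** * Power series with complex coefficients *)

Definition CPSeries (a : nat -> C) (x : R) : C := (PSeries (fun n => Re (a n)) x, PSeries (fun n => Im (a n)) x).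

(** Absolute convergence below [r] replaces the radius of convergence: it is inherited directly from
    a real majorant. *)
Definition CPS_summable (a : nat -> C) (r : R) : Prop := forall x, (0 <= x < r)%R -> ex_series (fun n => Cmod (a n) * x ^ n)%R.

Lemma CV_radius_gt (b : nat -> R) (a : nat -> C) r x : CPS_summable a r -> (forall n, (Rabs (b n) <= Cmod (a n))%R) -> (Rabs x < r)%R ->
  Rbar_lt (Rabs x) (CV_radius b).
Proof.
  intros H Hb Hx. pose proof (Rabs_pos x). set (y := ((Rabs x + r) / 2)%R).
  assert (Hy : (Rabs x < y < r)%R) by (unfold y; lra).
  apply Rbar_lt_le_trans with (Finite y). simpl; lra.
  apply (Lub_Rbar_correct (CV_disk b)).
  apply (ex_series_le (V:=R_CompleteNormedModule) _ (fun n => Cmod (a n) * y ^ n)%R).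
  2: apply H; lra. intros n. rewrite Rabs_Rabsolu, Rabs_mult.
  rewrite (Rabs_pos_eq (y ^ n)) by (apply pow_le; lra). apply Rmult_le_compat_r. apply pow_le; lra. apply Hb.
Qed.

Lemma PSeries_is_series (b : nat -> R) (x : R) : Rbar_lt (Rabs x) (CV_radius b) -> is_series (fun n => b n * x ^ n)%R (PSeries b x).
Proof. intros H. apply (proj1 (is_pseries_R b x (PSeries b x))). apply PSeries_correct. apply CV_radius_inside; auto. Qed.

Lemma CPSeries_is_series a r x : CPS_summable a r -> (Rabs x < r)%R -> is_Cseries (fun n => a n * RtoC (x ^ n)) (CPSeries a x).
Proof.
  intros H Hx. apply is_Cseries_parts.
  - apply (is_series_ext (fun n => Re (a n) * x ^ n)%R). intros n. unfold Re; simpl; ring.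
    apply (PSeries_is_series (fun n => Re (a n))). apply (CV_radius_gt _ a r); auto. intros; apply re_le_Cmod.
  - apply (is_series_ext (fun n => Im (a n) * x ^ n)%R). intros n. unfold Im, Re; simpl; ring.
    apply (PSeries_is_series (fun n => Im (a n))). apply (CV_radius_gt _ a r); auto. intros; apply im_le_Cmod.
Qed.

Definition CPS_derive (a : nat -> C) (n : nat) : C := natC (S n) * a (S n).

Lemma is_Cderive_CPSeries a r x : CPS_summable a r -> (Rabs x < r)%R -> is_Cderive (CPSeries a) x (CPSeries (CPS_derive a) x).
Proof.
  intros H Hx. apply is_Cderive_pair.
  - change (is_derive (PSeries (fun n => Re (a n))) x (PSeries (fun n => Re (CPS_derive a n)) x)).
    replace (PSeries (fun n => Re (CPS_derive a n)) x) with (PSeries (PS_derive (fun n => Re (a n))) x).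
    apply is_derive_PSeries. apply (CV_radius_gt _ a r); auto. intros; apply re_le_Cmod.
    apply PSeries_ext. intros n. unfold PS_derive, CPS_derive, natC, Re. cbn -[INR]. ring.
  - change (is_derive (PSeries (fun n => Im (a n))) x (PSeries (fun n => Im (CPS_derive a n)) x)).
    replace (PSeries (fun n => Im (CPS_derive a n)) x) with (PSeries (PS_derive (fun n => Im (a n))) x).
    apply is_derive_PSeries. apply (CV_radius_gt _ a r); auto. intros; apply im_le_Cmod.
    apply PSeries_ext. intros n. unfold PS_derive, CPS_derive, natC, Im, Re. cbn -[INR]. ring.
Qed.

Lemma Ccont_CPSeries a r x : CPS_summable a r -> (Rabs x < r)%R -> Ccont (CPSeries a) x.
Proof. intros. eapply is_Cderive_cont. apply (is_Cderive_CPSeries a r); auto. Qed.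

Lemma CPS_derive_series a r x : CPS_summable a r -> (Rabs x < r)%R -> is_Cseries (fun n => CPS_derive a n * RtoC (x ^ n)) (CPSeries (CPS_derive a) x).
Proof.
  intros H Hx. apply is_Cseries_parts.
  - apply (is_series_ext (fun n => PS_derive (fun n => Re (a n)) n * x ^ n)%R).
    intros n. unfold PS_derive, CPS_derive, natC, Re. cbn -[INR pow]. ring.
    change (Re (CPSeries (CPS_derive a) x)) with (PSeries (fun n => Re (CPS_derive a n)) x). rewrite <- (PSeries_ext (PS_derive (fun n => Re (a n)))).
    2:{ intros n. unfold PS_derive, CPS_derive, natC, Re. cbn -[INR pow]. ring. }
    apply PSeries_is_series. rewrite CV_radius_derive. apply (CV_radius_gt _ a r); auto.
    intros; apply re_le_Cmod.
  - apply (is_series_ext (fun n => PS_derive (fun n => Im (a n)) n * x ^ n)%R).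
    intros n. unfold PS_derive, CPS_derive, natC, Im, Re. cbn -[INR pow]. ring.
    change (Im (CPSeries (CPS_derive a) x)) with (PSeries (fun n => Im (CPS_derive a n)) x). rewrite <- (PSeries_ext (PS_derive (fun n => Im (a n)))).
    2:{ intros n. unfold PS_derive, CPS_derive, natC, Im, Re. cbn -[INR pow]. ring. }
    apply PSeries_is_series. rewrite CV_radius_derive. apply (CV_radius_gt _ a r); auto.
    intros; apply im_le_Cmod.
Qed.

Lemma CPSeries_0 a : CPSeries a 0 = a O.
Proof. unfold CPSeries. rewrite !PSeries_0. destruct (a O); reflexivity. Qed.

Lemma is_Cseries_shift a l : is_Cseries (fun n => a (S n)) l -> is_Cseries a (a O + l).
Proof.
  intros H. apply (is_Clim_unshift _ _ 1). apply (is_Clim_ext (fun n => a O + Csum (fun n => a (S n)) n)).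
  { intros n. rewrite Nat.add_1_r. induction n; simpl. ring. simpl in IHn. rewrite <- IHn. ring. }
  apply is_Clim_plus; auto. apply is_Clim_const.
Qed.

(** * Binomial and hypergeometric series *)

Fixpoint Rpoch (P : R) (i : nat) : R := match i with O => 1%R | S j => (Rpoch P j * (P + INR j))%R end.

Lemma Cpoch_RtoC P i : Cpochhammer (RtoC P) i = RtoC (Rpoch P i).
Proof. induction i; simpl. reflexivity. rewrite IHi. unfold natC. rewrite <- RtoC_plus, <- RtoC_mult. reflexivity. Qed.

Lemma Rpoch_pos P i : (0 < P)%R -> (0 < Rpoch P i)%R.
Proof. intros HP. induction i; simpl. lra. pose proof (pos_INR i). apply Rmult_lt_0_compat; lra. Qed.

(** Taylor coefficients of [(1 - x)^(-alpha)]. *)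
Definition binom_coef (alpha : C) (n : nat) : C := Cpochhammer alpha n / RtoC (INR (fact n)).
Definition binom_coefR (P : R) (n : nat) : R := (Rpoch P n / INR (fact n))%R.

Lemma INR_fact_pos n : (0 < INR (fact n))%R.
Proof. apply INR_fact_lt_0. Qed.

Lemma binom_coefR_pos P n : (0 < P)%R -> (0 < binom_coefR P n)%R.
Proof. intros. apply Rdiv_lt_0_compat. apply Rpoch_pos; auto. apply INR_fact_pos. Qed.

Lemma binom_coefR_S P n : binom_coefR P (S n) = (binom_coefR P n * ((P + INR n) / INR (S n)))%R.
Proof.
  unfold binom_coefR. simpl Rpoch. rewrite fact_simpl, mult_INR. pose proof (INR_fact_pos n). assert (INR (S n) <> 0%R) by (apply not_0_INR; lia).
  field. split; auto. lra.
Qed.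

Lemma ex_series_binom_coefR P x : (0 < P)%R -> (0 <= x < 1)%R -> ex_series (fun n => binom_coefR P n * x ^ n)%R.
Proof.
  intros HP Hx.
  assert (D : CV_disk (binom_coefR P) x).
  { apply (CV_disk_DAlembert (binom_coefR P) x 1).
    - intros n. pose proof (binom_coefR_pos P n HP). lra.
    - apply (is_lim_seq_ext (fun n => 1 + (P - 1) * / (INR n + 1))%R).
      + intros n. rewrite binom_coefR_S. pose proof (binom_coefR_pos P n HP). rewrite S_INR. pose proof (pos_INR n).
        replace (binom_coefR P n * ((P + INR n) / (INR n + 1)) / binom_coefR P n)%R with ((P + INR n) / (INR n + 1))%R by (field; lra).
        rewrite Rabs_pos_eq. field; lra. apply Rdiv_le_0_compat; lra.
      + replace (Finite 1) with (Rbar_plus 1 (Rbar_mult (P - 1)%R 0%R)) by (simpl; f_equal; ring).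
        apply is_lim_seq_plus'. apply is_lim_seq_const.
        apply (is_lim_seq_scal_l (fun n => / (INR n + 1))%R (P - 1) 0).
        apply (is_lim_seq_ext (fun n => / INR (S n))%R). intros n; rewrite S_INR; auto.
        apply (is_lim_seq_incr_1 (fun n => / INR n)%R). 
        replace (Finite 0) with (Rbar_inv p_infty) by reflexivity. apply is_lim_seq_inv. apply is_lim_seq_INR. discriminate.
    - right. split; [lra|]. rewrite Rabs_pos_eq by lra. lra. }
  eapply ex_series_ext; [|exact D]. intros n. simpl.
  rewrite Rabs_pos_eq. reflexivity. apply Rmult_le_pos. left; apply binom_coefR_pos; auto. apply pow_le; lra.
Qed.

Lemma binom_coef_S alpha n : binom_coef alpha (S n) = binom_coef alpha n * ((alpha + natC n) / natC (S n)).
Proof.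
  unfold binom_coef, natC. simpl Cpochhammer. rewrite fact_simpl, mult_INR. pose proof (INR_fact_pos n).
  assert (INR (S n) <> 0%R) by (apply not_0_INR; lia). rewrite RtoC_mult.
  unfold natC. field. split; intros E; apply RtoC_inj in E; lra.
Qed.

Lemma Cmod_natC n : Cmod (natC n) = INR n.
Proof. unfold natC. rewrite Cmod_R. apply Rabs_pos_eq, pos_INR. Qed.

Lemma natC_S n : natC (S n) = natC n + 1.
Proof. unfold natC. rewrite S_INR, RtoC_plus. reflexivity. Qed.

Lemma natC_neq_0 n : natC (S n) <> 0.
Proof. intros E. apply RtoC_inj in E. pose proof (lt_0_INR (S n) ltac:(lia)). lra. Qed.

Lemma binom_coef_le alpha P n : (Cmod alpha <= P)%R -> (0 < P)%R -> (Cmod (binom_coef alpha n) <= binom_coefR P n)%R.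
Proof.
  intros H HP. induction n.
  - unfold binom_coef, binom_coefR; simpl. unfold Cdiv. rewrite Cmult_1_l, Cmod_inv, Cmod_R, Rabs_R1. lra. intros E; apply RtoC_inj in E; lra.
  - rewrite binom_coef_S, binom_coefR_S, Cmod_mult. apply Rmult_le_compat; try apply Cmod_ge_0; auto.
    rewrite Cmod_div by apply natC_neq_0. rewrite Cmod_natC. apply Rmult_le_compat_r.
    left; apply Rinv_0_lt_compat, lt_0_INR; lia. eapply Rle_trans; [apply Cmod_triangle|]. rewrite Cmod_natC. lra.
Qed.

Lemma CPS_summable_le a (b : nat -> R) r : (forall n, (Cmod (a n) <= b n)%R) -> (forall x, (0 <= x < r)%R -> ex_series (fun n => b n * x ^ n)%R) -> CPS_summable a r.
Proof.
  intros Hb H x Hx. apply (ex_series_le (V:=R_CompleteNormedModule) _ (fun n => b n * x ^ n)%R); auto.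
  intros n. rewrite Rabs_pos_eq.
  apply Rmult_le_compat_r; auto. apply pow_le; lra. apply Rmult_le_pos. apply Cmod_ge_0. apply pow_le; lra.
Qed.

Lemma binom_coef_summable alpha : CPS_summable (binom_coef alpha) 1.
Proof.
  pose proof (Cmod_ge_0 alpha).
  apply (CPS_summable_le _ (binom_coefR (Cmod alpha + 1))). intros n. apply binom_coef_le; lra. intros x Hx. apply ex_series_binom_coefR; auto; lra.
Qed.

(** The recurrence [(n+1) a_(n+1) = (alpha + n) a_n] read on the series, with [n a_n] as the
    coefficients of [x f']. *)
Lemma binomial_ode alpha x : (Rabs x < 1)%R ->
  (1 - RtoC x) * CPSeries (CPS_derive (binom_coef alpha)) x = alpha * CPSeries (binom_coef alpha) x.
Proof.
  intros Hx. pose proof (CPSeries_is_series _ 1 x (binom_coef_summable alpha) Hx) as S1.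
  pose proof (CPS_derive_series _ 1 x (binom_coef_summable alpha) Hx) as S2.
  assert (S3 : is_Cseries (fun n => natC n * binom_coef alpha n * RtoC (x ^ n)) (RtoC x * CPSeries (CPS_derive (binom_coef alpha)) x)).
  { replace (RtoC x * CPSeries (CPS_derive (binom_coef alpha)) x) with (natC 0 * binom_coef alpha 0 * RtoC (x ^ 0) + RtoC x * CPSeries (CPS_derive (binom_coef alpha)) x).
    apply (is_Cseries_shift (fun n => natC n * binom_coef alpha n * RtoC (x ^ n))).
    apply (is_Cseries_ext (fun n => RtoC x * (CPS_derive (binom_coef alpha) n * RtoC (x ^ n)))).
    intros n. unfold CPS_derive. simpl pow. rewrite RtoC_mult. ring. apply is_Cseries_scal; auto. unfold natC; simpl. ring. }
  assert (S4 : is_Cseries (fun n => CPS_derive (binom_coef alpha) n * RtoC (x ^ n)) (alpha * CPSeries (binom_coef alpha) x + RtoC x * CPSeries (CPS_derive (binom_coef alpha)) x)).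
  { eapply is_Cseries_ext; [|apply is_Cseries_plus; [apply (is_Cseries_scal alpha); exact S1|exact S3]].
    intros n. unfold CPS_derive. rewrite binom_coef_S. pose proof (natC_neq_0 n). field. auto. }
  pose proof (is_Clim_unique _ _ _ S2 S4) as E.
  replace ((1 - RtoC x) * CPSeries (CPS_derive (binom_coef alpha)) x) with (CPSeries (CPS_derive (binom_coef alpha)) x - RtoC x * CPSeries (CPS_derive (binom_coef alpha)) x) by ring.
  rewrite E at 1. ring.
Qed.

Lemma is_Cderive_zero_const f a b : (forall t, (Rmin a b <= t <= Rmax a b)%R -> is_Cderive f t 0) -> f a = f b.
Proof.
  intros H. destruct (Rtotal_order a b) as [Hl|[->|Hl]]; auto.
  - rewrite Rmin_left, Rmax_right in H by lra. apply (eq_is_derive (V:=C_R_NormedModule) f a b); auto.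
  - rewrite Rmin_right, Rmax_left in H by lra. symmetry. apply (eq_is_derive (V:=C_R_NormedModule) f b a); auto.
Qed.

(** By the differential equation, the product of [(1 - x)^alpha] and the series has zero derivative;
    at 0 it equals 1. *)
Lemma binomial_series alpha x : (Rabs x < 1)%R -> CPSeries (binom_coef alpha) x = rpow (1 - x) (- alpha).
Proof.
  intros Hx.
  set (f := fun t : R => rpow (1 - t) alpha * CPSeries (binom_coef alpha) t).
  assert (E : f 0%R = f x).
  { apply is_Cderive_zero_const. intros t Ht.
    assert (Ht1 : (Rabs t < 1)%R).
    { apply Rabs_def2 in Hx. apply Rabs_def1; destruct (Rle_lt_dec 0 x);
      [rewrite Rmax_right in Ht by lra|rewrite Rmax_left in Ht by lra|rewrite Rmin_left in Ht by lra|rewrite Rmin_right in Ht by lra]; lra. }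
    pose proof (binomial_ode alpha t Ht1) as O. assert (Ht2 := Rabs_def2 _ _ Ht1).
    assert (D1 : is_derive (fun t : R => 1 - t)%R t (-1)%R) by (auto_derive; auto; ring).
    eapply is_Cderive_eq.
    apply is_Cderive_mult. eapply (is_Cderive_comp (fun s => rpow s alpha) (fun t => 1 - t)%R).
    apply is_Cderive_rpow. lra. exact D1. apply (is_Cderive_CPSeries _ 1 t (binom_coef_summable alpha) Ht1).
    replace (alpha - 1) with (alpha + - (1)) by ring. rewrite rpow_add, rpow_opp, rpow_1 by lra.
    assert (N : RtoC (1 - t) <> 0) by (intros N; apply RtoC_inj in N; lra).
    rewrite RtoC_m1. 
    replace (CPSeries (CPS_derive (binom_coef alpha)) t) with (alpha * CPSeries (binom_coef alpha) t / RtoC (1 - t)).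
    field; auto. rewrite <- O, RtoC_minus. rewrite RtoC_minus in N. field; auto. }
  unfold f in E. rewrite CPSeries_0, Rminus_0_r, rpow_1_l in E.
  rewrite rpow_opp. pose proof (rpow_neq_0 (1 - x) alpha).
  replace (binom_coef alpha 0) with (RtoC 1) in E by (unfold binom_coef; simpl; field; intros N; apply RtoC_inj in N; lra).
  replace (CPSeries (binom_coef alpha) x) with (rpow (1 - x) alpha * CPSeries (binom_coef alpha) x / rpow (1 - x) alpha) by (field; auto).
  rewrite <- E. field; auto.
Qed.

Lemma binom_coef_RtoC P n : binom_coef (RtoC P) n = RtoC (binom_coefR P n).
Proof. unfold binom_coef, binom_coefR. rewrite Cpoch_RtoC, RtoC_div. reflexivity. pose proof (INR_fact_pos n). lra. Qed.

Lemma binomial_series_R P x : (Rabs x < 1)%R -> is_series (fun n => binom_coefR P n * x ^ n)%R (Rpower (1 - x) (- P)).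
Proof.
  intros Hx. pose proof (CPSeries_is_series _ 1 x (binom_coef_summable (RtoC P)) Hx) as H. rewrite binomial_series in H by auto.
  apply is_Cseries_Re in H. apply Rabs_def2 in Hx.
  rewrite <- RtoC_opp, rpow_RtoC in H by lra.
  eapply is_series_ext; [|exact H]. intros n. cbv beta. rewrite binom_coef_RtoC, <- RtoC_mult. reflexivity.
Qed.

(** Coefficients of Gauss's series 2F1(A, B; c; x). The lower parameter is real and taken positive
    in the estimates, which keeps the denominators away from 0. *)
Definition hyp_coef (A B : C) (c : R) (i : nat) : C := Cpochhammer A i * Cpochhammer B i / (RtoC (INR (fact i)) * RtoC (Rpoch c i)).

Lemma hyp_coef_S A B c i : (0 < c)%R -> hyp_coef A B c (S i) = hyp_coef A B c i * ((A + natC i) * (B + natC i) / (natC (S i) * RtoC (c + INR i))).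
Proof.
  intros Hc. unfold hyp_coef. simpl Cpochhammer. simpl Rpoch. rewrite fact_simpl, mult_INR, !RtoC_mult.
  pose proof (INR_fact_pos i). pose proof (natC_neq_0 i). unfold natC in *. pose proof (Rpoch_pos c i Hc). pose proof (pos_INR i).
  field. repeat split; auto; intros E; apply RtoC_inj in E; lra.
Qed.

(* Chosen so that [|A+i| |B+i| <= (hyp_maj A B c + i) (c+i)] for all [i], which lets a binomial series
   dominate the hypergeometric one. *)
Definition hyp_maj (A B : C) (c : R) : R := (Cmod A * Cmod B / c + Cmod A + Cmod B + 1)%R.

Lemma hyp_maj_ge_1 A B c : (0 < c)%R -> (1 <= hyp_maj A B c)%R.
Proof. intros Hc. unfold hyp_maj. pose proof (Cmod_ge_0 A). pose proof (Cmod_ge_0 B). assert (0 <= Cmod A * Cmod B / c)%R by (apply Rdiv_le_0_compat; nra). lra. Qed.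

Lemma hyp_coef_le A B c i : (0 < c)%R -> (Cmod (hyp_coef A B c i) <= binom_coefR (hyp_maj A B c) i)%R.
Proof.
  intros Hc. induction i.
  - unfold hyp_coef, binom_coefR; simpl. replace (1 * 1 / (1%R * 1%R)) with (RtoC 1) by (field; intros N; apply RtoC_inj in N; lra). rewrite Cmod_1. lra.
  - rewrite hyp_coef_S, binom_coefR_S, Cmod_mult by auto. apply Rmult_le_compat; try apply Cmod_ge_0; auto.
    pose proof (pos_INR i). pose proof (natC_neq_0 i) as N.
    assert (N2 : RtoC (c + INR i) <> 0) by (intros E; apply RtoC_inj in E; lra).
    rewrite Cmod_div by (apply Cmult_neq_0; auto). rewrite !Cmod_mult, Cmod_natC, Cmod_R, (Rabs_pos_eq (c + INR i)) by lra.
    pose proof (Cmod_triangle A (natC i)) as T1. pose proof (Cmod_triangle B (natC i)) as T2. rewrite Cmod_natC in T1, T2.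
    pose proof (Cmod_ge_0 A). pose proof (Cmod_ge_0 B). pose proof (Cmod_ge_0 (A + natC i)). pose proof (Cmod_ge_0 (B + natC i)).
    assert (HS : (0 < INR (S i))%R) by (apply lt_0_INR; lia).
    apply Rmult_le_reg_r with (INR (S i) * (c + INR i))%R. nra.
    replace (Cmod (A + natC i) * Cmod (B + natC i) / (INR (S i) * (c + INR i)) * (INR (S i) * (c + INR i)))%R with (Cmod (A + natC i) * Cmod (B + natC i))%R by (field; lra).
    replace ((hyp_maj A B c + INR i) / INR (S i) * (INR (S i) * (c + INR i)))%R with ((hyp_maj A B c + INR i) * (c + INR i))%R by (field; lra).
    apply Rle_trans with ((Cmod A + INR i) * (Cmod B + INR i))%R. apply Rmult_le_compat; auto.
    unfold hyp_maj. set (d := (Cmod A * Cmod B / c)%R). assert (Ed : (Cmod A * Cmod B = d * c)%R) by (unfold d; field; lra).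
    assert (0 <= d)%R by (apply Rdiv_le_0_compat; nra).
    replace ((Cmod A + INR i) * (Cmod B + INR i))%R with (Cmod A * Cmod B + (Cmod A + Cmod B) * INR i + INR i * INR i)%R by ring.
    rewrite Ed. nra.
Qed.

Lemma hyp_coef_summable A B c : (0 < c)%R -> CPS_summable (hyp_coef A B c) 1.
Proof.
  intros Hc. pose proof (hyp_maj_ge_1 A B c Hc). apply (CPS_summable_le _ (binom_coefR (hyp_maj A B c))). intros; apply hyp_coef_le; auto.
  intros; apply ex_series_binom_coefR; auto; lra.
Qed.

(** * Domination of the integrands and termwise integration *)

Lemma poly_exp_bound r x : (0 < x)%R -> exists K, (0 < K)%R /\ forall t, (0 <= t)%R -> (Rpower (1 + t) r * exp (- (x * t)) <= K)%R.
Proof.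
  intros Hx. destruct (Rle_lt_dec r 0).
  - exists 1%R. split. lra. intros t Ht.
    assert (Rpower (1 + t) r <= 1)%R. { replace 1%R with (Rpower (1 + t) 0) at 2 by (apply Rpower_O; lra). apply Rle_Rpower; lra. }
    assert (exp (- (x * t)) <= 1)%R. { rewrite <- exp_0. destruct (Req_dec (x * t) 0). rewrite H0. rewrite Ropp_0. lra. left; apply exp_increasing. nra. }
    pose proof (exp_pos (- (x * t))). nra.
  (* From [1 + ln y <= y] at [y = (1 + t) x / r] one gets [r ln (1 + t) - x t <= x - r - r ln (x /
     r)]; the term [- r] is then dropped. *)
  - exists (exp (x - r * ln (x / r))). split. apply exp_pos. intros t Ht.
    unfold Rpower. rewrite <- exp_plus.
    assert (Hxr : (0 < x / r)%R) by (apply Rdiv_lt_0_compat; lra).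
    assert (L : (ln (1 + t) <= (1 + t) * (x / r) - 1 - ln (x / r))%R).
    { assert (E : (ln ((1 + t) * (x / r)) = ln (1 + t) + ln (x / r))%R) by (apply ln_mult; lra).
      assert (P0 : (0 < (1 + t) * (x / r))%R) by nra.
      pose proof (exp_ineq1_le (ln ((1 + t) * (x / r)))) as I. rewrite exp_ln in I by auto. lra. }
    apply (Rmult_le_compat_l r) in L; [|lra].
    replace (r * ((1 + t) * (x / r) - 1 - ln (x / r)))%R with ((1 + t) * x - r - r * ln (x / r))%R in L by (field; lra).
    assert (B : (r * ln (1 + t) + - (x * t) <= x - r * ln (x / r))%R) by lra.
    destruct B as [B|B]. left; apply exp_increasing; auto. rewrite B; lra.
Qed.

(** Division by [dsat a t] leaves [(1 + t)^r (1 + t^a)^2 e^{-x t} / a], and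
    [1 + t^a <= 2 (1 + t)^a]; hence the exponent [r + 2 a] and the constant [4 / a]. *)
Lemma rpow_exp_le_dsat a r x : (0 < a)%R -> (0 < x)%R -> exists K, (0 < K)%R /\ forall t, (0 < t)%R ->
  (Rpower t (a - 1) * Rpower (1 + t) r * exp (- (x * t)) <= K * dsat a t)%R.
Proof.
  intros Ha Hx. destruct (poly_exp_bound (r + (a + a)) x Hx) as (K & HK & H).
  exists (K * (4 / a))%R. split. apply Rmult_lt_0_compat; auto. apply Rdiv_lt_0_compat; lra.
  intros t Ht. specialize (H t ltac:(lra)). rewrite !Rpower_plus in H. unfold dsat.
  pose proof (Rpower_pos t a) as Pa. pose proof (Rpower_pos t (a-1)) as Pb. 
  pose proof (Rpower_pos (1+t) r) as Pd. pose proof (exp_pos (- (x * t))) as Pe.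
  assert (B1 : (Rpower t a <= Rpower (1 + t) a)%R) by (apply Rpower_incr_base; lra).
  assert (B2 : (1 <= Rpower (1 + t) a)%R). { replace 1%R with (Rpower (1 + t) 0) at 1 by (apply Rpower_O; lra). apply Rle_Rpower; lra. }
  set (X := Rpower t a) in *. set (Y := Rpower (1 + t) a) in *. set (Z := Rpower t (a - 1)) in *.
  set (W := (Rpower (1 + t) r * exp (- (x * t)))%R) in *.
  replace (K * (4 / a) * (a * Z / ((1 + X) * (1 + X))))%R with (Z * (4 * K / ((1 + X) * (1 + X))))%R by (field; lra).
  replace (Z * Rpower (1 + t) r * exp (- (x * t)))%R with (Z * W)%R by (unfold W; ring).
  apply Rmult_le_compat_l. lra.
  apply Rmult_le_reg_r with ((1 + X) * (1 + X))%R. nra.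
  replace (4 * K / ((1 + X) * (1 + X)) * ((1 + X) * (1 + X)))%R with (4 * K)%R by (field; lra).
  assert (HW : (W * (Y * Y) <= K)%R) by (unfold W; lra).
  assert (0 < W)%R by (unfold W; nra).
  assert ((1 + X) * (1 + X) <= 4 * (Y * Y))%R by nra.
  apply Rle_trans with (W * (4 * (Y * Y)))%R. apply Rmult_le_compat_l; lra. lra.
Qed.

Lemma dsat_le_inv a t : (0 < a)%R -> (0 < t)%R -> (dsat a t <= a / t)%R.
Proof.
  intros Ha Ht. unfold dsat. pose proof (Rpower_pos t a).
  replace (Rpower t (a - 1)) with (Rpower t a / t)%R.
  2:{ replace (a - 1)%R with (a + - (1))%R by ring. rewrite Rpower_plus, Rpower_Ropp, Rpower_1 by auto. reflexivity. }
  set (X := Rpower t a) in *. apply Rmult_le_reg_r with (t * ((1 + X) * (1 + X)))%R. nra.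
  field_simplify; try lra. nra.
Qed.

(** Termwise integration of [h(t)] times the sum of [q_i x(t)^i]. The sum [S] of the majorant series
    controls all partial sums at once, so [h S] being dominated gives the domination. On a compact
    interval [x] stays below some [X] at which the majorant converges, which gives uniform
    convergence there. *)
Lemma is_CInt_series_swap (q : nat -> C) (r : nat -> R) (h : R -> C) (x : R -> R) (s : R -> C) (S : R -> R) (l : nat -> C) a K :
  (0 < a)%R -> Ccont_pos h -> Ccont_pos s -> (forall t, (0 < t)%R -> continuous x t) ->
  (forall i, (Cmod (q i) <= r i)%R) ->
  (forall t, (0 < t)%R -> (0 <= x t)%R) ->
  (forall t, (0 < t)%R -> is_series (fun i => r i * x t ^ i)%R (S t)) ->
  (forall t, (0 < t)%R -> (Cmod (h t) * S t <= K * dsat a t)%R) ->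
  dominated a K h ->
  (forall p q0, (0 < p <= q0)%R -> exists X SX, (forall t, (p <= t <= q0)%R -> (x t <= X)%R) /\ is_series (fun i => r i * X ^ i)%R SX) ->
  (forall t, (0 < t)%R -> is_Cseries (fun i => q i * RtoC (x t ^ i)) (s t)) ->
  (forall i, is_CInt (fun t => h t * RtoC (x t ^ i)) (l i)) ->
  exists m, is_CInt (fun t => h t * s t) m /\ is_Cseries (fun i => q i * l i) m.
Proof.
  intros Ha Hh Hs Hx Hq Hx0 HS HhS HdK Hloc Hser Hl.
  pose proof (dominated_K_pos a K h Ha HdK) as HK.
  assert (Hcx : forall i, Ccont_pos (fun t => RtoC (x t ^ i))).
  { intros i t Ht. apply Ccont_RtoC. induction i; simpl. apply continuous_const. apply (continuous_mult (K:=R_AbsRing)); auto. }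
  assert (Hr0 : forall i, (0 <= r i)%R) by (intros i; eapply Rle_trans; [apply Cmod_ge_0|apply Hq]).
  destruct (is_CInt_dominated_cvg (fun n t => Csum (fun i => q i * (h t * RtoC (x t ^ i))) n) (fun t => h t * s t) (Csum (fun i => q i * l i)) a K) as (m & Hm1 & Hm2); auto.
  - intros n. apply Ccont_pos_sum. intros i. apply Ccont_pos_scal. apply Ccont_pos_mult; auto.
  - apply Ccont_pos_mult; auto.
  - intros n t Ht. eapply Rle_trans; [|apply HhS; auto].
    rewrite (Csum_ext _ (fun i => h t * (q i * RtoC (x t ^ i)))) by (intros; ring).
    rewrite Csum_scal, Cmod_mult. apply Rmult_le_compat_l. apply Cmod_ge_0.
    eapply Rle_trans. apply (Csum_Cmod _ (fun i => r i * x t ^ i)%R).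
    + intros i _. rewrite Cmod_mult, Cmod_R, Rabs_pos_eq by (apply pow_le; auto). apply Rmult_le_compat_r; auto. apply pow_le; auto.
    + apply Csum_le_series; auto. intros i. apply Rmult_le_pos; auto. apply pow_le; auto.
  - intros p q0 eps Hp He. destruct (Hloc p q0 Hp) as (X & SX & HX & HSX).
    assert (HB : exists B, (0 < B)%R /\ forall t, (p <= t <= q0)%R -> (Cmod (h t) <= B)%R).
    { exists (K * (a / p) + 1)%R. assert (0 < a / p)%R by (apply Rdiv_lt_0_compat; lra). split. nra.
      intros t Ht. eapply Rle_trans. apply HdK; lra. apply Rle_trans with (K * (a / p))%R; [|lra].
      apply Rmult_le_compat_l; auto. eapply Rle_trans. apply dsat_le_inv; lra.
      apply Rmult_le_compat_l. lra. apply Rinv_le_contravar; lra. }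
    destruct HB as (B & HB0 & HB).
    pose proof (HSX : is_lim_seq (sum_n (fun i => r i * X ^ i)%R) SX) as HSX'. apply is_lim_seq_spec in HSX'.
    assert (He' : (0 < eps / B)%R) by (apply Rdiv_lt_0_compat; lra).
    destruct (HSX' (mkposreal _ He')) as [N HN]. exists (Datatypes.S N). intros n t Hn Ht.
    destruct n as [|n]; [lia|]. specialize (HN n ltac:(lia)). simpl in HN.
    rewrite (Csum_ext _ (fun i => h t * (q i * RtoC (x t ^ i)))) by (intros; ring).
    rewrite Csum_scal. rewrite Cmod_minus_sym.
    replace (h t * s t - h t * Csum (fun i => q i * RtoC (x t ^ i)) (Datatypes.S n)) with (h t * (s t - Csum (fun i => q i * RtoC (x t ^ i)) (Datatypes.S n))) by ring.
    rewrite Cmod_mult. apply Rle_trans with (B * (eps / B))%R; [|right; field; lra].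
    apply Rmult_le_compat; try apply Cmod_ge_0. apply HB; auto.
    eapply Rle_trans. apply (is_Cseries_tail_le _ _ (fun i => r i * X ^ i)%R SX).
    + apply Hser; lra.
    + intros i. rewrite Cmod_mult, Cmod_R, Rabs_pos_eq by (apply pow_le; apply Hx0; lra).
      apply Rmult_le_compat; auto. apply Cmod_ge_0. apply pow_le; apply Hx0; lra. apply pow_incr. split. apply Hx0; lra. auto.
    + auto.
    + rewrite Csum_Re. apply Rabs_def2 in HN. 
      replace (sum_n (fun i => Re (RtoC (r i * X ^ i))) n) with (sum_n (fun i => r i * X ^ i)%R n) by (apply sum_n_ext; reflexivity).
      lra.
  - intros n. apply (is_CInt_csum (fun i t => q i * (h t * RtoC (x t ^ i)))). intros i. apply is_CInt_scal; auto. apply Ccont_pos_mult; auto.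
  - exists m. split; auto.
Qed.

(** * The Gamma function *)

(** Projection on the direction of [z = f 1 - f 0]: the real mean value theorem is applied to the
    real part of [Cconj z * f]. *)
Lemma Cderive_mean_value_le (f df : R -> C) (M : R) :
  (forall s, (0 <= s <= 1)%R -> is_Cderive f s (df s) /\ (Cmod (df s) <= M)%R) -> (Cmod (f 1%R - f 0%R) <= M)%R.
Proof.
  intros H. set (z := f 1%R - f 0%R). 
  assert (HM : (0 <= M)%R). { destruct (H 0%R ltac:(lra)) as [_ H0]. eapply Rle_trans; [apply Cmod_ge_0|exact H0]. }
  destruct (Req_dec (Cmod z) 0) as [E|E]. rewrite E; auto.
  destruct (MVT_gen (fun s => Re (Cconj z * f s)) 0 1 (fun s => Re (Cconj z * df s))) as [c [Hc Eq]].
  - intros s Hs. rewrite Rmin_left, Rmax_right in Hs by lra. apply is_Cderive_Re. apply is_Cderive_scal. apply H. lra.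
  - intros s Hs. rewrite Rmin_left, Rmax_right in Hs by lra. apply continuity_pt_filterlim. apply (Ccont_Re (fun s => Cconj z * f s)).
    apply Ccont_mult. apply Ccont_const. eapply is_Cderive_cont. apply H; auto.
  - rewrite Rmin_left, Rmax_right in Hc by lra. destruct (H c Hc) as [_ Hb].
    assert (Ez : (Re (Cconj z * f 1%R) - Re (Cconj z * f 0%R) = Cmod z * Cmod z)%R).
    { rewrite Cmod_sqr. unfold z, Re, Im; simpl. unfold Re, Im; ring. }
    rewrite Ez in Eq. pose proof (re_le_Cmod (Cconj z * df c)) as R1. rewrite Cmod_mult, Cmod_conj in R1.
    pose proof (Rle_abs (Re (Cconj z * df c))). pose proof (Cmod_ge_0 z).
    assert (Cmod z * Cmod z <= Cmod z * M)%R. { rewrite Eq. eapply Rle_trans; [|apply Rmult_le_compat_l; [|exact Hb]]; lra. }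
    apply Rmult_le_reg_l with (Cmod z); lra.
Qed.

Lemma Cexp_lipschitz a b m : (Re a <= m)%R -> (Re b <= m)%R -> (Cmod (Cexp b - Cexp a) <= Cmod (b - a) * exp m)%R.
Proof.
  intros Ha Hb.
  replace (Cexp b - Cexp a) with (Cexp (a + RtoC 1 * (b - a)) - Cexp (a + RtoC 0 * (b - a))) by (f_equal; [|f_equal]; f_equal; ring).
  apply (Cderive_mean_value_le (fun s => Cexp (a + RtoC s * (b - a))) (fun s => (b - a) * Cexp (a + RtoC s * (b - a)))).
  intros s Hs. split.
  - apply is_Cderive_Cexp. eapply is_Cderive_eq. apply is_Cderive_plus. apply is_Cderive_const.
    apply is_Cderive_mult. apply is_Cderive_RtoC. apply is_derive_id. apply is_Cderive_const. unfold one; simpl. ring.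
  - rewrite Cmod_mult, Cmod_Cexp. apply Rmult_le_compat_l. apply Cmod_ge_0.
    assert (B : (Re (a + RtoC s * (b - a)) <= m)%R). { unfold Re in *; simpl in *. nra. }
    destruct B as [B|B]. left; apply exp_increasing; auto. rewrite B; lra.
Qed.

Lemma Cexp_taylor1 a b m : (Re a <= m)%R -> (Re b <= m)%R ->
  (Cmod (Cexp b - Cexp a - (b - a) * Cexp a) <= Cmod (b - a) * Cmod (b - a) * exp m)%R.
Proof.
  intros Ha Hb. set (f := fun s : R => Cexp (a + RtoC s * (b - a)) - RtoC s * ((b - a) * Cexp a)).
  replace (Cexp b - Cexp a - (b - a) * Cexp a) with (f 1%R - f 0%R).
  2:{ unfold f. replace (a + 1%R * (b - a)) with b by ring. replace (a + 0%R * (b - a)) with a by ring. ring. }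
  apply (Cderive_mean_value_le f (fun s => (b - a) * (Cexp (a + RtoC s * (b - a)) - Cexp a))).
  intros s Hs. split.
  - eapply is_Cderive_eq. apply is_Cderive_minus. apply is_Cderive_Cexp. apply is_Cderive_plus. apply is_Cderive_const.
    apply is_Cderive_mult. apply is_Cderive_RtoC. apply is_derive_id. apply is_Cderive_const.
    apply is_Cderive_mult. apply is_Cderive_RtoC. apply is_derive_id. apply is_Cderive_const. unfold one; simpl. ring.
  - rewrite Cmod_mult, Rmult_assoc. apply Rmult_le_compat_l. apply Cmod_ge_0.
    assert (B : (Re (a + RtoC s * (b - a)) <= m)%R). { unfold Re in *; simpl in *. nra. }
    eapply Rle_trans. apply (Cexp_lipschitz _ _ m); auto.
    apply Rmult_le_compat_r. left; apply exp_pos.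
    replace (a + RtoC s * (b - a) - a) with (RtoC s * (b - a)) by ring. rewrite Cmod_mult, Cmod_R, Rabs_pos_eq by lra.
    pose proof (Cmod_ge_0 (b - a)). nra.
Qed.

Lemma is_Cderive_of_quadratic (f : R -> C) x l (M d : R) : (0 < d)%R ->
  (forall h, (Rabs h < d)%R -> (Cmod (f (x + h)%R - f x - RtoC h * l) <= M * (h * h))%R) -> is_Cderive f x l.
Proof.
  intros Hd H.
  assert (HM : (0 <= M)%R).
  { specialize (H (d/2)%R). rewrite Rabs_pos_eq in H by lra. specialize (H ltac:(lra)).
    pose proof (Cmod_ge_0 (f (x + d / 2)%R - f x - RtoC (d / 2) * l)). apply Rnot_lt_le; intros Hlt.
    assert (0 < d / 2 * (d / 2))%R by nra. nra. }
  (* Stated for a real-linear functional bounded by the modulus, so as to treat [Re] and [Im]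
     together. *)
  assert (G : forall g : C -> R, (forall a b : C, g (a - b)%C = (g a - g b)%R) -> (forall (r : R) (a : C), g (RtoC r * a)%C = (r * g a)%R) ->
     (forall a : C, Rabs (g a) <= Cmod a)%R -> is_derive (fun t => g (f t)) x (g l)).
  { intros g Hg1 Hg2 Hg3. apply is_derive_Reals. intros eps He.
    assert (Hdd : (0 < Rmin d (eps / (M + 1)))%R). { apply Rmin_glb_lt; auto. apply Rdiv_lt_0_compat; lra. }
    exists (mkposreal _ Hdd). intros h Hh Hlt. simpl in Hlt.
    pose proof (Rmin_l d (eps / (M+1))). pose proof (Rmin_r d (eps / (M+1))).
    specialize (H h ltac:(lra)). pose proof (Hg3 (f (x + h)%R - f x - RtoC h * l)) as G3. rewrite !Hg1, Hg2 in G3.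
    assert (Hpos : (0 < Rabs h)%R) by (apply Rabs_pos_lt; auto).
    replace ((g (f (x + h)%R) - g (f x)) / h - g l)%R with ((g (f (x + h)%R) - g (f x) - h * g l) * / h)%R by (field; auto).
    rewrite Rabs_mult, Rabs_inv.
    apply Rmult_lt_reg_r with (Rabs h); auto. rewrite Rmult_assoc, Rinv_l, Rmult_1_r by lra.
    eapply Rle_lt_trans. apply G3. eapply Rle_lt_trans. apply H.
    replace (h * h)%R with (Rabs h * Rabs h)%R. 2:{ rewrite <- Rabs_mult. apply Rabs_pos_eq. apply Rle_0_sqr. }
    set (e := (eps / (M + 1))%R) in *. assert (eps = e * (M + 1))%R by (unfold e; field; lra).
    rewrite <- Rmult_assoc. apply Rmult_lt_compat_r; auto.
    assert (Rabs h < e)%R by lra. apply Rle_lt_trans with (M * e)%R. apply Rmult_le_compat_l; lra. nra. }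
  apply is_Cderive_pair.
  - apply (G Re). intros; reflexivity. intros; unfold Re; simpl; ring. apply re_le_Cmod.
  - apply (G Im). intros; reflexivity. intros; unfold Im, Re; simpl; ring. apply im_le_Cmod.
Qed.

Lemma Cexp_Clog (c : C) : c <> 0 -> Cexp (Clog c) = c.
Proof.
  intros Hc. assert (Hm : (0 < Cmod c)%R) by (exact (proj1 (Cmod_gt_0 c) ltac:(assumption))).
  pose proof (Cmod_sqr c) as Sq. destruct c as [x y]. unfold Clog, Cexp, Carg.
  set (m := Cmod (x, y)) in *. clearbody m. unfold Re, Im in *; simpl in *. rewrite exp_ln by auto.
  assert (Hx : (-1 <= x / m <= 1)%R).
  { split; apply Rmult_le_reg_r with m; auto; replace (x / m * m)%R with x by (field; lra); nra. }
  assert (Hs : (m * sqrt (1 - Rsqr (x / m)) = Rabs y)%R).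
  { rewrite <- (sqrt_Rsqr m) at 1 by lra. rewrite <- sqrt_mult. 
    replace (Rsqr m * (1 - Rsqr (x / m)))%R with (Rsqr y). apply sqrt_Rsqr_abs.
    unfold Rsqr. replace (m * m * (1 - x / m * (x / m)))%R with (m * m - x * x)%R by (field; lra). lra.
    apply Rle_0_sqr. unfold Rsqr. nra. }
  destruct (Rle_dec 0 y).
  - rewrite cos_acos, sin_acos by auto. apply C_ext; unfold Re, Im; simpl.
    field; lra. rewrite Hs. apply Rabs_pos_eq; auto.
  - rewrite cos_neg, sin_neg, cos_acos, sin_acos by auto. apply C_ext; unfold Re, Im; simpl.
    field; lra. rewrite Ropp_mult_distr_r_reverse, Hs. rewrite Rabs_left; lra.
Qed.

Lemma Carg_bound c : (0 < Re c)%R -> (- (PI / 2) < Carg c < PI / 2)%R.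
Proof.
  intros Hc. 
  assert (Hn : c <> 0) by (intros E; rewrite E in Hc; simpl in Hc; lra).
  assert (Hm : (0 < Cmod c)%R) by (exact (proj1 (Cmod_gt_0 c) ltac:(assumption))).
  assert (Hx : (0 < Re c / Cmod c <= 1)%R).
  { split. apply Rdiv_lt_0_compat; auto. apply Rmult_le_reg_r with (Cmod c); auto. pose proof (re_le_Cmod c). pose proof (Rle_abs (Re c)).
    replace (Re c / Cmod c * Cmod c)%R with (Re c) by (field; lra). lra. }
  assert (Ha : (acos (Re c / Cmod c) < PI / 2)%R).
  { pose proof (acos_bound (Re c / Cmod c)). apply Rnot_le_lt. intros Hle.
    pose proof (cos_le_0 (acos (Re c / Cmod c)) Hle ltac:(lra)) as K. rewrite cos_acos in K by lra. lra. }
  pose proof (acos_bound (Re c / Cmod c)). unfold Carg. destruct (Rle_dec 0 (Im c)); lra.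
Qed.

(** * Laplace integrals of powers *)

Definition laplace_fun (w c : C) (t : R) : C := Cexp (- (c * RtoC t)) * rpow t (w - 1).
Definition laplace_int (w c : C) : C := Cint_0_oo (laplace_fun w c).

Lemma Ccont_pos_Cexp_linear c : Ccont_pos (fun t => Cexp (- (c * RtoC t))).
Proof. apply Ccont_pos_Cexp. intros t Ht. apply Ccont_opp. apply (Ccont_pos_scal c _ Ccont_pos_id t Ht). Qed.

Lemma laplace_fun_cont w c : Ccont_pos (laplace_fun w c).
Proof. apply Ccont_pos_mult. apply Ccont_pos_Cexp_linear. apply Ccont_pos_rpow. Qed.

Lemma exp_le a b : (a <= b)%R -> (exp a <= exp b)%R.
Proof. intros [H|H]. left; apply exp_increasing; auto. rewrite H; lra. Qed.

Lemma Cmod_Cexp_linear c t : Cmod (Cexp (- (c * RtoC t))) = exp (- (Re c * t)).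
Proof. rewrite Cmod_Cexp. f_equal. unfold Re; simpl. ring. Qed.

Lemma Cmod_laplace_fun w c t : (0 < t)%R -> Cmod (laplace_fun w c t) = (exp (- (Re c * t)) * Rpower t (Re w - 1))%R.
Proof. intros Ht. unfold laplace_fun. rewrite Cmod_mult, Cmod_Cexp_linear, Cmod_rpow by auto. f_equal. Qed.

Lemma laplace_fun_dominated w c0 : (0 < Re w)%R -> (0 < c0)%R -> exists K, (0 < K)%R /\ forall c, (c0 <= Re c)%R -> dominated (Re w) K (laplace_fun w c).
Proof.
  intros Hw Hc. destruct (rpow_exp_le_dsat (Re w) 0 c0 Hw Hc) as (K & HK & H). exists K. split; auto.
  intros c Hcc t Ht. rewrite Cmod_laplace_fun by auto. eapply Rle_trans; [|apply H; auto].
  rewrite Rpower_O by lra. rewrite Rmult_1_r, Rmult_comm. apply Rmult_le_compat_l. left; apply Rpower_pos.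
  apply exp_le. nra.
Qed.

Lemma is_CInt_laplace w c : (0 < Re w)%R -> (0 < Re c)%R -> is_CInt (laplace_fun w c) (laplace_int w c).
Proof.
  intros Hw Hc. destruct (laplace_fun_dominated w (Re c) Hw Hc) as (K & HK & H).
  destruct (dominated_ex_CInt (laplace_fun w c) (Re w) K) as [l Hl]; auto. apply laplace_fun_cont. apply H; lra.
  unfold laplace_int. rewrite (is_CInt_Cint _ _ Hl). auto.
Qed.

Lemma rpow_exp_lim_oo w c : (0 < Re c)%R -> forall eps, (0 < eps)%R ->
  exists M, forall q, (M < q)%R -> (0 < q)%R -> (Cmod (Cexp (- (c * RtoC q)) * rpow q w) < eps)%R.
Proof.
  intros Hc eps He. destruct (poly_exp_bound (Rabs (Re w) + 1) (Re c) Hc) as (K & HK & H).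
  exists (Rmax 1 (K / eps))%R. intros q Hq' Hq0. rewrite Cmod_mult, Cmod_Cexp_linear, Cmod_rpow by auto.
  pose proof (Rmax_l 1 (K / eps)). pose proof (Rmax_r 1 (K / eps)). assert (Hq : (K / eps < q)%R) by lra.
  specialize (H q ltac:(lra)). rewrite Rpower_plus, Rpower_1 in H by lra.
  assert (B : (Rpower q (Re w) <= Rpower (1 + q) (Rabs (Re w)))%R).
  { apply Rle_trans with (Rpower q (Rabs (Re w))). apply Rle_Rpower; [lra|]. apply Rle_abs. apply Rpower_incr_base; [apply Rabs_pos|lra]. }
  pose proof (exp_pos (- (Re c * q))). 
  set (E := exp (- (Re c * q))) in *. set (P := Rpower (1 + q) (Rabs (Re w))) in *.
  apply Rle_lt_trans with (E * P)%R. apply Rmult_le_compat_l; lra.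
  apply Rmult_lt_reg_r with (1 + q)%R. lra. apply Rle_lt_trans with K. lra.
  apply (Rmult_lt_compat_l eps) in Hq; auto. replace (eps * (K / eps))%R with K in Hq by (field; lra). nra.
Qed.

Lemma rpow_exp_lim_0 w c : (0 < Re w)%R -> (0 < Re c)%R -> forall eps, (0 < eps)%R ->
  exists d, (0 < d)%R /\ forall p, (0 < p < d)%R -> (Cmod (Cexp (- (c * RtoC p)) * rpow p w) < eps)%R.
Proof.
  intros Hw Hc eps He. exists (exp (ln eps / Re w)). split. apply exp_pos. intros p Hp.
  rewrite Cmod_mult, Cmod_Cexp_linear, Cmod_rpow by lra.
  assert (E1 : (exp (- (Re c * p)) <= 1)%R) by (rewrite <- exp_0; apply exp_le; nra).
  assert (E2 : (Rpower p (Re w) < eps)%R).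
  { rewrite <- (exp_ln eps) by auto. apply exp_increasing.
    assert (ln p < ln eps / Re w)%R. { rewrite <- (ln_exp (ln eps / Re w)). apply ln_increasing; lra. }
    apply (Rmult_lt_compat_l (Re w)) in H; auto. replace (Re w * (ln eps / Re w))%R with (ln eps) in H by (field; lra). lra. }
  pose proof (exp_pos (- (Re c * p))). nra.
Qed.

(** Integration by parts: [e^{-c t} t^w] vanishes at both ends. *)
Lemma laplace_int_rec w c : (0 < Re w)%R -> (0 < Re c)%R -> c * laplace_int (w + 1) c = w * laplace_int w c.
Proof.
  intros Hw Hc.
  assert (Hw1 : (0 < Re (w + 1))%R) by (unfold Re in *; simpl; lra).
  set (F := fun t => Cexp (- (c * RtoC t)) * rpow t w).
  assert (H : is_CInt (fun t => w * laplace_fun w c t + (- c) * laplace_fun (w + 1) c t) (0 - 0)).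
  { apply (is_CInt_FTC F).
    - intros t Ht. eapply is_Cderive_eq. apply is_Cderive_mult. apply is_Cderive_Cexp. apply is_Cderive_opp. apply is_Cderive_scal.
      apply is_Cderive_RtoC. apply is_derive_id. apply is_Cderive_rpow; auto.
      unfold laplace_fun, one; simpl. replace (w + 1 - 1) with w by ring. ring.
    - apply Ccont_pos_plus; apply Ccont_pos_scal; apply laplace_fun_cont.
    - intros eps He. destruct (rpow_exp_lim_0 w c Hw Hc eps He) as (d & Hd & H). exists d. split; auto. intros p Hp.
      replace (F p - 0) with (F p) by ring. apply H; auto.
    - intros eps He. destruct (rpow_exp_lim_oo w c Hc eps He) as (M & H). exists M. intros q Hq Hq0.
      replace (F q - 0) with (F q) by ring. apply H; auto. }
  assert (H' : is_CInt (fun t => w * laplace_fun w c t + (- c) * laplace_fun (w + 1) c t) (w * laplace_int w c + (- c) * laplace_int (w + 1) c)).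
  { apply is_CInt_plus; apply is_CInt_scal; try apply laplace_fun_cont; apply is_CInt_laplace; auto. }
  pose proof (is_CInt_unique _ _ _ H H') as E.
  replace (c * laplace_int (w + 1) c) with (w * laplace_int w c - (w * laplace_int w c + (- c) * laplace_int (w + 1) c)) by ring. rewrite <- E. ring.
Qed.

(** First-order expansion in [c] under the integral sign. The remainder of the exponential carries a
    factor [t^2], hence the domination with exponent [w + 2]; the constant is uniform on
    [c0 <= Re c]. *)
Lemma laplace_int_taylor1 w c0 : (0 < Re w)%R -> (0 < c0)%R -> exists K, (0 < K)%R /\ forall c c', (c0 <= Re c)%R -> (c0 <= Re c')%R ->
  (Cmod (laplace_int w c' - laplace_int w c + (c' - c) * laplace_int (w + 1) c) <= K * (Cmod (c' - c) * Cmod (c' - c)))%R.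
Proof.
  intros Hw Hc0. set (w2 := w + 1 + 1).
  assert (Hw1 : (0 < Re (w + 1))%R) by (unfold Re in *; simpl; lra).
  assert (Hw2 : (0 < Re w2)%R) by (unfold w2, Re in *; simpl; lra).
  destruct (laplace_fun_dominated w2 c0 Hw2 Hc0) as (K & HK & H). exists K. split; auto. intros c c' Hc Hc'.
  set (f := fun t => (laplace_fun w c' t + RtoC (-1) * laplace_fun w c t) + (c' - c) * laplace_fun (w + 1) c t).
  assert (Hf : Ccont_pos f). { apply Ccont_pos_plus. apply Ccont_pos_plus. apply laplace_fun_cont. apply Ccont_pos_scal, laplace_fun_cont. apply Ccont_pos_scal, laplace_fun_cont. }
  replace (K * (Cmod (c' - c) * Cmod (c' - c)))%R with (Cmod (c' - c) * Cmod (c' - c) * K)%R by ring.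
  apply (dominated_CInt_le f (Re w2)); auto.
  - intros t Ht. specialize (H (RtoC c0) ltac:(simpl; lra) t Ht). rewrite Cmod_laplace_fun in H by auto. 
    unfold f, laplace_fun. replace (rpow t (w + 1 - 1)) with (RtoC t * rpow t (w - 1)).
    2:{ replace (w + 1 - 1) with (1 + (w - 1)) by ring. rewrite rpow_add, rpow_1 by auto. reflexivity. }
    rewrite RtoC_m1.
    replace (Cexp (- (c' * RtoC t)) * rpow t (w - 1) + - (1) * (Cexp (- (c * RtoC t)) * rpow t (w - 1)) + (c' - c) * (Cexp (- (c * RtoC t)) * (RtoC t * rpow t (w - 1))))
      with ((Cexp (- (c' * RtoC t)) - Cexp (- (c * RtoC t)) - (- (c' * RtoC t) - - (c * RtoC t)) * Cexp (- (c * RtoC t))) * rpow t (w - 1)) by ring.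
    rewrite Cmod_mult, Cmod_rpow by auto.
    eapply Rle_trans. apply Rmult_le_compat_r. left; apply Rpower_pos. apply (Cexp_taylor1 _ _ (- (c0 * t))%R).
    unfold Re in *; simpl in *. nra. unfold Re in *; simpl in *. nra.
    replace (- (c' * RtoC t) - - (c * RtoC t)) with (- (RtoC t * (c' - c))) by ring.
    rewrite Cmod_opp, Cmod_mult, Cmod_R, Rabs_pos_eq by lra.
    replace (Rpower t (Re (w - 1))) with (Rpower t (Re w2 - 1) / (t * t))%R.
    2:{ replace (Re w2 - 1)%R with (Re (w - 1) + (1 + 1))%R by (unfold w2, Re; simpl; ring). rewrite !Rpower_plus, Rpower_1 by auto. field. lra. }
    set (d := Cmod (c' - c)) in *. assert (0 <= d)%R by apply Cmod_ge_0.
    replace (t * d * (t * d) * exp (- (c0 * t)) * (Rpower t (Re w2 - 1) / (t * t)))%R with (d * d * (exp (- (c0 * t)) * Rpower t (Re w2 - 1)))%R by (field; lra).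
    rewrite (Rmult_assoc (d * d)). apply Rmult_le_compat_l. nra. auto.
  - replace (laplace_int w c' - laplace_int w c + (c' - c) * laplace_int (w + 1) c) with ((laplace_int w c' + RtoC (-1) * laplace_int w c) + (c' - c) * laplace_int (w + 1) c) by (rewrite RtoC_m1; ring).
    apply is_CInt_plus. apply is_CInt_plus. apply is_CInt_laplace; auto; lra.
    apply is_CInt_scal; [apply laplace_fun_cont|apply is_CInt_laplace; auto; lra].
    apply is_CInt_scal; [apply laplace_fun_cont|apply is_CInt_laplace; auto; lra].
Qed.

Lemma Re_Cexp_pos (t : R) (L : C) : (Rabs (t * Im L) < PI / 2)%R -> (0 < Re (Cexp (RtoC t * L)))%R.
Proof.
  intros H. unfold Cexp, Re at 1; simpl. apply Rmult_lt_0_compat. apply exp_pos. apply Rabs_def2 in H.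
  replace (t * snd L + 0 * fst L)%R with (t * Im L)%R by (unfold Im; ring). apply cos_gt_0; lra.
Qed.

Lemma is_Cderive_laplace_int w (L : C) t : (0 < Re w)%R -> (Rabs (t * Im L) < PI / 2)%R ->
  is_Cderive (fun s => laplace_int w (Cexp (RtoC s * L))) t (- (L * Cexp (RtoC t * L) * laplace_int (w + 1) (Cexp (RtoC t * L)))).
Proof.
  intros Hw Ht. set (c := fun s : R => Cexp (RtoC s * L)).
  assert (Hre : (0 < Re (c t))%R).
  { apply Re_Cexp_pos; auto. }
  (* Half the real part at [t]: an increment of modulus at most [c0] stays in the half-plane where
     the Taylor bound is uniform. *)
  set (c0 := (Re (c t) / 2)%R).
  set (m := (Rabs t * Rabs (Re L) + Rabs (Re L))%R).
  assert (Hb : forall h, (Rabs h <= 1)%R -> (Re (RtoC (t + h) * L) <= m)%R).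
  { intros h Hh. replace (Re (RtoC (t + h) * L)) with ((t + h) * Re L)%R by (unfold Re; simpl; ring).
    eapply Rle_trans. apply Rle_abs. rewrite Rabs_mult. unfold m.
    pose proof (Rabs_triang t h). pose proof (Rabs_pos (Re L)). nra. }
  assert (Hb0 : (Re (RtoC t * L) <= m)%R). { specialize (Hb 0%R). rewrite Rabs_R0, Rplus_0_r in Hb. apply Hb; lra. }
  assert (D1 : forall h, (Rabs h <= 1)%R -> (Cmod (c (t + h)%R - c t) <= Rabs h * (Cmod L * exp m))%R).
  { intros h Hh. eapply Rle_trans. apply (Cexp_lipschitz _ _ m); auto.
    replace (RtoC (t + h) * L - RtoC t * L) with (RtoC h * L) by (rewrite RtoC_plus; ring). rewrite Cmod_mult, Cmod_R. lra. }
  assert (D2 : forall h, (Rabs h <= 1)%R -> (Cmod (c (t + h)%R - c t - RtoC h * (L * c t)) <= (h * h) * (Cmod L * Cmod L * exp m))%R).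
  { intros h Hh. unfold c. replace (RtoC h * (L * Cexp (RtoC t * L))) with ((RtoC (t + h) * L - RtoC t * L) * Cexp (RtoC t * L)) by (rewrite RtoC_plus; ring).
    eapply Rle_trans. apply (Cexp_taylor1 _ _ m); auto.
    replace (RtoC (t + h) * L - RtoC t * L) with (RtoC h * L) by (rewrite RtoC_plus; ring). rewrite Cmod_mult, Cmod_R.
    replace (h * h)%R with (Rabs h * Rabs h)%R. 2:{ rewrite <- Rabs_mult. apply Rabs_pos_eq. apply Rle_0_sqr. } lra. }
  destruct (laplace_int_taylor1 w c0 Hw ltac:(unfold c0; lra)) as (K & HK & HQ).
  set (B := (Cmod L * exp m)%R) in *.
  assert (HB : (0 <= B)%R). { unfold B. pose proof (Cmod_ge_0 L). pose proof (exp_pos m). nra. }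
  assert (Hd : (0 < Rmin 1 (c0 / (B + 1)))%R). { apply Rmin_glb_lt. lra. apply Rdiv_lt_0_compat; unfold c0; lra. }
  apply (is_Cderive_of_quadratic _ _ _ (K * (B * B) + Cmod (laplace_int (w + 1) (c t)) * (Cmod L * Cmod L * exp m)) _ Hd).
  intros h Hh. pose proof (Rmin_l 1 (c0 / (B+1))). pose proof (Rmin_r 1 (c0 / (B+1))).
  assert (Hh1 : (Rabs h <= 1)%R) by lra. specialize (D1 h Hh1). specialize (D2 h Hh1).
  assert (Hc' : (c0 <= Re (c (t + h)%R))%R).
  { pose proof (re_le_Cmod (c (t + h)%R - c t)) as R1.
    assert (X : (Rabs h * B <= c0)%R).
    { apply Rle_trans with (c0 / (B + 1) * B)%R. apply Rmult_le_compat_r; lra.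
      apply Rmult_le_reg_r with (B + 1)%R. lra. replace (c0 / (B + 1) * B * (B + 1))%R with (c0 * B)%R by (field; lra). unfold c0; nra. }
    replace (Re (c (t + h)%R - c t)) with (Re (c (t + h)%R) - Re (c t))%R in R1 by reflexivity.
    assert (Rabs (Re (c (t + h)%R) - Re (c t)) <= c0)%R by lra. apply Rabs_le_between in H1. unfold c0 in *. lra. }
  specialize (HQ (c t) (c (t + h)%R) ltac:(unfold c0; lra) Hc').
  change (Cexp (RtoC (t + h) * L)) with (c (t + h)%R). change (Cexp (RtoC t * L)) with (c t).
  set (A := laplace_int (w + 1) (c t)) in *.
  replace (laplace_int w (c (t + h)%R) - laplace_int w (c t) - RtoC h * - (L * c t * A))
    with ((laplace_int w (c (t + h)%R) - laplace_int w (c t) + (c (t + h)%R - c t) * A) + - (A * (c (t + h)%R - c t - RtoC h * (L * c t)))) by ring.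
  eapply Rle_trans. apply Cmod_triangle. rewrite Cmod_opp, Cmod_mult.
  pose proof (Cmod_ge_0 A). pose proof (Cmod_ge_0 (c (t + h)%R - c t)).
  assert (E1 : (K * (Cmod (c (t + h)%R - c t) * Cmod (c (t + h)%R - c t)) <= K * (h * h * (B * B)))%R).
  { apply Rmult_le_compat_l. lra. replace (h * h * (B * B))%R with ((Rabs h * B) * (Rabs h * B))%R.
    2:{ replace (h * h)%R with (Rabs h * Rabs h)%R. ring. rewrite <- Rabs_mult. apply Rabs_pos_eq. apply Rle_0_sqr. }
    apply Rmult_le_compat; auto. }
  assert (E2 : (Cmod A * Cmod (c (t + h)%R - c t - RtoC h * (L * c t)) <= Cmod A * (h * h * (Cmod L * Cmod L * exp m)))%R).
  { apply Rmult_le_compat_l; auto. }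
  lra.
Qed.

Lemma Gamma_Euler_laplace w : (0 < Re w)%R -> Gamma_Euler w = laplace_int w 1.
Proof.
  intros Hw. apply is_CInt_Cint. eapply is_CInt_ext; [|apply (is_CInt_laplace w 1); auto; simpl; lra].
  intros t Ht. unfold laplace_fun. rewrite Cpower_RtoC by auto. rewrite Cmult_1_l. ring.
Qed.

(* [c^w laplace_int w c] is constant along the curve [s |-> exp (s Log c)] from [1] to [c],
   which stays in the right half-plane. *)
Lemma laplace_Gamma w c : (0 < Re w)%R -> (0 < Re c)%R -> laplace_int w c = Gamma_Euler w * Cpower c (- w).
Proof.
  intros Hw Hc. rewrite Gamma_Euler_laplace by auto.
  assert (Hn : c <> 0) by (intros E; rewrite E in Hc; simpl in Hc; lra).
  set (L := Clog c). set (Q := fun s : R => Cexp (w * (RtoC s * L)) * laplace_int w (Cexp (RtoC s * L))).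
  assert (HL : (Rabs (Im L) < PI / 2)%R). { unfold L, Clog; simpl. apply Rabs_def1; pose proof (Carg_bound c Hc); lra. }
  assert (E : Q 0%R = Q 1%R).
  { apply is_Cderive_zero_const. intros t Ht. rewrite Rmin_left, Rmax_right in Ht by lra.
    assert (Ht' : (Rabs (t * Im L) < PI / 2)%R).
    { rewrite Rabs_mult, (Rabs_pos_eq t) by lra. pose proof (Rabs_pos (Im L)). nra. }
    assert (Hre : (0 < Re (Cexp (RtoC t * L)))%R).
    { apply Re_Cexp_pos; auto. }
    eapply is_Cderive_eq. apply is_Cderive_mult; [|apply is_Cderive_laplace_int; auto].
    apply is_Cderive_Cexp. apply is_Cderive_scal. apply is_Cderive_mult. apply is_Cderive_RtoC. apply is_derive_id. apply is_Cderive_const.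
    unfold one; simpl. pose proof (laplace_int_rec w _ Hw Hre) as R1.
    replace (Cexp (w * (RtoC t * L)) * - (L * Cexp (RtoC t * L) * laplace_int (w + 1) (Cexp (RtoC t * L))))
      with (- (L * Cexp (w * (RtoC t * L)) * (Cexp (RtoC t * L) * laplace_int (w + 1) (Cexp (RtoC t * L))))) by ring.
    rewrite R1. ring. }
  unfold Q in E. rewrite !Cmult_0_l, Cmult_0_r, Cexp_0, !Cmult_1_l in E.
  unfold L at 2 in E. rewrite Cexp_Clog in E by auto. rewrite E.
  unfold Cpower. fold L. replace (- w * L) with (- (w * L)) by ring. rewrite Cexp_inv.
  pose proof (Cexp_neq_0 (w * L)). field; auto.
Qed.

(** * Recurrence and special values of Gamma *)

Lemma Re_plus a b : Re (a + b) = (Re a + Re b)%R. Proof. reflexivity. Qed.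
Lemma Re_opp a : Re (- a) = (- Re a)%R. Proof. reflexivity. Qed.
Lemma Re_RtoC r : Re (RtoC r) = r. Proof. reflexivity. Qed.
Lemma Re_natC n : Re (natC n) = INR n. Proof. reflexivity. Qed.

Lemma RtoC_neq_0 (r : R) : (r <> 0)%R -> RtoC r <> 0.
Proof. intros H E. apply RtoC_inj in E. auto. Qed.

Lemma Re_pos_neq_0 z : (0 < Re z)%R -> z <> 0.
Proof. intros H E. rewrite E in H. simpl in H. lra. Qed.

Lemma Gamma_Euler_rec z : (0 < Re z)%R -> Gamma_Euler (z + 1) = z * Gamma_Euler z.
Proof.
  intros Hz. rewrite !Gamma_Euler_laplace; auto. 2: rewrite Re_plus; simpl; lra.
  pose proof (laplace_int_rec z 1 Hz ltac:(simpl; lra)) as H. rewrite Cmult_1_l in H. auto.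
Qed.

Lemma Cpoch_neq_0 z M : (forall k, (k < M)%nat -> z + natC k <> 0) -> Cpochhammer z M <> 0.
Proof.
  intros H. induction M; simpl. apply RtoC_neq_0. lra.
  apply Cmult_neq_0. apply IHM. intros; apply H; lia. apply H; lia.
Qed.

Lemma natC_plus a b : natC (a + b) = natC a + natC b.
Proof. unfold natC. rewrite plus_INR, RtoC_plus. reflexivity. Qed.

Lemma Gamma_Euler_poch z M : (0 < Re z)%R -> Gamma_Euler (z + natC M) = Cpochhammer z M * Gamma_Euler z.
Proof.
  intros Hz. induction M.
  - simpl. replace (z + natC 0) with z. ring. unfold natC; simpl; ring.
  - rewrite natC_S. replace (z + (natC M + 1)) with (z + natC M + 1) by ring. rewrite Gamma_Euler_rec, IHM. simpl. ring.
    rewrite Re_plus, Re_natC. pose proof (pos_INR M). lra.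
Qed.

Lemma Cpoch_add z M k : Cpochhammer z (M + k) = Cpochhammer z M * Cpochhammer (z + natC M) k.
Proof.
  induction k. rewrite Nat.add_0_r. simpl. ring.
  rewrite Nat.add_succ_r. simpl. rewrite IHk, natC_plus. ring.
Qed.

Definition not_pole (z : C) : Prop := forall k, z + natC k <> 0.

Lemma not_pole_Re_pos z : (0 < Re z)%R -> not_pole z.
Proof. intros H k. apply Re_pos_neq_0. rewrite Re_plus, Re_natC. pose proof (pos_INR k). lra. Qed.

Lemma Gamma_shift_aux z M k : not_pole z -> (0 < Re z + INR M)%R ->
  Gamma_Euler (z + natC (M + k)) / Cpochhammer z (M + k) = Gamma_Euler (z + natC M) / Cpochhammer z M.
Proof.
  intros Hn HM. rewrite natC_plus, Cplus_assoc, Gamma_Euler_poch by (rewrite Re_plus, Re_natC; auto).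
  rewrite Cpoch_add. pose proof (Cpoch_neq_0 z M (fun k _ => Hn k)).
  assert (Cpochhammer (z + natC M) k <> 0).
  { apply Cpoch_neq_0. intros j _. rewrite <- Cplus_assoc, <- natC_plus. apply Hn. }
  field. auto.
Qed.

(** Allows one convenient shift to be used for [z] and [z + 1] instead of the least ones of the
    definition. *)
Lemma Gamma_shift z M : not_pole z -> (0 < Re z + INR M)%R -> Gamma z = Gamma_Euler (z + natC M) / Cpochhammer z M.
Proof.
  intros Hn HM. unfold Gamma. set (m := Z.to_nat (up (- Re z))).
  assert (Hm : (0 < Re z + INR m)%R).
  { pose proof (archimed (- Re z)) as [A _]. unfold m. destruct (Z.le_gt_cases 0 (up (- Re z))).
    - rewrite INR_IZR_INZ, Z2Nat.id by auto. lra.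
    - pose proof (pos_INR (Z.to_nat (up (- Re z)))). apply IZR_lt in H. lra. }
  destruct (Nat.le_ge_cases m M) as [Hle|Hle].
  - replace M with (m + (M - m))%nat by lia. rewrite Gamma_shift_aux; auto.
  - replace m with (M + (m - M))%nat by lia. rewrite Gamma_shift_aux; auto.
Qed.

Lemma Gamma_pos z : (0 < Re z)%R -> Gamma z = Gamma_Euler z.
Proof.
  intros Hz. rewrite (Gamma_shift z 0%nat).
  - change (Cpochhammer z 0) with (RtoC 1). replace (z + natC 0) with z by (unfold natC; simpl; ring).
    field.
  - apply not_pole_Re_pos; auto.
  - simpl; lra.
Qed.

Lemma not_pole_S z : not_pole z -> not_pole (z + 1).
Proof. intros H k. replace (z + 1 + natC k) with (z + natC (S k)) by (rewrite natC_S; ring). apply H. Qed.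

Lemma Gamma_rec z : not_pole z -> Gamma (z + 1) = z * Gamma z.
Proof.
  intros Hn. destruct (nfloor_ex (Rabs (Re z))) as [M HM]. apply Rabs_pos.
  assert (HM1 : (0 < Re z + INR (S M))%R). { rewrite S_INR. pose proof (Rle_abs (- Re z)). rewrite Rabs_Ropp in H. lra. }
  assert (Hz : z <> 0). { specialize (Hn O). replace (z + natC 0) with z in Hn by (unfold natC; simpl; ring). auto. }
  rewrite (Gamma_shift z (S (S M))); auto. rewrite (Gamma_shift (z + 1) (S M)).
  - replace (z + natC (S (S M))) with (z + 1 + natC (S M)) by (rewrite (natC_S (S M)); ring).
    change (S (S M)) with (1 + S M)%nat. rewrite Cpoch_add. replace (z + natC 1) with (z + 1) by (unfold natC; simpl; ring).
    replace (Cpochhammer z 1) with z by (simpl; unfold natC; simpl; ring).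
    pose proof (Cpoch_neq_0 (z + 1) (S M) (fun k _ => not_pole_S z Hn k)). field. auto.
  - apply not_pole_S; auto.
  - rewrite Re_plus. simpl Re. lra.
  - rewrite S_INR. lra.
Qed.

Lemma Gamma_Euler_1 : Gamma_Euler 1 = 1.
Proof.
  rewrite Gamma_Euler_laplace by (simpl; lra). apply is_CInt_Cint.
  apply (is_CInt_ext (fun t => Cexp (- (1 * RtoC t)))).
  { intros t Ht. unfold laplace_fun. replace (1 - 1) with (RtoC 0) by ring. rewrite rpow_0. ring. }
  replace (RtoC 1) with (0 - - (1)) by ring.
  apply (is_CInt_FTC (fun t => - Cexp (- (1 * RtoC t)))).
  - intros t Ht. eapply is_Cderive_eq. apply is_Cderive_opp. apply is_Cderive_Cexp. apply is_Cderive_opp. apply is_Cderive_scal. apply is_Cderive_RtoC. apply is_derive_id.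
    unfold one; simpl. replace (0 - - (1)) with (RtoC 1) by ring. ring.
  - replace (0 - - (1)) with (RtoC 1) by ring. apply Ccont_pos_Cexp_linear.
  - intros eps He. exists eps. split; auto. intros p Hp.
    replace (0 - - (1)) with (RtoC 1) by ring. replace (- Cexp (- (1 * RtoC p)) - - (1)) with (- (Cexp (- (1 * RtoC p)) - Cexp 0)) by (rewrite Cexp_0; ring).
    rewrite Cmod_opp. eapply Rle_lt_trans. apply (Cexp_lipschitz _ _ 0); simpl; lra. rewrite exp_0.
    replace (- (1 * RtoC p) - 0) with (- RtoC p) by ring. rewrite Cmod_opp, Cmod_R, Rabs_pos_eq; lra.
  - intros eps He. destruct (rpow_exp_lim_oo 0 1 ltac:(simpl; lra) eps He) as [M HM]. exists M. intros q Hq Hq0.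
    replace (0 - - (1)) with (RtoC 1) by ring. replace (- Cexp (- (1 * RtoC q)) - 0) with (- (Cexp (- (1 * RtoC q)) * rpow q 0)) by (rewrite rpow_0; ring).
    rewrite Cmod_opp. auto.
Qed.

Lemma Gamma_Euler_fact n : Gamma_Euler (natC n + 1) = RtoC (INR (fact n)).
Proof.
  induction n. replace (natC 0 + 1) with (RtoC 1) by (unfold natC; simpl; ring). rewrite Gamma_Euler_1. reflexivity.
  rewrite Gamma_Euler_rec, natC_S, IHn. rewrite fact_simpl, mult_INR, RtoC_mult, S_INR, RtoC_plus. reflexivity.
  rewrite Re_natC. apply lt_0_INR; lia.
Qed.

(** Comparison with an integral of known value, for the estimate of [Gamma_ratio] where the size of
    the constant matters. *)
Lemma is_CInt_norm_le f g l m : Ccont_pos f -> (forall t, (0 < t)%R -> continuous g t) -> (forall t, (0 < t)%R -> (Cmod (f t) <= g t)%R) ->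
  is_CInt f l -> is_CInt (fun t => RtoC (g t)) (RtoC m) -> (Cmod l <= m)%R.
Proof.
  intros Hf Hg Hle Hl Hm. apply Rnot_lt_le; intros Hlt.
  assert (Hgc : Ccont_pos (fun t => RtoC (g t))) by (intros t Ht; apply Ccont_RtoC; auto).
  destruct (is_CInt_elim f l Hf Hl ((Cmod l - m) / 2)%R ltac:(lra)) as (d & M & Hd & HM).
  destruct (is_CInt_elim _ _ Hgc Hm ((Cmod l - m) / 2)%R ltac:(lra)) as (d' & M' & Hd' & HM').
  set (p := (Rmin (Rmin d d') 1 / 2)%R). set (q := (Rmax (Rmax M M') 1 + 1)%R).
  pose proof (Rmin_l (Rmin d d') 1). pose proof (Rmin_r (Rmin d d') 1). pose proof (Rmin_l d d'). pose proof (Rmin_r d d').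
  pose proof (Rmax_l (Rmax M M') 1). pose proof (Rmax_r (Rmax M M') 1). pose proof (Rmax_l M M'). pose proof (Rmax_r M M').
  assert (0 < Rmin (Rmin d d') 1)%R by (repeat apply Rmin_glb_lt; lra).
  specialize (HM p q ltac:(unfold p; lra) ltac:(unfold q; lra) ltac:(unfold q; lra)).
  specialize (HM' p q ltac:(unfold p; lra) ltac:(unfold q; lra) ltac:(unfold q; lra)).
  assert (Hpq : (0 < p <= q)%R) by (unfold p, q; lra).
  assert (E : (Cmod (CRInt f p q) <= Re (CRInt (fun t => RtoC (g t)) p q))%R).
  { rewrite <- norm_CR. apply (norm_RInt_le (V:=C_R_NormedModule) f g p q).
    - lra. - intros x Hx. rewrite norm_CR. apply Hle; lra.
    - apply Ccont_pos_is; auto; lra.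
    - rewrite CRInt_parts by (auto; lra). apply (RInt_correct (V:=R_CompleteNormedModule)).
      apply (ex_RInt_continuous (V:=R_CompleteNormedModule)). intros z Hz. rewrite Rmin_left, Rmax_right in Hz by lra. apply Hg; lra. }
  pose proof (Cmod_triangle (l - CRInt f p q) (CRInt f p q)) as T. replace (l - CRInt f p q + CRInt f p q) with l in T by ring.
  rewrite Cmod_minus_sym in T.
  pose proof (re_le_Cmod (CRInt (fun t => RtoC (g t)) p q - RtoC m)) as R1.
  replace (Re (CRInt (fun t => RtoC (g t)) p q - RtoC m)) with (Re (CRInt (fun t => RtoC (g t)) p q) - m)%R in R1 by reflexivity.
  pose proof (Rle_abs (Re (CRInt (fun t => RtoC (g t)) p q) - m)). lra.
Qed.

(** Mean value inequality on the segment from 1 to [w]. As [-2 <= Re (z - 1) <= 0], the factor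
    [y^(Re z - 1)] is at most 1 for [y >= 1] and at most [w^-2] for [w <= y < 1]. *)
Lemma rpow_minus_1_le (w : R) (z : C) : (0 < w)%R -> (Rabs (Re z) <= 1)%R ->
  (Cmod (rpow w z - 1) <= Cmod z * (Rabs (w - 1) * (1 + / (w * w))))%R.
Proof.
  intros Hw Hz. set (y := fun s : R => (1 + s * (w - 1))%R).
  replace (rpow w z - 1) with (rpow (y 1%R) z - rpow (y 0%R) z).
  2:{ unfold y. replace (1 + 1 * (w - 1))%R with w by ring. replace (1 + 0 * (w - 1))%R with 1%R by ring. rewrite rpow_1_l. reflexivity. }
  assert (Hy : forall s, (0 <= s <= 1)%R -> (0 < y s)%R). { intros s Hs. unfold y. destruct (Rle_lt_dec 1 w); nra. }
  apply (Cderive_mean_value_le (fun s => rpow (y s) z) (fun s => RtoC (w - 1) * (z * rpow (y s) (z - 1)))).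
  intros s Hs. specialize (Hy s Hs). split.
  - apply (is_Cderive_comp (fun t => rpow t z)). apply is_Cderive_rpow; auto. unfold y. auto_derive; auto. ring.
  - rewrite !Cmod_mult, Cmod_R, Cmod_rpow by auto. rewrite <- Rmult_assoc, (Rmult_comm (Rabs (w - 1))), Rmult_assoc.
    apply Rmult_le_compat_l. apply Cmod_ge_0. apply Rmult_le_compat_l. apply Rabs_pos.
    assert (He : (-2 <= Re (z - 1) <= 0)%R). { unfold Cminus. rewrite Re_plus, Re_opp, Re_RtoC. apply Rabs_le_between in Hz. lra. }
    assert (Hi : (0 < / (w * w))%R) by (apply Rinv_0_lt_compat; nra).
    destruct (Rle_lt_dec 1 (y s)) as [H1|H1].
    + apply Rle_trans with 1%R; [|lra].
      apply Rle_trans with (Rpower (y s) 0). apply Rle_Rpower; lra. rewrite Rpower_O by auto. lra.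
    + apply Rle_trans with (/ (w * w))%R; [|lra].
      assert (Hwy : (w <= y s)%R). { unfold y in *. destruct (Rle_lt_dec 1 w); [exfalso|]; nra. }
      replace (/ (w * w))%R with (Rpower (/ w) 2).
      2:{ replace 2%R with (1 + 1)%R by ring. rewrite Rpower_plus, Rpower_1 by (apply Rinv_0_lt_compat; auto). field; lra. }
      assert (Hiw : (1 < / w)%R). { rewrite <- Rinv_1. apply Rinv_lt_contravar; try lra. }
      replace (Rpower (y s) (Re (z - 1))) with (Rpower (/ y s) (- Re (z - 1))).
      2:{ unfold Rpower. rewrite ln_Rinv by auto. f_equal. ring. }
      apply Rle_trans with (Rpower (/ w) (- Re (z - 1))).
      * apply Rpower_incr_base. lra. split. apply Rinv_0_lt_compat; auto. apply Rinv_le_contravar; auto.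
      * apply Rle_Rpower; lra.
Qed.

(** The quotient of the two sides of the asymptotic equivalence [Gamma(n + 1 + z) ~ n! n^z]. *)
Definition Gamma_ratio (n : nat) (z : C) : C := Gamma_Euler (natC n + 1 + z) / (RtoC (INR (fact n)) * rpow (INR n) z).

Lemma is_CInt_moment (k : nat) : is_CInt (fun t => RtoC (t ^ k * exp (- t))) (RtoC (INR (fact k))).
Proof.
  rewrite <- Gamma_Euler_fact. rewrite Gamma_Euler_laplace by (rewrite Re_plus, Re_natC; simpl; pose proof (pos_INR k); lra).
  eapply is_CInt_ext; [|apply is_CInt_laplace]. 3: simpl; lra.
  - intros t Ht. unfold laplace_fun. replace (natC k + 1 - 1) with (natC k) by ring. rewrite rpow_natC by auto.
    replace (- (1 * RtoC t)) with (RtoC (- t)) by (rewrite RtoC_opp; ring). rewrite Cexp_RtoC, RtoC_mult. ring.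
  - rewrite Re_plus, Re_natC. simpl. pose proof (pos_INR k). lra.
Qed.

Lemma is_CInt_rscal (c : R) (g : R -> R) m : (forall t, continuous g t) ->
  is_CInt (fun t => RtoC (g t)) (RtoC m) -> is_CInt (fun t => RtoC (c * g t)) (RtoC (c * m)).
Proof.
  intros Hg H. rewrite RtoC_mult. apply (is_CInt_ext (fun t => RtoC c * RtoC (g t))). intros; rewrite RtoC_mult; auto.
  apply is_CInt_scal; auto. intros t _. apply Ccont_RtoC; auto.
Qed.
Lemma is_CInt_rplus (g h : R -> R) m k : is_CInt (fun t => RtoC (g t)) (RtoC m) -> is_CInt (fun t => RtoC (h t)) (RtoC k) -> is_CInt (fun t => RtoC (g t + h t)) (RtoC (m + k)).
Proof.
  intros H1 H2. rewrite RtoC_plus. apply (is_CInt_ext (fun t => RtoC (g t) + RtoC (h t))). intros; rewrite RtoC_plus; auto.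
  apply is_CInt_plus; auto.
Qed.

Lemma continuous_moment k t : continuous (fun t => t ^ k * exp (- t))%R t.
Proof. apply (ex_derive_continuous (K:=R_AbsRing) (V:=R_NormedModule)). auto_derive. auto. Qed.

(* From [|w^z - 1| <= |z| |w - 1| (1 + w^-2)] at [w = t/n] and [2 |w - 1| <= d + (w - 1)^2 / d];
   the moments of [t^n e^{-t}] are factorials. *)
Lemma Gamma_ratio_bound m z (d : R) : (0 < d)%R -> (Rabs (Re z) <= 1)%R ->
  (Cmod (Gamma_ratio (m + 2) z - 1) <= Cmod z * (3 * d + 4 / (INR (m + 2) * d)))%R.
Proof.
  (* The index is [m + 2] because the factor [w^-2] lowers the power [t^n] by two. *)
  intros Hd Hz. set (n := (m + 2)%nat). set (x := INR n).
  assert (Hx : (2 <= x)%R). { unfold x, n. rewrite plus_INR. simpl. pose proof (pos_INR m). lra. }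
  set (F := INR (fact n)). assert (HF : (0 < F)%R) by apply INR_fact_pos.
  assert (Hre : (0 < Re (natC n + 1 + z))%R).
  { rewrite !Re_plus, Re_natC. simpl Re. fold x. apply Rabs_le_between in Hz. lra. }
  assert (Hre1 : (0 < Re (natC n + 1))%R). { rewrite Re_plus, Re_natC. simpl Re. fold x. lra. }
  set (f := fun t => / rpow x z * laplace_fun (natC n + 1 + z) 1 t + RtoC (-1) * laplace_fun (natC n + 1) 1 t).
  assert (Hf : Ccont_pos f) by (apply Ccont_pos_plus; apply Ccont_pos_scal; apply laplace_fun_cont).
  assert (Hfi : is_CInt f (RtoC F * (Gamma_ratio n z - 1))).
  { replace (RtoC F * (Gamma_ratio n z - 1)) with (/ rpow x z * laplace_int (natC n + 1 + z) 1 + RtoC (-1) * laplace_int (natC n + 1) 1).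
    apply is_CInt_plus; apply is_CInt_scal; try apply laplace_fun_cont; apply is_CInt_laplace; auto; simpl; lra.
    rewrite <- !Gamma_Euler_laplace by auto. rewrite Gamma_Euler_fact, RtoC_m1. unfold Gamma_ratio. fold F x.
    pose proof (rpow_neq_0 x z). field. split; auto. apply RtoC_neq_0; lra. }
  set (mo := fun (k : nat) (t : R) => (t ^ k * exp (- t))%R).
  (* Coefficients of [t^(m+4)] down to [t^m] in the expansion of
     [t^n (d + (w - 1)^2 / d) (1 + w^-2)] with [w = t / x]. *)
  set (c4 := (/ d / (x * x))%R). set (c3 := (- 2 / d / x)%R). set (c2 := (d + 2 / d)%R).
  set (c1 := (- 2 * x / d)%R). set (c0 := (d * (x * x) + x * x / d)%R).
  set (g0 := fun t => (c4 * mo (m + 4)%nat t + (c3 * mo (m + 3)%nat t + (c2 * mo (m + 2)%nat t + (c1 * mo (m + 1)%nat t + c0 * mo m t))))%R).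
  set (I0 := (c4 * INR (fact (m + 4)) + (c3 * INR (fact (m + 3)) + (c2 * INR (fact (m + 2)) + (c1 * INR (fact (m + 1)) + c0 * INR (fact m)))))%R).
  assert (Hg0 : is_CInt (fun t => RtoC (g0 t)) (RtoC I0)).
  { repeat apply (is_CInt_rplus (fun t => _ * _)%R); apply is_CInt_rscal; try (intros; apply continuous_moment); apply is_CInt_moment. }
  assert (Hgc : forall t, continuous g0 t).
  { intros t. unfold g0, mo. apply (ex_derive_continuous (K:=R_AbsRing) (V:=R_NormedModule)). auto_derive. auto. }
  assert (HB : (Cmod (RtoC F * (Gamma_ratio n z - 1)) <= Cmod z / 2 * I0)%R).
  { apply (is_CInt_norm_le f (fun t => Cmod z / 2 * g0 t)%R); auto.
    - intros t _. apply (continuous_scal_r (K:=R_AbsRing) (V:=R_NormedModule) (Cmod z / 2)%R g0). auto.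
    - intros t Ht. unfold f, laplace_fun. 
      replace (/ rpow x z * (Cexp (- (1 * RtoC t)) * rpow t (natC n + 1 + z - 1)) + RtoC (-1) * (Cexp (- (1 * RtoC t)) * rpow t (natC n + 1 - 1)))
        with (RtoC (mo n t) * (rpow (t / x) z - 1)).
      2:{ replace (natC n + 1 + z - 1) with (natC n + z) by ring. replace (natC n + 1 - 1) with (natC n) by ring.
          rewrite rpow_add, rpow_natC by auto. unfold Rdiv. rewrite rpow_mult_base by (auto; apply Rinv_0_lt_compat; lra).
          rewrite rpow_inv_base, rpow_opp by lra. replace (- (1 * RtoC t)) with (RtoC (- t)) by (rewrite RtoC_opp; ring).
          rewrite Cexp_RtoC, RtoC_m1. unfold mo. rewrite RtoC_mult. ring. }
      assert (Hmo : (0 < mo n t)%R). { apply Rmult_lt_0_compat. apply pow_lt; auto. apply exp_pos. }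
      rewrite Cmod_mult, Cmod_R, Rabs_pos_eq by lra.
      assert (Hw : (0 < t / x)%R) by (apply Rdiv_lt_0_compat; lra).
      pose proof (rpow_minus_1_le (t / x) z Hw Hz) as B1.
      eapply Rle_trans. apply Rmult_le_compat_l. lra. apply B1.
      assert (B2 : (Rabs (t / x - 1) <= (d + (t / x - 1) * (t / x - 1) / d) / 2)%R).
      { replace ((t / x - 1) * (t / x - 1))%R with (Rabs (t / x - 1) * Rabs (t / x - 1))%R by (rewrite <- Rabs_mult; apply Rabs_pos_eq; apply Rle_0_sqr).
        set (a := Rabs (t / x - 1)). assert (0 <= (d - a) * (d - a) / d)%R by (apply Rdiv_le_0_compat; [apply Rle_0_sqr|auto]).
        replace ((d - a) * (d - a) / d)%R with (d - 2 * a + a * a / d)%R in H by (field; lra). lra. }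
      set (w := (t / x)%R) in *.
      assert (Hiw : (0 < / (w * w))%R) by (apply Rinv_0_lt_compat; nra).
      apply Rle_trans with (mo n t * (Cmod z * ((d + (w - 1) * (w - 1) / d) / 2 * (1 + / (w * w)))))%R.
      { apply Rmult_le_compat_l. lra. apply Rmult_le_compat_l. apply Cmod_ge_0. apply Rmult_le_compat_r; lra. }
      right. unfold g0, c0, c1, c2, c3, c4, mo, w, n. rewrite !pow_add. field. repeat split; lra.
    - apply is_CInt_rscal; auto. }
  rewrite Cmod_mult, Cmod_R, Rabs_pos_eq in HB by lra.
  assert (HI : (I0 <= F * (2 * (3 * d + 4 / (x * d))))%R).
  { unfold I0. set (F0 := INR (fact m)). assert (HF0 : (0 < F0)%R) by apply INR_fact_pos.
    assert (E1 : INR (fact (m + 1)) = ((x - 1) * F0)%R).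
    { replace (m + 1)%nat with (S m) by lia. rewrite fact_simpl, mult_INR. f_equal. unfold x, n. rewrite S_INR, plus_INR. simpl. ring. }
    assert (E2 : F = (x * ((x - 1) * F0))%R).
    { unfold F, n. replace (m + 2)%nat with (S (m + 1)) by lia. rewrite fact_simpl, mult_INR, E1. f_equal. unfold x, n. rewrite S_INR, !plus_INR. simpl. ring. }
    assert (E3 : INR (fact (m + 3)) = ((x + 1) * (x * ((x - 1) * F0)))%R).
    { rewrite <- E2. replace (m + 3)%nat with (S (m + 2)) by lia. rewrite fact_simpl, mult_INR. f_equal. unfold x, n. rewrite S_INR, !plus_INR. ring. }
    assert (E4 : INR (fact (m + 4)) = ((x + 2) * ((x + 1) * (x * ((x - 1) * F0))))%R).
    { rewrite <- E3. replace (m + 4)%nat with (S (m + 3)) by lia. rewrite fact_simpl, mult_INR. f_equal. unfold x, n. rewrite S_INR, !plus_INR. simpl. ring. }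
    change (INR (fact (m + 2))) with F. rewrite E4, E3, E1, E2. unfold c0, c1, c2, c3, c4.
    apply Rle_trans with (F0 * (d * (x * (x - 1) + x * x) + / d * ((x - 1) + 2 * (x - 1) / x + x)))%R.
    { right. field. split; lra. }
    replace (x * ((x - 1) * F0) * (2 * (3 * d + 4 / (x * d))))%R with (F0 * (d * (6 * (x * (x - 1))) + / d * (8 * (x - 1))))%R by (field; split; lra).
    apply Rmult_le_compat_l. lra. apply Rplus_le_compat. apply Rmult_le_compat_l. lra. nra.
    apply Rmult_le_compat_l. left; apply Rinv_0_lt_compat; auto.
    assert ((2 * (x - 1) / x <= 2)%R). { apply Rmult_le_reg_r with x. lra. field_simplify; lra. } lra. }
  pose proof (Cmod_ge_0 z).
  apply Rmult_le_reg_l with F; auto. eapply Rle_trans. apply HB.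
  apply Rle_trans with (Cmod z / 2 * (F * (2 * (3 * d + 4 / (x * d)))))%R. apply Rmult_le_compat_l; lra. right. field. split; lra.
Qed.

Lemma Gamma_ratio_lim z : (Rabs (Re z) <= 1)%R -> is_Clim (fun n => Gamma_ratio n z) 1.
Proof.
  intros Hz eps He. pose proof (Cmod_ge_0 z) as Hc.
  assert (HA : exists A, A = (Cmod z + 1)%R) by (eexists; reflexivity). destruct HA as [A HA].
  (* With this [d] the term [3 d] is half of [eps / A]; for [d] fixed, [4 / (n d)] tends to 0. *)
  assert (HdA : exists d, d = (eps / (6 * A))%R) by (eexists; reflexivity). destruct HdA as [d HdA].
  assert (Hd : (0 < d)%R) by (rewrite HdA; apply Rdiv_lt_0_compat; lra).
  destruct (nfloor_ex (16 * A / (eps * d))) as [N HN]. { left. apply Rdiv_lt_0_compat; nra. }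
  exists (N + 3)%nat. intros n Hn. replace n with (n - 2 + 2)%nat by lia.
  eapply Rle_lt_trans. apply (Gamma_ratio_bound _ z d); auto. replace (n - 2 + 2)%nat with n by lia.
  assert (Hn' : (16 * A / (eps * d) < INR n)%R). { apply Rlt_le_trans with (INR N + 1)%R. apply HN. rewrite <- S_INR. apply le_INR; lia. }
  assert (Hn0 : (0 < INR n)%R) by (apply lt_0_INR; lia).
  assert (E1 : (4 / (INR n * d) < eps / (4 * A))%R).
  { apply Rmult_lt_reg_r with (INR n * d * (4 * A))%R. repeat apply Rmult_lt_0_compat; lra.
    replace (4 / (INR n * d) * (INR n * d * (4 * A)))%R with (16 * A)%R by (field; lra).
    replace (eps / (4 * A) * (INR n * d * (4 * A)))%R with (eps * d * INR n)%R by (field; lra).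
    apply (Rmult_lt_compat_l (eps * d)) in Hn'; [|nra]. replace (eps * d * (16 * A / (eps * d)))%R with (16 * A)%R in Hn' by (field; lra). lra. }
  assert (E2 : (3 * d + 4 / (INR n * d) < eps / A)%R).
  { assert (Ed : (3 * d = eps / A / 2)%R) by (rewrite HdA; field; lra).
    replace (eps / (4 * A))%R with (eps / A / 4)%R in E1 by (field; lra). 
    lra. }
  apply Rle_lt_trans with (A * (3 * d + 4 / (INR n * d)))%R.
  { apply Rmult_le_compat_r; [|lra]. assert (0 < 4 / (INR n * d))%R by (apply Rdiv_lt_0_compat; nra). lra. }
  apply (Rmult_lt_compat_l A) in E2; [|lra]. replace (A * (eps / A))%R with eps in E2 by (field; lra). auto.
Qed.

(** * The reflection formula *)

Definition Ccos (w : C) : C := (Cexp (Ci * w) + Cexp (- (Ci * w))) / 2.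

Lemma Ci_sqr : Ci * Ci = - (1).
Proof. apply C_ext; unfold Re, Im; simpl; ring. Qed.

Lemma Ci_neq_0 : Ci <> 0.
Proof. intros E. apply (f_equal Im) in E. unfold Im in E; simpl in E. lra. Qed.

Lemma Csin_0 : Csin 0 = 0.
Proof. unfold Csin. rewrite Cmult_0_r. replace (- 0) with (RtoC 0) by ring. rewrite Cexp_0. unfold Cdiv. ring. Qed.
Lemma Ccos_0 : Ccos 0 = 1.
Proof. unfold Ccos. rewrite Cmult_0_r. replace (- 0) with (RtoC 0) by ring. rewrite Cexp_0. field. Qed.

Lemma is_Cderive_Csin (a : C) t : is_Cderive (fun t : R => Csin (a * RtoC t)) t (a * Ccos (a * RtoC t)).
Proof.
  assert (D : is_Cderive (fun t : R => a * RtoC t) t a).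
  { eapply is_Cderive_eq. apply is_Cderive_scal. apply is_Cderive_RtoC. apply is_derive_id. unfold one; simpl; ring. }
  eapply is_Cderive_eq. apply is_Cderive_mult; [|apply is_Cderive_const].
  apply is_Cderive_minus; apply is_Cderive_Cexp; [|apply is_Cderive_opp]; apply is_Cderive_scal; exact D.
  unfold Ccos. field. apply Ci_neq_0.
Qed.

Lemma is_Cderive_Ccos (a : C) t : is_Cderive (fun t : R => Ccos (a * RtoC t)) t (- (a * Csin (a * RtoC t))).
Proof.
  assert (D : is_Cderive (fun t : R => a * RtoC t) t a).
  { eapply is_Cderive_eq. apply is_Cderive_scal. apply is_Cderive_RtoC. apply is_derive_id. unfold one; simpl; ring. }
  eapply is_Cderive_eq. apply is_Cderive_mult; [|apply is_Cderive_const].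
  apply is_Cderive_plus; apply is_Cderive_Cexp; [|apply is_Cderive_opp]; apply is_Cderive_scal; exact D.
  unfold Csin. set (E1 := Cexp (Ci * (a * RtoC t))). set (E2 := Cexp (- (Ci * (a * RtoC t)))).
  transitivity ((Ci * Ci) * a * (E1 - E2) / (Ci * 2)).
  field. apply Ci_neq_0.
  rewrite Ci_sqr. field. apply Ci_neq_0.
Qed.

(** * Wallis integrals with a cosine weight *)

Definition Ccont_all (f : R -> C) : Prop := forall t, Ccont f t.

Lemma Ccont_all_is f p q : Ccont_all f -> is_RInt (V := C_R_NormedModule) f p q (CRInt f p q).
Proof. intros H. apply (RInt_correct (V:=C_RCN)). apply (ex_RInt_continuous (V:=C_RCN)). intros; apply H. Qed.

Lemma Ccont_all_FTC F f p q : (forall t, is_Cderive F t (f t)) -> Ccont_all f -> CRInt f p q = F q - F p.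
Proof. intros HF Hf. apply (is_RInt_unique (V:=C_RCN)). apply (is_RInt_derive (V:=C_RCN) F f); intros t Ht. apply HF. apply Hf. Qed.

Lemma Ccont_all_scal c f p q : Ccont_all f -> CRInt (fun t => c * f t) p q = c * CRInt f p q.
Proof. intros. apply (is_RInt_unique (V:=C_RCN)). apply is_RInt_cmult. apply Ccont_all_is; auto. Qed.

Lemma Ccont_all_plus f g p q : Ccont_all f -> Ccont_all g -> CRInt (fun t => f t + g t) p q = CRInt f p q + CRInt g p q.
Proof. intros. apply (is_RInt_unique (V:=C_RCN)). apply (is_RInt_plus (V:=C_R_NormedModule)); apply Ccont_all_is; auto. Qed.

Lemma Ccont_all_norm_le f g p q : (p <= q)%R -> Ccont_all f -> (forall t, continuous g t) -> (forall t, (p <= t <= q)%R -> (Cmod (f t) <= g t)%R) ->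
  (Cmod (CRInt f p q) <= RInt g p q)%R.
Proof.
  intros Hp Hf Hg H. rewrite <- norm_CR. apply (norm_RInt_le (V:=C_R_NormedModule) f g p q); auto.
  - intros x Hx. rewrite norm_CR. auto.
  - apply Ccont_all_is; auto.
  - apply (RInt_correct (V:=R_CompleteNormedModule)). apply (ex_RInt_continuous (V:=R_CompleteNormedModule)). intros; apply Hg.
Qed.

Definition wallis_fun (z : C) (n : nat) (x : R) : C := Ccos (2 * z * RtoC x) * RtoC (cos x ^ (2 * n)).
Definition wallis_int (z : C) (n : nat) : C := CRInt (wallis_fun z n) 0 (PI / 2).

Lemma is_derive_cospow k t : is_derive (fun x => cos x ^ (S k))%R t (- (INR (S k) * cos t ^ k * sin t))%R.
Proof.
  eapply is_derive_val. apply is_derive_pow. apply is_derive_cos. change (Nat.pred (S k)) with k. ring.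
Qed.

Lemma wallis_fun_cont z n : Ccont_all (wallis_fun z n).
Proof.
  intros t. apply Ccont_mult. eapply is_Cderive_cont. apply is_Cderive_Ccos.
  apply Ccont_RtoC. apply (ex_derive_continuous (K:=R_AbsRing) (V:=R_NormedModule)). auto_derive. auto.
Qed.

(* With [wallis_int_0] and [wallis_int_lim] this gives Euler's product for the sine. *)
Lemma wallis_int_rec z k : let n := natC (S k) in
  (4 * n * n - 4 * z * z) * wallis_int z (S k) = 2 * n * (2 * n - 1) * wallis_int z k.
Proof.
  intros n. 
  (* The boundary terms of two integrations by parts, which vanish at both [0] and [PI / 2]. *)
  set (F := fun x : R => 2 * n * (Ccos (2 * z * RtoC x) * RtoC (cos x ^ (2 * k + 1) * sin x)) - 2 * z * (Csin (2 * z * RtoC x) * RtoC (cos x ^ (2 * k + 2)))).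
  assert (H : CRInt (fun x => (4 * n * n - 4 * z * z) * wallis_fun z (S k) x + (- (2 * n * (2 * n - 1))) * wallis_fun z k x) 0 (PI / 2) = F (PI / 2)%R - F 0%R).
  { apply Ccont_all_FTC.
    - intros t. eapply is_Cderive_eq. apply is_Cderive_minus; apply is_Cderive_scal; apply is_Cderive_mult.
      apply is_Cderive_Ccos.
      apply is_Cderive_RtoC. apply Derive.is_derive_mult. replace (2 * k + 1)%nat with (S (2 * k)) by lia. apply is_derive_cospow. apply is_derive_sin.
      apply is_Cderive_Csin.
      apply is_Cderive_RtoC. replace (2 * k + 2)%nat with (S (2 * k + 1)) by lia. apply is_derive_cospow.
      unfold wallis_fun. set (CC := Ccos (2 * z * RtoC t)). set (SS := Csin (2 * z * RtoC t)).
      replace (2 * S k)%nat with (2 * k + 2)%nat by lia. 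
      assert (E1 : n = RtoC (INR k + 1)) by (unfold n, natC; rewrite S_INR; reflexivity).
      pose proof (sin2_cos2 t) as T. unfold Rsqr in T.
      rewrite S_INR, (S_INR (2 * k + 1)), plus_INR, mult_INR. simpl (INR 2). simpl (INR 1).
      replace (cos t ^ (2 * k + 2))%R with (cos t ^ (2 * k) * (cos t * cos t))%R by (rewrite pow_add; simpl; ring).
      replace (cos t ^ (2 * k + 1))%R with (cos t ^ (2 * k) * cos t)%R by (rewrite pow_add; simpl; ring).
      set (P := (cos t ^ (2 * k))%R).
      assert (HS : RtoC (sin t) * RtoC (sin t) = 1 - RtoC (cos t) * RtoC (cos t)).
      { rewrite <- !RtoC_mult, <- RtoC_minus. f_equal. lra. }
      rewrite E1. rewrite !RtoC_plus, !RtoC_mult, !RtoC_opp, !RtoC_mult, ?RtoC_plus, ?RtoC_mult, ?RtoC_plus.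
      set (K := RtoC (INR k)). set (c := RtoC (cos t)) in *. set (s := RtoC (sin t)) in *. set (p := RtoC P).
      transitivity (2 * (K + 1) * (CC * (- ((2 * K + 1) * p * (s * s)) + p * c * c)) - 4 * z * z * CC * p * c * c).
      ring. rewrite HS. ring.
    - intros t. apply Ccont_plus; apply Ccont_mult; try apply Ccont_const; apply wallis_fun_cont. }
  assert (E0 : F (PI / 2)%R - F 0%R = 0).
  { unfold F. rewrite cos_PI2, sin_0, Rmult_0_r, !Cmult_0_r, Csin_0.
    rewrite !pow_ne_zero by lia. rewrite Rmult_0_l. ring. }
  rewrite E0 in H.
  rewrite (Ccont_all_plus (fun x => (4 * n * n - 4 * z * z) * wallis_fun z (S k) x) (fun x => (- (2 * n * (2 * n - 1))) * wallis_fun z k x)) in H;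
    try (intros t; apply Ccont_mult; [apply Ccont_const|apply wallis_fun_cont]).
  rewrite (Ccont_all_scal _ (wallis_fun z (S k))), (Ccont_all_scal _ (wallis_fun z k)) in H by apply wallis_fun_cont.
  change (CRInt (wallis_fun z (S k)) 0 (PI / 2)) with (wallis_int z (S k)) in H. change (CRInt (wallis_fun z k) 0 (PI / 2)) with (wallis_int z k) in H.
  transitivity ((4 * n * n - 4 * z * z) * wallis_int z (S k) + - (2 * n * (2 * n - 1)) * wallis_int z k + 2 * n * (2 * n - 1) * wallis_int z k). ring.
  rewrite H. ring.
Qed.

Lemma wallis_int_0 (z : C) : z <> 0 -> wallis_int z 0 = Csin (z * RtoC PI) / (2 * z).
Proof.
  intros Hz. unfold wallis_int.
  rewrite (Ccont_all_FTC (fun x => / (2 * z) * Csin (2 * z * RtoC x))).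
  - rewrite Cmult_0_r, Csin_0. replace (2 * z * RtoC (PI / 2)) with (z * RtoC PI) by (rewrite RtoC_div by lra; field). field; auto.
  - intros t. eapply is_Cderive_eq. apply is_Cderive_scal. apply is_Cderive_Csin. unfold wallis_fun. simpl. field. auto.
  - apply wallis_fun_cont.
Qed.

Fixpoint wallis_val (n : nat) : R := match n with O => (PI / 2)%R | S k => (wallis_val k * ((2 * INR k + 1) / (2 * INR k + 2)))%R end.

Lemma wallis_val_pos n : (0 < wallis_val n)%R.
Proof.
  induction n; simpl. pose proof PI_RGT_0; lra. pose proof (pos_INR n). apply Rmult_lt_0_compat; auto. apply Rdiv_lt_0_compat; lra.
Qed.

Lemma wallis_int_zero_arg n : wallis_int 0 n = RtoC (wallis_val n).
Proof.
  induction n.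
  - unfold wallis_int. rewrite (Ccont_all_FTC (fun x => RtoC x)).
    + simpl. rewrite <- RtoC_minus. f_equal. lra.
    + intros t. eapply is_Cderive_eq. apply is_Cderive_RtoC. apply is_derive_id. unfold wallis_fun. 
      rewrite Cmult_0_r, Cmult_0_l, Ccos_0. unfold one; simpl; ring.
    + apply wallis_fun_cont.
  - pose proof (wallis_int_rec 0 n) as H. cbv zeta in H. rewrite IHn in H. simpl wallis_val.
    pose proof (pos_INR n). assert (N1 : natC (S n) = RtoC (INR n + 1)) by (unfold natC; rewrite S_INR; reflexivity).
    rewrite N1 in H. assert (N2 : RtoC (INR n + 1) <> 0) by (apply RtoC_neq_0; lra).
    replace (wallis_int 0 (S n)) with ((4 * RtoC (INR n + 1) * RtoC (INR n + 1) - 4 * 0 * 0) * wallis_int 0 (S n) / (4 * RtoC (INR n + 1) * RtoC (INR n + 1))) by (field; auto).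
    rewrite H. rewrite RtoC_mult, RtoC_div by lra. rewrite !RtoC_plus, RtoC_mult. rewrite !RtoC_plus in N2.
    field. split; auto. intros E. apply N2. replace (RtoC (INR n) + 1) with ((2 * RtoC (INR n) + 2) / 2) by field. rewrite E. field.
Qed.

(** With [y = x / 2]: [2 sin x = 4 sin y cos y >= 4 y (cos y)^2 = x (1 + cos x) >= x]. *)
Lemma sin_ge_half x : (0 <= x <= PI / 2)%R -> (x <= 2 * sin x)%R.
Proof.
  intros Hx. set (y := (x / 2)%R).
  assert (A : (y * cos y <= sin y)%R).
  { destruct (MVT_gen sin 0 y cos) as [c [Hc E]].
    - intros; apply is_derive_sin. - intros; apply continuity_pt_filterlim, continuous_sin.
    - unfold y in *. rewrite Rmin_left, Rmax_right in Hc by lra. rewrite sin_0 in E. 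
      assert (cos (x / 2) <= cos c)%R by (apply cos_decr_1; lra). nra. }
  assert (B : (sin x = 2 * sin y * cos y)%R). { replace x with (2 * y)%R by (unfold y; field). apply sin_2a. }
  assert (Cc : (cos y * cos y = (1 + cos x) / 2)%R). { replace x with (2 * y)%R by (unfold y; field). rewrite cos_2a_cos. field. }
  assert (0 <= cos x)%R by (apply cos_ge_0; lra). assert (0 <= cos y)%R by (apply cos_ge_0; unfold y; lra).
  
  assert (x = 2 * y)%R by (unfold y; field). nra.
Qed.

(** The first-order terms of the two exponentials cancel, which leaves a quadratic bound. *)
Lemma Ccos_minus_1_le w : (Cmod (Ccos w - 1) <= Cmod w * Cmod w * exp (Cmod w))%R.
Proof.
  assert (K : forall v, (Re v <= Cmod v)%R). { intros v. eapply Rle_trans; [apply Rle_abs|apply re_le_Cmod]. }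
  assert (M1 : Cmod (Ci * w) = Cmod w) by (rewrite Cmod_mult, Cmod_Ci; ring).
  pose proof (Cexp_taylor1 0 (Ci * w) (Cmod w) ltac:(simpl; apply Cmod_ge_0) ltac:(rewrite <- M1; apply K)) as A1.
  pose proof (Cexp_taylor1 0 (- (Ci * w)) (Cmod w) ltac:(simpl; apply Cmod_ge_0) ltac:(rewrite <- M1, <- Cmod_opp; apply K)) as A2.
  rewrite Cexp_0 in A1, A2. replace (Ci * w - 0) with (Ci * w) in A1 by ring. replace (- (Ci * w) - 0) with (- (Ci * w)) in A2 by ring.
  rewrite M1 in A1. rewrite Cmod_opp, M1 in A2.
  unfold Ccos. replace ((Cexp (Ci * w) + Cexp (- (Ci * w))) / 2 - 1)
    with (RtoC (/ 2) * ((Cexp (Ci * w) - 1 - Ci * w * 1) + (Cexp (- (Ci * w)) - 1 - - (Ci * w) * 1))).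
  2: rewrite RtoC_inv by lra; field.
  rewrite Cmod_mult, Cmod_R, Rabs_pos_eq by lra. pose proof (Cmod_triangle (Cexp (Ci * w) - 1 - Ci * w * 1) (Cexp (- (Ci * w)) - 1 - - (Ci * w) * 1)). lra.
Qed.

(** The quadratic bound and [x <= 2 sin x] give [|cos(2zx) - 1| <= B (sin x)^2]. Since
    [(sin x)^2 (cos x)^(2n)] is a difference of consecutive powers, its integral is [wallis_val n -
    wallis_val (S n) = wallis_val n / (2n + 2)], which is small relative to [wallis_val n]. *)
Lemma wallis_int_lim z : is_Clim (fun n => wallis_int z n / RtoC (wallis_val n)) 1.
Proof.
  set (B := (16 * (Cmod z * Cmod z) * exp (Cmod z * PI))%R).
  assert (HB : (0 <= B)%R). { unfold B. pose proof (exp_pos (Cmod z * PI)). nra. }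
  apply (is_Clim_le _ _ (fun n => B * / (INR (S n)))%R).
  2:{ replace (Finite 0) with (Rbar_mult B 0) by (simpl; f_equal; ring). apply is_lim_seq_scal_l.
      apply (is_lim_seq_incr_1 (fun n => / INR n)%R). 
      replace (Finite 0) with (Rbar_inv p_infty) by reflexivity. apply is_lim_seq_inv. apply is_lim_seq_INR. discriminate. }
  intros n. pose proof (wallis_val_pos n) as Hw. assert (Nw : RtoC (wallis_val n) <> 0) by (apply RtoC_neq_0; lra).
  pose proof PI_RGT_0 as HPI.
  set (g := fun x => (B * (cos x ^ (2 * n) - cos x ^ (2 * S n)))%R).
  assert (Hg : forall t, continuous g t).
  { intros t. unfold g. apply (ex_derive_continuous (K:=R_AbsRing) (V:=R_NormedModule)). auto_derive. auto. }
  assert (Hn : (Cmod (wallis_int z n - RtoC (wallis_val n)) <= B * (wallis_val n - wallis_val (S n)))%R).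
  { rewrite <- wallis_int_zero_arg.
    replace (wallis_int z n - wallis_int 0 n) with (CRInt (fun x => wallis_fun z n x + RtoC (-1) * wallis_fun 0 n x) 0 (PI / 2)).
    2:{ assert (Hs : Ccont_all (fun x => RtoC (-1) * wallis_fun 0 n x)).
        { intros t; apply Ccont_mult. apply Ccont_const. apply wallis_fun_cont. }
        pose proof (Ccont_all_plus _ _ 0 (PI / 2) (wallis_fun_cont z n) Hs) as E1.
        pose proof (Ccont_all_scal (RtoC (-1)) _ 0 (PI / 2) (wallis_fun_cont 0 n)) as E2.
        transitivity (wallis_int z n + RtoC (-1) * wallis_int 0 n); [|rewrite RtoC_m1; ring].
        unfold wallis_int. rewrite <- E2. exact E1. }
    replace (B * (wallis_val n - wallis_val (S n)))%R with (RInt g 0 (PI / 2)).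
    - apply Ccont_all_norm_le; auto. lra.
      + intros t. apply Ccont_plus. apply wallis_fun_cont. apply Ccont_mult. apply Ccont_const. apply wallis_fun_cont.
      + intros t Ht. unfold wallis_fun. rewrite RtoC_m1, Cmult_0_r, Cmult_0_l, Ccos_0.
        replace (Ccos (2 * z * RtoC t) * RtoC (cos t ^ (2 * n)) + - (1) * (1 * RtoC (cos t ^ (2 * n)))) with ((Ccos (2 * z * RtoC t) - 1) * RtoC (cos t ^ (2 * n))) by ring.
        assert (Hc : (0 <= cos t ^ (2 * n))%R). { apply pow_le. apply cos_ge_0; lra. }
        rewrite Cmod_mult, Cmod_R, (Rabs_pos_eq (cos t ^ (2 * n))) by auto.
        unfold g. replace (cos t ^ (2 * n) - cos t ^ (2 * S n))%R with (sin t * sin t * cos t ^ (2 * n))%R.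
        2:{ replace (2 * S n)%nat with (2 * n + 2)%nat by lia. rewrite pow_add. pose proof (sin2_cos2 t) as T. unfold Rsqr in T. 
            replace (sin t * sin t)%R with (1 - cos t * cos t)%R by lra. ring. }
        rewrite <- Rmult_assoc. apply Rmult_le_compat_r; auto.
        eapply Rle_trans. apply Ccos_minus_1_le. pose proof (sin_ge_half t Ht) as S1.
        assert (M : Cmod (2 * z * RtoC t) = (2 * Cmod z * t)%R). { rewrite !Cmod_mult, !Cmod_R, !Rabs_pos_eq; lra. }
        rewrite M. unfold B. pose proof (Cmod_ge_0 z).
        assert (E : (exp (2 * Cmod z * t) <= exp (Cmod z * PI))%R) by (apply exp_le; nra).
        pose proof (exp_pos (2 * Cmod z * t)).
        assert (Q : (2 * Cmod z * t * (2 * Cmod z * t) <= 16 * (Cmod z * Cmod z) * (sin t * sin t))%R).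
        { replace (2 * Cmod z * t * (2 * Cmod z * t))%R with ((Cmod z * Cmod z) * (4 * (t * t)))%R by ring.
          replace (16 * (Cmod z * Cmod z) * (sin t * sin t))%R with ((Cmod z * Cmod z) * (16 * (sin t * sin t)))%R by ring.
          apply Rmult_le_compat_l. nra. nra. }
        replace (16 * (Cmod z * Cmod z) * exp (Cmod z * PI) * (sin t * sin t))%R with (16 * (Cmod z * Cmod z) * (sin t * sin t) * exp (Cmod z * PI))%R by ring.
        apply Rmult_le_compat; auto. nra. lra.
    - assert (W : forall k, is_RInt (fun x => cos x ^ (2 * k))%R 0 (PI / 2) (wallis_val k)).
      { intros k. pose proof (Ccont_all_is (wallis_fun 0 k) 0 (PI / 2) (wallis_fun_cont 0 k)) as I. fold (wallis_int 0 k) in I. rewrite wallis_int_zero_arg in I.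
        pose proof (is_RInt_fct_extend_fst (U:=R_NormedModule) (V:=R_NormedModule) _ _ _ _ I) as I1.
        eapply (is_RInt_ext (V:=R_NormedModule)); [|exact I1]. intros x _. change (Re (wallis_fun 0 k x) = (cos x ^ (2 * k))%R). unfold wallis_fun.
        rewrite Cmult_0_r, Cmult_0_l, Ccos_0, Cmult_1_l. reflexivity. }
      apply is_RInt_unique. 
      apply (is_RInt_scal (V:=R_NormedModule)). apply (is_RInt_minus (V:=R_NormedModule)); apply W. }
  replace (wallis_int z n / RtoC (wallis_val n) - 1) with ((wallis_int z n - RtoC (wallis_val n)) / RtoC (wallis_val n)) by (field; auto).
  rewrite Cmod_div, Cmod_R, Rabs_pos_eq by (auto; lra).
  apply Rmult_le_reg_r with (wallis_val n); auto. unfold Rdiv. rewrite Rmult_assoc, Rinv_l, Rmult_1_r by lra.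
  eapply Rle_trans. apply Hn. simpl wallis_val. rewrite S_INR. pose proof (pos_INR n).
  rewrite Rmult_assoc. apply Rmult_le_compat_l; auto.
  apply Rle_trans with (wallis_val n * (/ (2 * INR n + 2)))%R. right; field; lra.
  rewrite Rmult_comm. apply Rmult_le_compat_r. lra. apply Rinv_le_contravar; lra.
Qed.

Definition is_Zint (z : C) : Prop := exists k : Z, z = RtoC (IZR k).

(* [Gamma(n+1+z) Gamma(n+1-z) / n!^2 * wallis_int z n / wallis_int 0 n] does not depend on [n]
   and tends to [1]. *)
Lemma reflection_strip z : (Rabs (Re z) < 1)%R -> ~ is_Zint z ->
  Gamma_Euler (1 + z) * Gamma_Euler (1 - z) * Csin (z * RtoC PI) = RtoC PI * z.
Proof.
  intros Hz Hn.
  assert (Hz' := Rabs_def2 _ _ Hz).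
  assert (Hz0 : z <> 0). { intros E. apply Hn. exists 0%Z. exact E. }
  set (s := fun n => Gamma_ratio n z * Gamma_ratio n (- z) * (wallis_int z n / RtoC (wallis_val n))).
  assert (L1 : is_Clim s (1 * 1 * 1)).
  { apply is_Clim_mult. apply is_Clim_mult. apply Gamma_ratio_lim. lra. apply Gamma_ratio_lim. rewrite Re_opp, Rabs_Ropp. lra. apply wallis_int_lim. }
  assert (Hden : forall k, natC (S k) + z <> 0 /\ natC (S k) - z <> 0).
  { intros k. split; intros E; apply Hn.
    - exists (- Z.of_nat (S k))%Z. rewrite opp_IZR, <- INR_IZR_INZ, RtoC_opp. replace z with (natC (S k) + z - natC (S k)) by ring. rewrite E. unfold natC; ring.
    - exists (Z.of_nat (S k))%Z. rewrite <- INR_IZR_INZ. replace z with (natC (S k) - (natC (S k) - z)) by ring. rewrite E. unfold natC; ring. }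
  assert (Hg : forall n, (1 <= n)%nat -> Gamma_ratio n z * Gamma_ratio n (- z) = Gamma_Euler (natC n + 1 + z) * Gamma_Euler (natC n + 1 - z) / (RtoC (INR (fact n)) * RtoC (INR (fact n)))).
  { intros n Hn1. unfold Gamma_ratio. rewrite rpow_opp. pose proof (rpow_neq_0 (INR n) z).
    assert (RtoC (INR (fact n)) <> 0) by (apply RtoC_neq_0; pose proof (INR_fact_pos n); lra).
    replace (natC n + 1 + - z) with (natC n + 1 - z) by ring. field. auto. }
  set (G := fun n => Gamma_Euler (natC n + 1 + z) * Gamma_Euler (natC n + 1 - z) / (RtoC (INR (fact n)) * RtoC (INR (fact n))) * (wallis_int z n / RtoC (wallis_val n))).
  assert (HG : forall n, G (S n) = G n).
  { intros n. unfold G. pose proof (wallis_int_rec z n) as R1. cbv zeta in R1.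
    destruct (Hden n) as [D1 D2]. pose proof (wallis_val_pos n) as W. pose proof (pos_INR n).
    set (N := natC (S n)) in *. assert (EN : N = natC n + 1) by apply natC_S.
    assert (NN : N <> 0) by apply natC_neq_0.
    replace (N + 1 + z) with ((natC n + 1 + z) + 1) by (rewrite EN; ring).
    replace (N + 1 - z) with ((natC n + 1 - z) + 1) by (rewrite EN; ring).
    rewrite !Gamma_Euler_rec.
    2,3: unfold Cminus; rewrite ?Re_plus, ?Re_opp, Re_natC; simpl Re; lra.
    rewrite <- EN. rewrite fact_simpl, mult_INR, RtoC_mult. fold (natC (S n)). fold N.
    simpl wallis_val. rewrite RtoC_mult, RtoC_div by lra. 
    replace (RtoC (2 * INR n + 1)) with (2 * N - 1). 2:{ rewrite EN. unfold natC. rewrite RtoC_plus, RtoC_mult. ring. }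
    replace (RtoC (2 * INR n + 2)) with (2 * N). 2:{ rewrite EN. unfold natC. rewrite RtoC_plus, RtoC_mult. ring. }
    assert (N1 : 2 * N - 1 <> 0). { rewrite EN. apply Re_pos_neq_0. unfold Cminus. rewrite Re_plus. unfold natC, Re; simpl. lra. }
    assert (N2 : RtoC (wallis_val n) <> 0) by (apply RtoC_neq_0; lra).
    assert (N3 : RtoC (INR (fact n)) <> 0) by (apply RtoC_neq_0; pose proof (INR_fact_pos n); lra).
    replace (wallis_int z n) with ((4 * N * N - 4 * z * z) * wallis_int z (S n) / (2 * N * (2 * N - 1))) by (rewrite R1; field; auto).
    field. repeat split; auto. }
  assert (HG0 : forall n, G n = G O) by (induction n; [reflexivity|rewrite HG; auto]).
  assert (L2 : is_Clim s (G O)).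
  { apply (is_Clim_unshift _ _ 1). apply (is_Clim_ext (fun _ => G O)). 2: apply is_Clim_const.
    intros n. rewrite Nat.add_1_r. unfold s. rewrite Hg by lia. symmetry. apply (HG0 (S n)). }
  pose proof (is_Clim_unique _ _ _ L1 L2) as E. unfold G in E.
  rewrite wallis_int_0 in E by auto. simpl wallis_val in E. 
  replace (natC 0 + 1 + z) with (1 + z) in E by (unfold natC; simpl; ring).
  replace (natC 0 + 1 - z) with (1 - z) in E by (unfold natC; simpl; ring).
  assert (HP : RtoC PI <> 0) by (apply RtoC_neq_0; pose proof PI_RGT_0; lra).
  rewrite RtoC_div in E by lra. simpl INR in E.
  transitivity ((1 * 1 * 1) * (RtoC PI * z)). rewrite E. field. auto. ring.
Qed.

(** * The reflection formula at all non-integers *)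

Lemma is_Zint_sub_natC z n : is_Zint (z + natC n) -> is_Zint z.
Proof.
  intros [k Hk]. exists (k - Z.of_nat n)%Z. rewrite minus_IZR, <- INR_IZR_INZ, RtoC_minus, <- Hk. unfold natC. ring.
Qed.

Lemma is_Zint_add_natC z n : is_Zint z -> is_Zint (z + natC n).
Proof.
  intros [k Hk]. exists (k + Z.of_nat n)%Z. rewrite plus_IZR, <- INR_IZR_INZ, RtoC_plus, <- Hk. reflexivity.
Qed.

Lemma is_Zint_opp z : is_Zint (- z) -> is_Zint z.
Proof. intros [k Hk]. exists (- k)%Z. rewrite opp_IZR, RtoC_opp, <- Hk. ring. Qed.

Lemma is_Zint_S z : is_Zint (z + 1) -> is_Zint z.
Proof. intros H. apply (is_Zint_sub_natC z 1). exact H. Qed.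

Lemma nonint_not_pole z : ~ is_Zint z -> not_pole z.
Proof.
  intros H k E. apply H. apply (is_Zint_sub_natC z k). rewrite E. exists 0%Z. reflexivity.
Qed.

Lemma Cexp_CiPI : Cexp (Ci * RtoC PI) = - (1).
Proof.
  apply C_ext; unfold Re, Im; simpl.
  - replace (0 * PI - 1 * 0)%R with 0%R by ring. replace (0 * 0 + 1 * PI)%R with PI by ring. rewrite exp_0, cos_PI. ring.
  - replace (0 * PI - 1 * 0)%R with 0%R by ring. replace (0 * 0 + 1 * PI)%R with PI by ring. rewrite exp_0, sin_PI. ring.
Qed.

Lemma Csin_shift z : Csin ((z + 1) * RtoC PI) = - Csin (z * RtoC PI).
Proof.
  unfold Csin. replace (Ci * ((z + 1) * RtoC PI)) with (Ci * (z * RtoC PI) + Ci * RtoC PI) by ring.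
  replace (- (Ci * (z * RtoC PI) + Ci * RtoC PI)) with (- (Ci * (z * RtoC PI)) + - (Ci * RtoC PI)) by ring.
  rewrite !Cexp_add, (Cexp_inv (Ci * RtoC PI)), Cexp_CiPI. field. apply Ci_neq_0.
Qed.

Lemma Csin_opp w : Csin (- w) = - Csin w.
Proof.
  unfold Csin. replace (Ci * - w) with (- (Ci * w)) by ring. replace (- - (Ci * w)) with (Ci * w) by ring. field. apply Ci_neq_0.
Qed.

Definition refl_prod (z : C) : C := Gamma (- z) * Gamma (1 + z) * Csin (z * RtoC PI).

(** The shift multiplies [Gamma (1 + z)] by [1 + z], divides [Gamma (- z)] by [- (z + 1)] and
    changes the sign of the sine. *)
Lemma refl_prod_S z : ~ is_Zint z -> refl_prod (z + 1) = refl_prod z.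
Proof.
  intros H. unfold refl_prod.
  assert (H1 : ~ is_Zint (- (z + 1))) by (intros K; apply H, is_Zint_S, is_Zint_opp; auto).
  assert (H2 : ~ is_Zint (1 + z)) by (intros K; apply H, is_Zint_S; rewrite Cplus_comm; auto).
  rewrite Csin_shift. replace (1 + (z + 1)) with ((1 + z) + 1) by ring. rewrite (Gamma_rec (1 + z)) by (apply nonint_not_pole; auto).
  replace (- z) with (- (z + 1) + 1) by ring. rewrite Gamma_rec by (apply nonint_not_pole; auto). ring.
Qed.

Lemma refl_prod_add_natC z n : ~ is_Zint z -> refl_prod (z + natC n) = refl_prod z.
Proof.
  intros H. induction n. f_equal. unfold natC; simpl; ring.
  rewrite natC_S, Cplus_assoc, refl_prod_S; auto. intros K. apply H, (is_Zint_sub_natC z n); auto.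
Qed.

Lemma refl_prod_strip z : ~ is_Zint z -> (Rabs (Re z) < 1)%R -> refl_prod z = - RtoC PI.
Proof.
  intros H Hz. pose proof (reflection_strip z Hz H) as R1. apply Rabs_def2 in Hz.
  assert (Hz0 : z <> 0) by (intros E; apply H; exists 0%Z; exact E).
  rewrite <- (Gamma_pos (1 + z)), <- (Gamma_pos (1 - z)) in R1.
  2,3: unfold Cminus; rewrite Re_plus, ?Re_opp; simpl Re; lra.
  replace (1 - z) with (- z + 1) in R1 by ring. rewrite Gamma_rec in R1.
  2: apply nonint_not_pole; intros K; apply H, is_Zint_opp; auto.
  unfold refl_prod. replace (Gamma (- z) * Gamma (1 + z) * Csin (z * RtoC PI)) with (Gamma (1 + z) * (- z * Gamma (- z)) * Csin (z * RtoC PI) / - z) by (field; auto).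
  rewrite R1. field; auto.
Qed.

(** By periodicity of [refl_prod] the real part can be moved into []-1, 1[], where
    [reflection_strip] applies. *)
Lemma reflection z : ~ is_Zint z -> Gamma (- z) * Gamma (1 + z) * Csin (z * RtoC PI) = - RtoC PI.
Proof.
  intros H. fold (refl_prod z). destruct (Rle_lt_dec 0 (Re z)) as [Hz|Hz].
  - destruct (nfloor_ex (Re z) Hz) as [n Hn]. replace z with ((z - natC n) + natC n) by ring.
    assert (H' : ~ is_Zint (z - natC n)). { intros K. apply H. replace z with ((z - natC n) + natC n) by ring. apply is_Zint_add_natC; auto. }
    rewrite refl_prod_add_natC by auto. apply refl_prod_strip; auto. unfold Cminus. rewrite Re_plus, Re_opp, Re_natC. apply Rabs_def1; lra.
  - destruct (nfloor_ex (- Re z)) as [n Hn]. lra. rewrite <- (refl_prod_add_natC z n) by auto.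
    apply refl_prod_strip. intros K; apply H, (is_Zint_sub_natC z n); auto. rewrite Re_plus, Re_natC. apply Rabs_def1; lra.
Qed.

Lemma RtoC_PI_neq_0 : RtoC PI <> 0.
Proof. apply RtoC_neq_0. pose proof PI_RGT_0; lra. Qed.

Lemma reflection_neq_0 z : ~ is_Zint z -> Gamma (1 + z) <> 0 /\ Csin (z * RtoC PI) <> 0.
Proof.
  intros H. pose proof (reflection z H) as R1. pose proof RtoC_PI_neq_0 as P. split; intros E; rewrite E in R1; apply P.
  replace (RtoC PI) with (- - RtoC PI) by ring. rewrite <- R1. ring.
  replace (RtoC PI) with (- - RtoC PI) by ring. rewrite <- R1. ring.
Qed.

(** At integers the value is a factorial; elsewhere a zero would contradict the reflection formula,
    whose right-hand side is not 0. *)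
Lemma Gamma_Euler_neq_0 q : (0 < Re q)%R -> Gamma_Euler q <> 0.
Proof.
  intros Hq. destruct (classic (is_Zint q)) as [[k Hk]|H].
  - assert (Hk0 : (0 < k)%Z). { rewrite Hk in Hq. apply lt_IZR in Hq. auto. }
    assert (E : q = natC (Z.to_nat (k - 1)) + 1).
    { rewrite Hk. unfold natC. rewrite <- RtoC_plus. f_equal. rewrite INR_IZR_INZ, Z2Nat.id, minus_IZR by lia. simpl; ring. }
    rewrite E, Gamma_Euler_fact. apply RtoC_neq_0. pose proof (INR_fact_pos (Z.to_nat (k - 1))). lra.
  - rewrite <- Gamma_pos by auto. replace q with (1 + (q - 1)) by ring. apply reflection_neq_0.
    intros K. apply H. replace q with ((q - 1) + natC 1) by (unfold natC; simpl; ring). apply is_Zint_add_natC; auto.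
Qed.

(** * Integral representation of K *)

Definition exp_coef (d : C) (n : nat) : C := d ^ n / RtoC (INR (fact n)).
Definition exp_coefR (x : R) (n : nat) : R := (x ^ n / INR (fact n))%R.

Lemma fact_neq_0_C n : RtoC (INR (fact n)) <> 0.
Proof. apply RtoC_neq_0. pose proof (INR_fact_pos n); lra. Qed.

Lemma Cmod_exp_coef d n : Cmod (exp_coef d n) = exp_coefR (Cmod d) n.
Proof.
  unfold exp_coef, exp_coefR. rewrite Cmod_div by apply fact_neq_0_C. rewrite Cmod_pow, Cmod_R, Rabs_pos_eq; auto. left; apply INR_fact_pos.
Qed.

Lemma exp_coefR_series d x : is_series (fun n => exp_coefR d n * x ^ n)%R (exp (d * x)).
Proof.
  pose proof (is_exp_Reals (d * x)) as H. apply is_pseries_R in H. eapply is_series_ext; [|exact H].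
  intros n. simpl. unfold exp_coefR. rewrite Rpow_mult_distr. unfold Rdiv. ring.
Qed.

Lemma exp_coefR_pos d n : (0 <= d)%R -> (0 <= exp_coefR d n)%R.
Proof. intros. apply Rdiv_le_0_compat. apply pow_le; auto. apply INR_fact_pos. Qed.

Lemma exp_coef_summable d r : CPS_summable (exp_coef d) r.
Proof. apply (CPS_summable_le _ (exp_coefR (Cmod d))). intros n; rewrite Cmod_exp_coef; lra. intros x Hx. eexists. apply exp_coefR_series. Qed.

Lemma CPSeries_ext a b x : (forall n, a n = b n) -> CPSeries a x = CPSeries b x.
Proof. intros H. unfold CPSeries. f_equal; apply PSeries_ext; intros n; rewrite H; reflexivity. Qed.

Lemma exp_coef_S d n : natC (S n) * exp_coef d (S n) = d * exp_coef d n.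
Proof.
  unfold exp_coef. rewrite fact_simpl, mult_INR, RtoC_mult. fold (natC (S n)). simpl Cpow. pose proof (natC_neq_0 n). pose proof (fact_neq_0_C n).
  field. auto.
Qed.

Lemma exp_coef_is_series d x : is_Cseries (fun n => exp_coef d n * RtoC (x ^ n)) (CPSeries (exp_coef d) x).
Proof. apply (CPSeries_is_series _ (Rabs x + 1)). apply exp_coef_summable. lra. Qed.

Lemma CPSeries_exp_coef d x : CPSeries (exp_coef d) x = Cexp (d * RtoC x).
Proof.
  set (f := fun t : R => Cexp (- d * RtoC t) * CPSeries (exp_coef d) t).
  assert (E : f 0%R = f x).
  { apply is_Cderive_zero_const. intros t _. eapply is_Cderive_eq. apply is_Cderive_mult.
    apply is_Cderive_Cexp. apply is_Cderive_scal. apply is_Cderive_RtoC. apply is_derive_id.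
    apply (is_Cderive_CPSeries _ (Rabs t + 1)). apply exp_coef_summable. lra.
    assert (D : CPSeries (CPS_derive (exp_coef d)) t = d * CPSeries (exp_coef d) t).
    { pose proof (CPS_derive_series (exp_coef d) (Rabs t + 1) t (exp_coef_summable _ _) ltac:(lra)) as S1.
      pose proof (is_Cseries_scal d _ _ (exp_coef_is_series d t)) as S2.
      apply (is_Clim_unique _ _ _ S1). eapply is_Cseries_ext; [|exact S2]. intros n. unfold CPS_derive. rewrite exp_coef_S. ring. }
    rewrite D. unfold one; simpl. ring. }
  unfold f in E. rewrite CPSeries_0, Cmult_0_r, Cexp_0 in E. replace (exp_coef d 0) with (RtoC 1) in E by (unfold exp_coef; simpl; field).
  replace (- d * RtoC x) with (- (d * RtoC x)) in E by ring. rewrite Cexp_inv in E. pose proof (Cexp_neq_0 (d * RtoC x)).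
  replace (CPSeries (exp_coef d) x) with (Cexp (d * RtoC x) * (/ Cexp (d * RtoC x) * CPSeries (exp_coef d) x)) by (field; auto).
  rewrite <- E. ring.
Qed.

(** Gives a common lower bound to all denominators [j - z], also after integer shifts of [z]. *)
Lemma nonint_gap z : ~ is_Zint z -> exists d, (0 < d)%R /\ forall k : Z, (d <= Cmod (RtoC (IZR k) - z))%R.
Proof.
  intros H. destruct (Req_dec (Im z) 0) as [E|E].
  - set (n := up (Re z)). pose proof (archimed (Re z)) as [A B]. fold n in A, B.
    assert (Hne : (IZR n - Re z <> 1)%R).
    { intros X. apply H. exists (n - 1)%Z. apply C_ext; simpl. rewrite minus_IZR. lra. auto. }
    exists (Rmin (IZR n - Re z) (1 - (IZR n - Re z))). split. apply Rmin_glb_lt; lra.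
    intros k. pose proof (re_le_Cmod (RtoC (IZR k) - z)) as R1. replace (Re (RtoC (IZR k) - z)) with (IZR k - Re z)%R in R1 by reflexivity.
    eapply Rle_trans; [|exact R1]. pose proof (Rmin_l (IZR n - Re z) (1 - (IZR n - Re z))). pose proof (Rmin_r (IZR n - Re z) (1 - (IZR n - Re z))).
    destruct (Z.le_gt_cases n k) as [K|K].
    + apply IZR_le in K. rewrite Rabs_pos_eq; lra.
    + assert (K' : (k <= n - 1)%Z) by lia. apply IZR_le in K'. rewrite minus_IZR in K'. rewrite Rabs_left1; lra.
  - exists (Rabs (Im z)). split. apply Rabs_pos_lt; auto. intros k.
    pose proof (im_le_Cmod (RtoC (IZR k) - z)) as I1. replace (Im (RtoC (IZR k) - z)) with (- Im z)%R in I1 by (unfold Im; simpl; ring).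
    rewrite Rabs_Ropp in I1. auto.
Qed.

(* Coefficients of the primitive of [e^{dY} Y^{-z-1}] obtained by integrating the exponential
   series term by term. *)
Definition prim_coef (d z : C) (j : nat) : C := exp_coef d j / (natC j - z).
Definition exp_rpow_prim (d z : C) (Y : R) : C := rpow Y (- z) * CPSeries (prim_coef d z) Y.

Lemma natC_IZR k : natC k = RtoC (IZR (Z.of_nat k)).
Proof. unfold natC. rewrite INR_IZR_INZ. reflexivity. Qed.

Lemma nonint_sub z j : ~ is_Zint z -> natC j - z <> 0.
Proof. intros H E. apply H. exists (Z.of_nat j). rewrite <- natC_IZR. replace z with (natC j - (natC j - z)) by ring. rewrite E. ring. Qed.

Lemma prim_coef_le d z g j : ~ is_Zint z -> (0 < g)%R -> (forall k : Z, (g <= Cmod (RtoC (IZR k) - z))%R) -> (Cmod (prim_coef d z j) <= exp_coefR (Cmod d) j * / g)%R.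
Proof.
  intros H Hg0 Hg. unfold prim_coef. rewrite Cmod_div by (apply nonint_sub; auto). rewrite Cmod_exp_coef. 
  apply Rmult_le_compat_l. apply exp_coefR_pos, Cmod_ge_0. apply Rinv_le_contravar; auto. rewrite natC_IZR. auto.
Qed.

Lemma prim_coef_summable d z r : ~ is_Zint z -> CPS_summable (prim_coef d z) r.
Proof.
  intros H. destruct (nonint_gap z H) as (g & Hg0 & Hg).
  apply (CPS_summable_le _ (fun j => exp_coefR (Cmod d) j * / g)%R). intros n. apply prim_coef_le; auto.
  intros x Hx. exists (exp (Cmod d * x) * / g)%R. eapply is_series_ext; [|apply (is_series_scal_r (/ g)), exp_coefR_series]. intros n. simpl. ring.
Qed.

Lemma prim_coef_is_series d z x : ~ is_Zint z -> is_Cseries (fun n => prim_coef d z n * RtoC (x ^ n)) (CPSeries (prim_coef d z) x).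
Proof. intros. apply (CPSeries_is_series _ (Rabs x + 1)). apply prim_coef_summable; auto. lra. Qed.

Lemma rpow_pred Y a : (0 < Y)%R -> rpow Y a = rpow Y (a - 1) * RtoC Y.
Proof. intros HY. transitivity (rpow Y (a - 1) * rpow Y 1); [|rewrite rpow_1; auto]. rewrite <- rpow_add. f_equal. ring. Qed.

(** Multiplied by [j - z], the coefficients become those of the exponential; so the series [P]
    satisfies [Y P' - z P = e^{dY}]. *)
Lemma is_Cderive_exp_rpow_prim d z Y : ~ is_Zint z -> (0 < Y)%R -> is_Cderive (exp_rpow_prim d z) Y (Cexp (d * RtoC Y) * rpow Y (- z - 1)).
Proof.
  intros H HY. eapply is_Cderive_eq. apply is_Cderive_mult. apply is_Cderive_rpow; auto.
  apply (is_Cderive_CPSeries _ (Rabs Y + 1)). apply prim_coef_summable; auto. lra.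
  assert (E : RtoC Y * CPSeries (CPS_derive (prim_coef d z)) Y - z * CPSeries (prim_coef d z) Y = Cexp (d * RtoC Y)).
  { rewrite <- CPSeries_exp_coef.
    pose proof (CPS_derive_series (prim_coef d z) (Rabs Y + 1) Y (prim_coef_summable d z _ H) ltac:(lra)) as S1.
    assert (S3 : is_Cseries (fun n => natC n * prim_coef d z n * RtoC (Y ^ n)) (natC 0 * prim_coef d z 0 * RtoC (Y ^ 0) + RtoC Y * CPSeries (CPS_derive (prim_coef d z)) Y)).
    { apply (is_Cseries_shift (fun n => natC n * prim_coef d z n * RtoC (Y ^ n))).
      apply (is_Cseries_ext (fun n => RtoC Y * (CPS_derive (prim_coef d z) n * RtoC (Y ^ n)))).
      intros n. unfold CPS_derive. simpl pow. rewrite RtoC_mult. ring. apply is_Cseries_scal; auto. }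
    pose proof (is_Cseries_plus _ _ _ _ S3 (is_Cseries_scal (- z) _ _ (prim_coef_is_series d z Y H))) as S4.
    pose proof (exp_coef_is_series d Y) as S5.
    transitivity (natC 0 * prim_coef d z 0 * RtoC (Y ^ 0) + RtoC Y * CPSeries (CPS_derive (prim_coef d z)) Y + - z * CPSeries (prim_coef d z) Y).
    unfold natC; simpl; ring.
    apply (is_Clim_unique _ _ _ S4). eapply is_Cseries_ext; [|exact S5]. intros n. unfold prim_coef. pose proof (nonint_sub z n H). field; auto. }
  rewrite <- E, (rpow_pred Y (- z)) by auto. ring.
Qed.

(** Integration by parts for these particular primitives. It is verified on coefficients, so that no
    constant of integration is left undetermined. *)
Lemma exp_rpow_prim_rec d z Y : ~ is_Zint z -> (0 < Y)%R -> - (z + 1) * exp_rpow_prim d (z + 1) Y = Cexp (d * RtoC Y) * rpow Y (- z - 1) - d * exp_rpow_prim d z Y.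
Proof.
  intros H HY. assert (H1 : ~ is_Zint (z + 1)) by (intros K; apply H, is_Zint_S; auto).
  assert (E : - (z + 1) * CPSeries (prim_coef d (z + 1)) Y = Cexp (d * RtoC Y) - d * RtoC Y * CPSeries (prim_coef d z) Y).
  { rewrite <- CPSeries_exp_coef.
    assert (S3 : is_Cseries (fun n => natC n * prim_coef d (z + 1) n * RtoC (Y ^ n)) (natC 0 * prim_coef d (z + 1) 0 * RtoC (Y ^ 0) + d * RtoC Y * CPSeries (prim_coef d z) Y)).
    { apply (is_Cseries_shift (fun n => natC n * prim_coef d (z + 1) n * RtoC (Y ^ n))).
      apply (is_Cseries_ext (fun n => (d * RtoC Y) * (prim_coef d z n * RtoC (Y ^ n)))).
      intros n. unfold prim_coef. simpl pow. rewrite RtoC_mult.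
      replace (natC (S n) * (exp_coef d (S n) / (natC (S n) - (z + 1)))) with ((natC (S n) * exp_coef d (S n)) / (natC (S n) - (z + 1))) by (unfold Cdiv; ring).
      rewrite exp_coef_S. replace (natC (S n) - (z + 1)) with (natC n - z) by (rewrite natC_S; ring). unfold Cdiv; ring.
      apply is_Cseries_scal. apply prim_coef_is_series; auto. }
    assert (S4 : is_Cseries (fun n => exp_coef d n * RtoC (Y ^ n)) (natC 0 * prim_coef d (z + 1) 0 * RtoC (Y ^ 0) + d * RtoC Y * CPSeries (prim_coef d z) Y + (- (z + 1)) * CPSeries (prim_coef d (z + 1)) Y)).
    { eapply is_Cseries_ext; [|exact (is_Cseries_plus _ _ _ _ S3 (is_Cseries_scal (- (z + 1)) _ _ (prim_coef_is_series d (z + 1) Y H1)))].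
      intros n. unfold prim_coef. pose proof (nonint_sub (z + 1) n H1). field. auto. }
    rewrite (is_Clim_unique _ _ _ (exp_coef_is_series d Y) S4). unfold natC; simpl. ring. }
  unfold exp_rpow_prim. replace (- (z + 1)) with (- z - 1) at 2 by ring.
  transitivity (rpow Y (- z - 1) * (- (z + 1) * CPSeries (prim_coef d (z + 1)) Y)). ring. rewrite E.
  rewrite (rpow_pred Y (- z)) by auto. ring.
Qed.

Definition lim_oo (F : R -> C) (l : C) : Prop :=
  forall eps, (0 < eps)%R -> exists M, forall q, (M < q)%R -> (0 < q)%R -> (Cmod (F q - l) < eps)%R.

Lemma lim_oo_lin F G H a b l m : lim_oo F l -> lim_oo G m -> (forall t, (0 < t)%R -> H t = a * F t + b * G t) -> lim_oo H (a * l + b * m).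
Proof.
  intros HF HG E eps He. set (A := (Cmod a + Cmod b + 1)%R). pose proof (Cmod_ge_0 a). pose proof (Cmod_ge_0 b).
  assert (Hd : (0 < eps / A)%R) by (unfold A; apply Rdiv_lt_0_compat; lra).
  destruct (HF _ Hd) as [M1 K1]. destruct (HG _ Hd) as [M2 K2]. exists (Rmax M1 M2). intros q Hq Hq0.
  pose proof (Rmax_l M1 M2). pose proof (Rmax_r M1 M2). specialize (K1 q ltac:(lra) Hq0). specialize (K2 q ltac:(lra) Hq0).
  rewrite E by auto. replace (a * F q + b * G q - (a * l + b * m)) with (a * (F q - l) + b * (G q - m)) by ring.
  eapply Rle_lt_trans. apply Cmod_triangle. rewrite !Cmod_mult. set (e := (eps / A)%R) in *.
  assert (Ee : (eps = e * A)%R) by (unfold e, A; field; lra).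
  
  
  rewrite Ee. unfold A. nra.
Qed.

Lemma Cpower_add z a b : Cpower z (a + b) = Cpower z a * Cpower z b.
Proof. unfold Cpower. rewrite <- Cexp_add. f_equal. ring. Qed.
Lemma Cpower_1 (z : C) : z <> 0 -> Cpower z 1 = z.
Proof. intros. unfold Cpower. rewrite Cmult_1_l. apply Cexp_Clog; auto. Qed.

(** For [Re z < 0] the integrand is integrable up to 0, where this primitive vanishes; its limit at
    infinity is therefore the complete integral [Gamma (- z) c^z]. *)
Lemma exp_rpow_prim_lim_base c z : ~ is_Zint z -> (0 < Re c)%R -> (Re z < 0)%R -> lim_oo (exp_rpow_prim (- c) z) (Cpower c z * Gamma (- z)).
Proof.
  intros H Hc Hz. assert (Hz' : (0 < Re (- z))%R) by (rewrite Re_opp; lra).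
  replace (Cpower c z * Gamma (- z)) with (laplace_int (- z) c + 0).
  2:{ rewrite laplace_Gamma by auto. rewrite Gamma_pos by auto. replace (- - z) with z by ring. ring. }
  unfold lim_oo. apply (is_CInt_FTC_limit (exp_rpow_prim (- c) z) (laplace_fun (- z) c) (laplace_int (- z) c) 0).
  - intros t Ht. eapply is_Cderive_eq. apply is_Cderive_exp_rpow_prim; auto. unfold laplace_fun. f_equal. f_equal. ring.
  - apply laplace_fun_cont.
  - apply is_CInt_laplace; auto.
  - intros eps He.
    assert (HB : exists B, (0 < B)%R /\ forall p, (0 < p < 1)%R -> (Cmod (CPSeries (prim_coef (- c) z) p) <= B)%R).
    { destruct (nonint_gap z H) as (g & Hg0 & Hg). exists (exp (Cmod (- c)) * / g)%R.
      split. apply Rmult_lt_0_compat. apply exp_pos. apply Rinv_0_lt_compat; auto.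
      intros p Hp. apply (is_Cseries_Cmod_le _ _ (fun j => exp_coefR (Cmod (- c)) j * 1 ^ j * / g)%R _ (prim_coef_is_series (- c) z p H)).
      - intros n. rewrite Cmod_mult, Cmod_R, Rabs_pos_eq by (apply pow_le; lra).
        apply Rle_trans with (exp_coefR (Cmod (- c)) n * / g * 1)%R; [|rewrite pow1; lra].
        apply Rmult_le_compat. apply Cmod_ge_0. apply pow_le; lra. apply prim_coef_le; auto. rewrite <- (pow1 n). apply pow_incr; lra.
      - replace (exp (Cmod (- c)) * / g)%R with (exp (Cmod (- c) * 1) * / g)%R by (rewrite Rmult_1_r; auto).
        apply (is_series_scal_r (/ g)). apply exp_coefR_series. }
    destruct HB as (B & HB0 & HB).
    assert (He' : (0 < eps / B)%R) by (apply Rdiv_lt_0_compat; lra).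
    (* The limit at 0 is known with an extra factor [e^{-p}], which is at least [e^{-1}] for
       [p < 1]; hence the division by [exp 1]. *)
    destruct (rpow_exp_lim_0 (- z) 1 Hz' ltac:(simpl; lra) (eps / B / exp 1)%R) as (d & Hd & Hdd).
    { apply Rdiv_lt_0_compat; auto. apply exp_pos. }
    exists (Rmin d 1). split. apply Rmin_glb_lt; lra. intros p Hp. pose proof (Rmin_l d 1). pose proof (Rmin_r d 1).
    specialize (Hdd p ltac:(lra)). specialize (HB p ltac:(lra)). rewrite Cmod_mult, Cmod_Cexp_linear in Hdd.
    replace (exp_rpow_prim (- c) z p - 0) with (exp_rpow_prim (- c) z p) by ring. unfold exp_rpow_prim. rewrite Cmod_mult.
    assert (X : (Cmod (rpow p (- z)) < eps / B)%R).
    { assert (E1 : (exp (-1) <= exp (- (Re 1 * p)))%R) by (apply exp_le; simpl; lra).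
      apply Rle_lt_trans with (exp 1 * (exp (- (Re 1 * p)) * Cmod (rpow p (- z))))%R.
      - assert (E2 : (exp 1 * exp (-1) = 1)%R) by (rewrite <- exp_plus; replace (1 + -1)%R with 0%R by ring; apply exp_0).
        pose proof (Cmod_ge_0 (rpow p (- z))). pose proof (exp_pos 1). rewrite <- Rmult_assoc.
        assert (exp 1 * exp (-1) <= exp 1 * exp (- (Re 1 * p)))%R by (apply Rmult_le_compat_l; lra). nra.
      - apply (Rmult_lt_compat_l (exp 1)) in Hdd; [|apply exp_pos].
        replace (exp 1 * (eps / B / exp 1))%R with (eps / B)%R in Hdd by (field; pose proof (exp_pos 1); lra). auto. }
    pose proof (Cmod_ge_0 (rpow p (- z))). 
    apply Rle_lt_trans with (Cmod (rpow p (- z)) * B)%R. apply Rmult_le_compat_l; auto.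
    apply (Rmult_lt_compat_r B) in X; auto. replace (eps / B * B)%R with eps in X by (field; lra). auto.
Qed.

Lemma exp_rpow_prim_lim_S c z : ~ is_Zint z -> (0 < Re c)%R -> lim_oo (exp_rpow_prim (- c) z) (Cpower c z * Gamma (- z)) ->
  lim_oo (exp_rpow_prim (- c) (z + 1)) (Cpower c (z + 1) * Gamma (- (z + 1))).
Proof.
  intros H Hc HL.
  assert (Hz1 : z + 1 <> 0). { intros E. apply H. apply is_Zint_S. exists 0%Z. auto. }
  assert (H1 : ~ is_Zint (- (z + 1))) by (intros K; apply H, is_Zint_S, is_Zint_opp; auto).
  replace (Cpower c (z + 1) * Gamma (- (z + 1))) with ((- / (z + 1)) * 0 + (- (c / (z + 1))) * (Cpower c z * Gamma (- z))).
  2:{ replace (- z) with (- (z + 1) + 1) by ring. rewrite Gamma_rec by (apply nonint_not_pole; auto).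
      rewrite Cpower_add, Cpower_1 by (apply Re_pos_neq_0; auto). field. auto. }
  apply (lim_oo_lin (fun Y => Cexp (- c * RtoC Y) * rpow Y (- z - 1)) (exp_rpow_prim (- c) z)); auto.
  - intros eps He. destruct (rpow_exp_lim_oo (- z - 1) c Hc eps He) as [M HM]. exists M. intros q Hq Hq0.
    replace (Cexp (- c * RtoC q) * rpow q (- z - 1) - 0) with (Cexp (- (c * RtoC q)) * rpow q (- z - 1)).
    apply HM; auto. replace (- c * RtoC q) with (- (c * RtoC q)) by ring. ring.
  - intros t Ht. pose proof (exp_rpow_prim_rec (- c) z t H Ht) as E.
    replace (exp_rpow_prim (- c) (z + 1) t) with ((- (z + 1) * exp_rpow_prim (- c) (z + 1) t) / - (z + 1)) by (field; auto).
    rewrite E. field. auto.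
Qed.

(** Starts at [z - (n + 1)], whose real part is negative, and climbs back by unit steps: a
    continuation in [z] through the recurrences of the primitive and of Gamma. *)
Lemma exp_rpow_prim_lim c z : ~ is_Zint z -> (0 < Re c)%R -> lim_oo (exp_rpow_prim (- c) z) (Cpower c z * Gamma (- z)).
Proof.
  intros H Hc. destruct (nfloor_ex (Rabs (Re z))) as [n Hn]. apply Rabs_pos.
  assert (G : forall k, lim_oo (exp_rpow_prim (- c) (z - natC (S n) + natC k)) (Cpower c (z - natC (S n) + natC k) * Gamma (- (z - natC (S n) + natC k)))).
  { assert (H0 : ~ is_Zint (z - natC (S n))). { intros K. apply H. replace z with (z - natC (S n) + natC (S n)) by ring. apply is_Zint_add_natC; auto. }
    induction k.
    - replace (z - natC (S n) + natC 0) with (z - natC (S n)) by (unfold natC; simpl; ring). apply exp_rpow_prim_lim_base; auto.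
      unfold Cminus. rewrite Re_plus, Re_opp, Re_natC, S_INR. pose proof (Rle_abs (Re z)). lra.
    - rewrite (natC_S k), Cplus_assoc. apply exp_rpow_prim_lim_S; auto. intros K. apply H0, (is_Zint_sub_natC _ k); auto. }
  specialize (G (S n)). replace (z - natC (S n) + natC (S n)) with z in G by ring. auto.
Qed.

(** The integrand [e^{-c w} w^{-z-1}] over [w > 1], moved by [w = 1 + y] to the half-line of
    [is_CInt]. *)
Definition tail_fun (c z : C) (y : R) : C := Cexp (- (c * RtoC (1 + y))) * rpow (1 + y) (- z - 1).

Lemma tail_fun_cont c z : Ccont_pos (tail_fun c z).
Proof.
  apply Ccont_pos_mult; [|apply Ccont_pos_rpow1]. intros t Ht. apply (Ccont_comp (fun t => Cexp (- (c * RtoC t))) (fun t => 1 + t)%R).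
  apply (continuous_plus (V:=R_NormedModule)). apply continuous_const. apply continuous_id. apply Ccont_pos_Cexp_linear. lra.
Qed.

Lemma is_CInt_tail c z : ~ is_Zint z -> (0 < Re c)%R -> is_CInt (tail_fun c z) (Cpower c z * Gamma (- z) - CPSeries (prim_coef (- c) z) 1).
Proof.
  intros H Hc. replace (CPSeries (prim_coef (- c) z) 1) with (exp_rpow_prim (- c) z 1) by (unfold exp_rpow_prim; rewrite rpow_1_l; ring).
  assert (D : forall t, is_derive (fun t => 1 + t)%R t 1%R) by (intros t; auto_derive; auto; ring).
  apply (is_CInt_FTC (fun y => exp_rpow_prim (- c) z (1 + y)%R)).
  - intros t Ht. eapply is_Cderive_eq. eapply (is_Cderive_comp (exp_rpow_prim (- c) z) (fun t => 1 + t)%R). apply is_Cderive_exp_rpow_prim; auto. lra. apply D.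
    unfold tail_fun. replace (- c * RtoC (1 + t)) with (- (c * RtoC (1 + t))) by ring. ring.
  - apply tail_fun_cont.
  - intros eps He.
    assert (Hcon : Ccont (fun y => exp_rpow_prim (- c) z (1 + y)%R) 0%R).
    { eapply is_Cderive_cont. eapply (is_Cderive_comp (exp_rpow_prim (- c) z) (fun t => 1 + t)%R). apply is_Cderive_exp_rpow_prim; auto. lra. apply D. }
    assert (He2 : (0 < eps / 2)%R) by lra.
    destruct (Hcon (ball (M := C_UniformSpace) (exp_rpow_prim (- c) z (1 + 0)%R) (mkposreal _ He2))) as [d Hd].
    { exists (mkposreal _ He2). auto. }
    exists d. split. apply cond_pos. intros p Hp. specialize (Hd p).
    destruct Hd as [B1 B2]. { unfold ball; simpl. unfold AbsRing_ball, abs, minus, plus, opp; simpl. rewrite Ropp_0, Rplus_0_r, Rabs_pos_eq; lra. }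
    rewrite Rplus_0_r in B1, B2. unfold ball in B1, B2; simpl in B1, B2. unfold AbsRing_ball, abs, minus, plus, opp in B1, B2; simpl in B1, B2.
    eapply Rle_lt_trans. apply Cmod_le_sum. unfold Re, Im, Cminus; simpl. lra.
  - intros eps He. destruct (exp_rpow_prim_lim c z H Hc eps He) as [M HM]. exists M. intros q Hq Hq0. apply HM; lra.
Qed.

Lemma rpow_natmul t a i : (0 < t)%R -> rpow t (a - natC i) = rpow t a * RtoC ((/ t) ^ i).
Proof.
  intros Ht. unfold Cminus. rewrite rpow_add. f_equal. rewrite <- rpow_inv_base by auto. apply rpow_natC.
  apply Rinv_0_lt_compat; auto.
Qed.

(** With [w = 1 + y] and [c = u / 2] this is [e^{-u (w + 1/w) / 2} w^{-nu-1}]. *)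
Definition half_K_fun (c nu : C) (y : R) : C := tail_fun c nu y * Cexp (- c * RtoC (/ (1 + y))).

Lemma tail_fun_shift c nu i y : (0 < y)%R -> tail_fun c (nu + natC i) y = tail_fun c nu y * RtoC ((/ (1 + y)) ^ i).
Proof.
  intros Hy. unfold tail_fun. replace (- (nu + natC i) - 1) with ((- nu - 1) - natC i) by ring.
  rewrite rpow_natmul by lra. ring.
Qed.

Lemma continuous_inv_1_plus t : (0 < t)%R -> continuous (fun y => / (1 + y))%R t.
Proof.
  intros Ht. apply (ex_derive_continuous (K:=R_AbsRing) (V:=R_NormedModule)). auto_derive. lra.
Qed.

(** In the expansion of [e^{-c/w}] each power of [1/w] raises the order by one. Since [1/w] stays
    below 1, the majorant series is bounded by [exp (Cmod (- c))] throughout. *)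
Lemma half_K_series c nu (l : nat -> C) : (0 < Re c)%R -> (forall k, is_CInt (tail_fun c (nu + natC k)) (l k)) ->
  exists m, is_CInt (half_K_fun c nu) m /\ is_Cseries (fun k => exp_coef (- c) k * l k) m.
Proof.
  intros Hc Hl.
  destruct (rpow_exp_le_dsat 1 (- Re nu - 1) (Re c) Rlt_0_1 Hc) as (K & HK & HD).
  set (E := exp (Cmod (- c))). pose proof (Cmod_ge_0 (- c)) as Hcm.
  assert (HE : (1 <= E)%R). { rewrite <- exp_0. apply exp_le. auto. }
  assert (HX : forall t, (0 < t)%R -> (0 < / (1 + t) < 1)%R).
  { intros t Ht. split. apply Rinv_0_lt_compat; lra. rewrite <- Rinv_1. apply Rinv_lt_contravar; lra. }
  assert (Hh : forall t, (0 < t)%R -> (Cmod (tail_fun c nu t) <= K * dsat 1 t)%R).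
  { intros t Ht. eapply Rle_trans; [|apply HD; auto]. unfold tail_fun. rewrite Cmod_mult, Cmod_Cexp_linear, Cmod_rpow by lra.
    replace (1 - 1)%R with 0%R by ring. rewrite Rpower_O, Rmult_1_l by auto. rewrite Rmult_comm.
    replace (Re (- nu - 1)) with (- Re nu - 1)%R by reflexivity.
    apply Rmult_le_compat_l. left; apply Rpower_pos. apply exp_le. nra. }
  apply (is_CInt_series_swap (exp_coef (- c)) (exp_coefR (Cmod (- c))) (tail_fun c nu) (fun y => / (1 + y))%R
     (fun y => Cexp (- c * RtoC (/ (1 + y)))) (fun y => exp (Cmod (- c) * / (1 + y))) l 1 (E * K)).
  - lra.
  - apply tail_fun_cont.
  - apply Ccont_pos_Cexp. apply Ccont_pos_scal. intros t Ht. apply Ccont_RtoC. apply continuous_inv_1_plus; auto.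
  - intros; apply continuous_inv_1_plus; auto.
  - intros i. rewrite Cmod_exp_coef. lra.
  - intros t Ht. left; apply HX; auto.
  - intros t Ht. apply exp_coefR_series.
  - intros t Ht. specialize (Hh t Ht). specialize (HX t Ht).
    assert (exp (Cmod (- c) * / (1 + t)) <= E)%R by (apply exp_le; nra).
    pose proof (exp_pos (Cmod (- c) * / (1 + t))). pose proof (Cmod_ge_0 (tail_fun c nu t)).
    rewrite Rmult_assoc, (Rmult_comm (Cmod _)). apply Rmult_le_compat; lra.
  - intros t Ht. specialize (Hh t Ht). eapply Rle_trans. apply Hh. pose proof (dsat_pos 1 t Rlt_0_1).
    apply Rmult_le_compat_r; [lra|]. nra.
  - intros p q Hp. exists 1%R, (exp (Cmod (- c) * 1)). split. intros t Ht. left; apply HX; lra. apply exp_coefR_series.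
  - intros t Ht. rewrite <- CPSeries_exp_coef. apply exp_coef_is_series.
  - intros i. eapply is_CInt_ext; [|apply Hl]. intros t Ht. apply tail_fun_shift; auto.
Qed.

Definition prim_at_1 (c z : C) : C := CPSeries (prim_coef (- c) z) 1.

Lemma prim_at_1_series c z : ~ is_Zint z -> is_Cseries (prim_coef (- c) z) (prim_at_1 c z).
Proof. intros H. eapply is_Cseries_ext; [|apply (prim_coef_is_series (- c) z 1 H)]. intros n. simpl. rewrite pow1. ring. Qed.

Lemma Csum_swap (f : nat -> nat -> C) N M : Csum (fun i => Csum (fun j => f i j) M) N = Csum (fun j => Csum (fun i => f i j) N) M.
Proof.
  induction N; simpl.
  - induction M; simpl; auto. rewrite <- IHM. ring.
  - rewrite IHN. rewrite <- Csum_plus. apply Csum_ext. intros; reflexivity.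
Qed.

Lemma exp_coefR_sum d : is_series (exp_coefR d) (exp d).
Proof. pose proof (exp_coefR_series d 1) as H. rewrite Rmult_1_r in H. eapply is_series_ext; [|exact H]. intros n. simpl. rewrite pow1. ring. Qed.

Lemma nonint_add z n : ~ is_Zint z -> ~ is_Zint (z + natC n).
Proof. intros H K. apply H, (is_Zint_sub_natC z n); auto. Qed.

(** The sum by rows is also the limit over squares, a form that is symmetric in the two indices and
    to which the exchange of indices in [double_sum_opp] applies. The gap between the two is at most
    [exp d] times the tail of the majorant of one row. *)
Lemma double_sum c nu : ~ is_Zint nu -> exists T,
  is_Cseries (fun k => exp_coef (- c) k * prim_at_1 c (nu + natC k)) T /\
  is_Clim (fun N => Csum (fun k => Csum (fun j => exp_coef (- c) k * exp_coef (- c) j / (natC j - natC k - nu)) N) N) T.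
Proof.
  intros H. destruct (nonint_gap nu H) as (g & Hg0 & Hg). set (d := Cmod (- c)). assert (Hd : (0 <= d)%R) by apply Cmod_ge_0.
  assert (Hgk : forall k (j : Z), (g <= Cmod (RtoC (IZR j) - (nu + natC k)))%R).
  { intros k j. replace (RtoC (IZR j) - (nu + natC k)) with (RtoC (IZR (j - Z.of_nat k)) - nu).
    apply Hg. rewrite minus_IZR, <- INR_IZR_INZ, RtoC_minus. unfold natC. ring. }
  assert (Hp : is_series (fun j => exp_coefR d j * / g)%R (exp d * / g)%R) by (apply (is_series_scal_r (/ g)), exp_coefR_sum).
  assert (Hps : forall k, (Cmod (prim_at_1 c (nu + natC k)) <= exp d * / g)%R).
  { intros k. apply (is_Cseries_Cmod_le _ _ (fun j => exp_coefR d j * / g)%R _ (prim_at_1_series c (nu + natC k) (nonint_add _ k H))); auto.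
    intros j. apply prim_coef_le; auto. apply nonint_add; auto. }
  destruct (is_Cseries_abs (fun k => exp_coef (- c) k * prim_at_1 c (nu + natC k)) (fun k => exp_coefR d k * (exp d * / g))%R) as [T HT].
  { intros k. rewrite Cmod_mult, Cmod_exp_coef. apply Rmult_le_compat_l; auto. apply exp_coefR_pos; auto. }
  { eexists. apply (is_series_scal_r (exp d * / g)%R), exp_coefR_sum. }
  exists T. split; auto.
  set (D := fun N => Csum (fun k => Csum (fun j => exp_coef (- c) k * exp_coef (- c) j / (natC j - natC k - nu)) N) N).
  assert (L : is_Clim (fun N => Csum (fun k => exp_coef (- c) k * prim_at_1 c (nu + natC k)) N - D N) 0).
  { apply (is_Clim_le _ _ (fun N => exp d * (exp d * / g - Re (Csum (fun j => RtoC (exp_coefR d j * / g)) N)))%R).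
    - intros N. 
      replace (Csum (fun k => exp_coef (- c) k * prim_at_1 c (nu + natC k)) N - D N - 0) with
        (Csum (fun k => exp_coef (- c) k * (prim_at_1 c (nu + natC k) - Csum (prim_coef (- c) (nu + natC k)) N)) N).
      2:{ unfold D. transitivity (Csum (fun k => exp_coef (- c) k * prim_at_1 c (nu + natC k)) N + Csum (fun k => - (1) * Csum (fun j => exp_coef (- c) k * exp_coef (- c) j / (natC j - natC k - nu)) N) N).
          2: rewrite Csum_scal; ring.
          rewrite <- Csum_plus. apply Csum_ext. intros k Hk.
          replace (Csum (fun j => exp_coef (- c) k * exp_coef (- c) j / (natC j - natC k - nu)) N) with (exp_coef (- c) k * Csum (prim_coef (- c) (nu + natC k)) N). ring.
          rewrite <- Csum_scal. apply Csum_ext. intros j _. unfold prim_coef. replace (natC j - (nu + natC k)) with (natC j - natC k - nu) by ring. unfold Cdiv; ring. }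
      set (tl := (exp d * / g - Re (Csum (fun j => RtoC (exp_coefR d j * / g)) N))%R).
      assert (Ht : forall k, (Cmod (prim_at_1 c (nu + natC k) - Csum (prim_coef (- c) (nu + natC k)) N) <= tl)%R).
      { intros k. apply (is_Cseries_tail_le (prim_coef (- c) (nu + natC k)) _ (fun j => exp_coefR d j * / g)%R); auto. apply prim_at_1_series, nonint_add; auto.
        intros j. apply prim_coef_le; auto. apply nonint_add; auto. }
      assert (Ht0 : (0 <= tl)%R) by (eapply Rle_trans; [apply Cmod_ge_0|apply (Ht O)]).
      eapply Rle_trans. apply (Csum_Cmod _ (fun k => exp_coefR d k * tl)%R).
      + intros k _. rewrite Cmod_mult, Cmod_exp_coef. apply Rmult_le_compat_l. apply exp_coefR_pos; auto. apply Ht.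
      + apply Csum_le_series. intros i. apply Rmult_le_pos; auto. apply exp_coefR_pos; auto. apply (is_series_scal_r tl), exp_coefR_sum.
    - assert (L0 : is_lim_seq (fun N => Re (Csum (fun j => RtoC (exp_coefR d j * / g)) N)) (exp d * / g)%R).
      { apply is_lim_seq_incr_1. apply (is_lim_seq_ext (sum_n (fun j => exp_coefR d j * / g)%R)).
        intros n. rewrite Csum_Re. apply sum_n_ext. reflexivity. exact Hp. }
      replace (Finite 0) with (Rbar_mult (exp d) (Finite (exp d * / g - exp d * / g)%R)) by (simpl; f_equal; ring).
      apply is_lim_seq_scal_l. apply is_lim_seq_minus'. apply is_lim_seq_const. exact L0. }
  pose proof (is_Clim_minus _ _ _ _ HT L) as L2. replace (T - 0) with T in L2 by ring.
  eapply is_Clim_ext; [|exact L2]. intros N. unfold D. ring.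
Qed.

(* Exchanging [j] and [k] changes the sign of [j - k - nu] up to [nu -> -nu]. *)
Lemma double_sum_opp c nu N : ~ is_Zint nu ->
  Csum (fun k => Csum (fun j => exp_coef (- c) k * exp_coef (- c) j / (natC j - natC k - - nu)) N) N =
  - Csum (fun k => Csum (fun j => exp_coef (- c) k * exp_coef (- c) j / (natC j - natC k - nu)) N) N.
Proof.
  intros H. rewrite Csum_swap.
  transitivity (- (1) * Csum (fun k => Csum (fun j => exp_coef (- c) k * exp_coef (- c) j / (natC j - natC k - nu)) N) N). 2: ring.
  rewrite <- Csum_scal. apply Csum_ext. intros k _. rewrite <- Csum_scal. apply Csum_ext. intros j _.
  assert (X : natC j - natC k - nu <> 0).
  { intros E. apply (nonint_add nu k H). exists (Z.of_nat j). rewrite <- natC_IZR.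
    replace (natC j) with (natC j - natC k - nu + (nu + natC k)) by ring. rewrite E. ring. }
  assert (X' : natC k - natC j - - nu <> 0).
  { intros E. apply X. replace (natC j - natC k - nu) with (- (natC k - natC j - - nu)) by ring. rewrite E; ring. }
  field. split; auto.
Qed.

Lemma Cpower_natC (c : C) k : c <> 0 -> Cpower c (natC k) = c ^ k.
Proof.
  intros Hc. induction k. unfold natC, Cpower; simpl. rewrite Cmult_0_l. apply Cexp_0.
  rewrite natC_S, Cpower_add, IHk, Cpower_1 by auto. simpl. ring.
Qed.

Lemma Csin_natC z k : Csin ((z + natC k) * RtoC PI) = (- (1)) ^ k * Csin (z * RtoC PI).
Proof.
  induction k. replace (z + natC 0) with z by (unfold natC; simpl; ring). ring.
  rewrite natC_S, Cplus_assoc, Csin_shift, IHk. simpl. ring.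
Qed.

(** Adding [T] to [m] removes the power series and leaves the Gamma terms. The reflection formula at
    [nu + k] turns [Gamma (- (nu + k))] into the reciprocal of [Gamma (nu + k + 1)], and its sign
    [(-1)^k] cancels that of the exponential coefficient, so the series of I appears. *)
Lemma BesselI_eval nu u : ~ is_Zint nu -> (0 < Re u)%R -> exists m T, is_CInt (half_K_fun (u / 2) nu) m /\
  is_Clim (fun N => Csum (fun k => Csum (fun j => exp_coef (- (u / 2)) k * exp_coef (- (u / 2)) j / (natC j - natC k - nu)) N) N) T /\
  BesselI nu u = - (Csin (nu * RtoC PI) / RtoC PI) * (m + T).
Proof.
  intros H Hu. set (c := u / 2).
  assert (Hc : (0 < Re c)%R). { replace (u / 2) with (RtoC (/ 2) * u) by (rewrite RtoC_inv by lra; field). unfold Re in *; simpl. lra. }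
  assert (Hc0 : c <> 0) by (apply Re_pos_neq_0; auto).
  destruct (half_K_series c nu (fun k => Cpower c (nu + natC k) * Gamma (- (nu + natC k)) - prim_at_1 c (nu + natC k)) Hc) as (m & Hm & Hs).
  { intros k. apply is_CInt_tail; auto. apply nonint_add; auto. }
  destruct (double_sum c nu H) as (T & HT1 & HT2).
  exists m, T. split; auto. split; auto.
  apply is_Cseries_CSeries.
  destruct (reflection_neq_0 nu H) as [_ Sn].
  pose proof (is_Cseries_scal (- (Csin (nu * RtoC PI) / RtoC PI)) _ _ (is_Cseries_plus _ _ _ _ Hs HT1)) as S1.
  eapply is_Cseries_ext; [|exact S1]. intros k. cbv beta.
  pose proof (nonint_add nu k H) as Hk. pose proof (reflection _ Hk) as R1. rewrite Csin_natC in R1.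
  destruct (reflection_neq_0 _ Hk) as [Gn _]. replace (1 + (nu + natC k)) with (natC k + nu + 1) in R1, Gn by ring.
  fold c. replace (2 * natC k + nu) with (natC k + (nu + natC k)) by ring. rewrite (Cpower_add c (natC k) (nu + natC k)), Cpower_natC by auto.
  set (G := Gamma (natC k + nu + 1)) in *. set (P := Cpower c (nu + natC k)). set (s := Csin (nu * RtoC PI)) in *.
  assert (Sg : (- (1)) ^ k * (- (1)) ^ k = RtoC 1). { rewrite <- Cpow_mult_l. replace (- (1) * - (1)) with (RtoC 1) by ring. apply Cpow_1_l. }
  pose proof RtoC_PI_neq_0 as HP. pose proof (fact_neq_0_C k) as HF.
  assert (Ec : (- c) ^ k = (- (1)) ^ k * c ^ k). { rewrite <- Cpow_mult_l. f_equal. ring. }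
  unfold exp_coef. rewrite Ec. set (sg := (- (1)) ^ k) in *. clearbody sg. set (ck := c ^ k). clearbody ck.
  replace (Gamma (- (nu + natC k))) with (- RtoC PI * sg / (G * s)).
  2:{ rewrite <- R1. transitivity (Gamma (- (nu + natC k)) * (sg * sg)). field. auto. rewrite Sg. ring. }
  transitivity ((sg * sg) * (ck * P / (RtoC (INR (fact k)) * G))).
  field. auto. rewrite Sg. ring.
Qed.

Lemma K_nonint_eval nu u : ~ is_Zint nu -> (0 < Re u)%R -> exists m1 m2, is_CInt (half_K_fun (u / 2) nu) m1 /\ is_CInt (half_K_fun (u / 2) (- nu)) m2 /\
  BesselK_nonint nu u = (m1 + m2) / 2.
Proof.
  intros H Hu. assert (H' : ~ is_Zint (- nu)) by (intros K; apply H, is_Zint_opp; auto).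
  destruct (BesselI_eval nu u H Hu) as (m1 & T1 & Hm1 & HT1 & E1).
  destruct (BesselI_eval (- nu) u H' Hu) as (m2 & T2 & Hm2 & HT2 & E2).
  exists m1, m2. split; auto. split; auto.
  assert (ET : T2 = - T1).
  { apply (is_Clim_unique _ _ _ HT2). apply (is_Clim_ext (fun N => - (1) * Csum (fun k => Csum (fun j => exp_coef (- (u / 2)) k * exp_coef (- (u / 2)) j / (natC j - natC k - nu)) N) N)).
    intros N. rewrite double_sum_opp by auto. ring. replace (- T1) with (- (1) * T1) by ring. apply is_Clim_scal; auto. }
  unfold BesselK_nonint. rewrite E1, E2, ET. replace (- nu * RtoC PI) with (- (nu * RtoC PI)) by ring. rewrite Csin_opp.
  destruct (reflection_neq_0 nu H) as [_ Sn]. pose proof RtoC_PI_neq_0. field. split; auto.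
Qed.

(** * The substitution [t = sinh^2 (s/2)] *)

Lemma is_CInt_comp f l (g dg : R -> R) : Ccont_pos f -> is_CInt f l ->
  (forall t, (0 < t)%R -> (0 < g t)%R /\ is_derive g t (dg t) /\ continuous dg t) ->
  (forall eps, (0 < eps)%R -> exists d, (0 < d)%R /\ forall p, (0 < p < d)%R -> (g p < eps)%R) ->
  (forall M, exists M', forall q, (M' < q)%R -> (0 < q)%R -> (M < g q)%R) ->
  is_CInt (fun t => RtoC (dg t) * f (g t)) l.
Proof.
  intros Hf Hl Hg H0 Hoo.
  assert (Hc : Ccont_pos (fun t => RtoC (dg t) * f (g t))).
  { intros t Ht. destruct (Hg t Ht) as (A & B & D). apply Ccont_mult. apply Ccont_RtoC; auto.
    apply (Ccont_comp f g). apply (ex_derive_continuous (K:=R_AbsRing) (V:=R_NormedModule)). eexists; eauto. apply Hf; auto. }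
  apply is_CInt_intro; auto. intros eps He. destruct (is_CInt_elim f l Hf Hl eps He) as (d & M & Hd & HM).
  destruct (H0 d Hd) as (d' & Hd' & Hp'). destruct (Hoo M) as (M' & HM'). exists d', M'. split; auto.
  intros p q Hp Hq Hq0.
  replace (CRInt (fun t => RtoC (dg t) * f (g t)) p q) with (CRInt f (g p) (g q)).
  - apply HM; auto. destruct (Hg p ltac:(lra)) as (A & _). split; auto. apply Hg; auto.
  - unfold CRInt. rewrite <- (RInt_comp (V:=C_RCN) f g dg p q).
    + apply (RInt_ext (V:=C_RCN)). intros t _. apply C_ext; unfold Re, Im, scal; simpl; unfold scal; simpl; unfold mult; simpl; ring.
    + intros t Ht. assert (0 < Rmin p q)%R by (apply Rmin_glb_lt; lra). apply Hf. apply Hg. lra.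
    + intros t Ht. assert (0 < Rmin p q)%R by (apply Rmin_glb_lt; lra). split; apply Hg; lra.
Qed.

(* [wt (sinh^2 (s/2)) = e^s]. *)
Definition wt (t : R) : R := ((sqrt t + sqrt (1 + t)) * (sqrt t + sqrt (1 + t)))%R.

(** With [t = sinh^2 (s/2)] this is [cosh (nu s)] times [ds/dt = 1 / (sinh (s/2) cosh (s/2))]. *)
Definition K_kernel (nu : C) (t : R) : C := RtoC (/ (sqrt t * sqrt (1 + t))) * ((rpow (wt t) nu + rpow (wt t) (- nu)) / 2).

Lemma sqrt_facts t : (0 < t)%R -> (0 < sqrt t)%R /\ (0 < sqrt (1 + t))%R /\ (sqrt t * sqrt t = t)%R /\ (sqrt (1 + t) * sqrt (1 + t) = 1 + t)%R.
Proof. intros Ht. repeat split. apply sqrt_lt_R0; auto. apply sqrt_lt_R0; lra. apply sqrt_sqrt; lra. apply sqrt_sqrt; lra. Qed.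

Lemma wt_bounds t : (0 < t)%R -> (1 < wt t)%R /\ (t < wt t - 1 <= 4 * t + 4 * sqrt t)%R /\ (wt t <= 4 * (1 + t))%R /\ (wt t + / wt t = 2 + 4 * t)%R.
Proof.
  intros Ht. destruct (sqrt_facts t Ht) as (A & B & Sa & Sb). unfold wt. set (a := sqrt t) in *. set (b := sqrt (1 + t)) in *.
  
  
  repeat split; try nra.
  (* As [b^2 - a^2 = 1], the inverse of [a + b] is [b - a]. *)
  replace (/ ((a + b) * (a + b)))%R with ((b - a) * (b - a))%R. nra.
  assert (E : ((b - a) * (a + b) = 1)%R) by nra.
  apply Rmult_eq_reg_r with ((a + b) * (a + b))%R. 2: nra. rewrite Rinv_l by nra.
  replace ((b - a) * (b - a) * ((a + b) * (a + b)))%R with (((b - a) * (a + b)) * ((b - a) * (a + b)))%R by ring. rewrite E; ring.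
Qed.

Lemma is_derive_sqrt_sum t : (0 < t)%R -> is_derive (fun t => sqrt t + sqrt (1 + t))%R t (/ (2 * sqrt t) + / (2 * sqrt (1 + t)))%R.
Proof. intros Ht. destruct (sqrt_facts t Ht) as (A & B & _). auto_derive. repeat split; lra. field. lra. Qed.

Lemma is_derive_wt t : (0 < t)%R -> is_derive (fun t => wt t - 1)%R t (wt t / (sqrt t * sqrt (1 + t)))%R.
Proof.
  intros Ht. destruct (sqrt_facts t Ht) as (A & B & Sa & Sb). unfold wt.
  pose proof (is_derive_sqrt_sum t Ht) as D. pose proof (Derive.is_derive_mult _ _ _ _ _ D D) as D2.
  pose proof (is_derive_minus (V:=R_NormedModule) _ (fun _ => 1%R) t _ _ D2 (is_derive_const 1%R t)) as D3.
  eapply is_derive_val. exact D3. unfold minus, plus, opp, zero; simpl. field. lra.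
Qed.

Lemma continuous_inv_sqrt_mult t : (0 < t)%R -> continuous (fun t => / (sqrt t * sqrt (1 + t)))%R t.
Proof.
  intros Ht. destruct (sqrt_facts t Ht) as (A & B & _).
  apply (ex_derive_continuous (K:=R_AbsRing) (V:=R_NormedModule)). auto_derive. repeat split; try lra. nra.
Qed.

Lemma continuous_wt t : (0 < t)%R -> continuous wt t.
Proof.
  intros Ht. apply (continuous_ext (fun t => ((wt t - 1) + 1)%R)). intros s; simpl; ring.
  apply (continuous_plus (V:=R_NormedModule) (fun t => (wt t - 1)%R) (fun _ => 1%R)). 2: apply continuous_const.
  apply (ex_derive_continuous (K:=R_AbsRing) (V:=R_NormedModule)). eexists. apply is_derive_wt; auto.
Qed.

Lemma K_kernel_cont nu : Ccont_pos (K_kernel nu).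
Proof.
  intros t Ht. destruct (wt_bounds t Ht) as (W & _). apply Ccont_mult. apply Ccont_RtoC, continuous_inv_sqrt_mult; auto.
  apply Ccont_mult; [|apply Ccont_const]. apply Ccont_plus; apply (Ccont_comp (fun s => rpow s _)); try (apply continuous_wt; auto); apply Ccont_rpow; lra.
Qed.

(** Since [1 + 2 t = cosh s], this is the classical integrand [e^{-u cosh s} cosh (nu s)] of K in
    the variable [t]. *)
Definition K_fun (nu u : C) (t : R) : C := Cexp (- (u * RtoC (1 + 2 * t))) * K_kernel nu t.

Lemma half_K_fun_cont c nu : Ccont_pos (half_K_fun c nu).
Proof.
  apply Ccont_pos_mult. apply tail_fun_cont. apply Ccont_pos_Cexp. apply Ccont_pos_scal. intros t Ht. apply Ccont_RtoC. apply continuous_inv_1_plus; auto.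
Qed.

Lemma K_fun_cont nu u : Ccont_pos (K_fun nu u).
Proof.
  apply Ccont_pos_mult; [|apply K_kernel_cont]. apply Ccont_pos_Cexp. intros t Ht. apply Ccont_opp. apply Ccont_mult. apply Ccont_const.
  apply Ccont_RtoC. apply (ex_derive_continuous (K:=R_AbsRing) (V:=R_NormedModule)). auto_derive. auto.
Qed.

(** Half the sum of the integrals for [nu] and [- nu], with [y = wt t - 1]: the factor [wt t] of the
    derivative cancels the extra [w^-1] of the integrand, and [wt t + 1 / wt t = 2 + 4 t] gives the
    exponent. *)
Lemma K_nonint_int nu u : ~ is_Zint nu -> (0 < Re u)%R -> is_CInt (K_fun nu u) (BesselK_nonint nu u).
Proof.
  intros H Hu. destruct (K_nonint_eval nu u H Hu) as (m1 & m2 & H1 & H2 & E).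
  rewrite E. replace ((m1 + m2) / 2) with (/ 2 * (m1 + m2)) by field.
  set (f := fun y => / 2 * (half_K_fun (u / 2) nu y + half_K_fun (u / 2) (- nu) y)).
  assert (Hf : Ccont_pos f) by (apply Ccont_pos_scal, Ccont_pos_plus; apply half_K_fun_cont).
  assert (Hfi : is_CInt f (/ 2 * (m1 + m2))).
  { apply (is_CInt_scal (/ 2) (fun y => half_K_fun (u / 2) nu y + half_K_fun (u / 2) (- nu) y)). apply Ccont_pos_plus; apply half_K_fun_cont. apply is_CInt_plus; auto. }
  eapply is_CInt_ext; [|apply (is_CInt_comp f _ (fun t => wt t - 1)%R (fun t => wt t / (sqrt t * sqrt (1 + t)))%R Hf Hfi)].
  - intros t Ht. destruct (wt_bounds t Ht) as (W1 & _ & _ & W4). destruct (sqrt_facts t Ht) as (A & B & _).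
    unfold f, half_K_fun, tail_fun, K_fun, K_kernel. replace (1 + (wt t - 1))%R with (wt t) by ring.
    replace (rpow (wt t) (- nu - 1)) with (rpow (wt t) (- nu) * / RtoC (wt t)).
    2:{ unfold Cminus. rewrite (rpow_add _ (- nu)), (rpow_opp _ 1), rpow_1 by lra. reflexivity. }
    replace (rpow (wt t) (- - nu - 1)) with (rpow (wt t) nu * / RtoC (wt t)).
    2:{ replace (- - nu) with nu by ring. unfold Cminus. rewrite (rpow_add _ nu), (rpow_opp _ 1), rpow_1 by lra. reflexivity. }
    replace (Cexp (- (u * RtoC (1 + 2 * t)))) with (Cexp (- (u / 2 * RtoC (wt t))) * Cexp (- (u / 2) * RtoC (/ wt t))).
    2:{ rewrite <- Cexp_add. f_equal. transitivity (- (u / 2) * RtoC (wt t + / wt t)). rewrite RtoC_plus; ring.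
        rewrite W4. replace (2 + 4 * t)%R with (2 * (1 + 2 * t))%R by ring. rewrite RtoC_mult. field. }
    unfold Rdiv. rewrite RtoC_mult. assert (RtoC (wt t) <> 0) by (apply RtoC_neq_0; lra). field. auto.
  - intros t Ht. destruct (wt_bounds t Ht) as (W1 & _). split; [lra|]. split. apply is_derive_wt; auto.
    apply (continuous_mult (K:=R_AbsRing) wt (fun t => / (sqrt t * sqrt (1 + t)))%R). apply continuous_wt; auto. apply continuous_inv_sqrt_mult; auto.
  (* The bound [wt p - 1 <= 4 p + 4 sqrt p] asks for [p] and [sqrt p] below [eps / 8]. *)
  - intros eps He. exists (Rmin (eps / 8) ((eps / 8) * (eps / 8))). split. apply Rmin_glb_lt; nra.
    intros p Hp. pose proof (Rmin_l (eps / 8) ((eps / 8) * (eps / 8))). pose proof (Rmin_r (eps / 8) ((eps / 8) * (eps / 8))).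
    destruct (wt_bounds p ltac:(lra)) as (_ & W & _).
    assert (sqrt p < eps / 8)%R. { rewrite <- (sqrt_square (eps / 8)) by lra. apply sqrt_lt_1; nra. } lra.
  - intros M. exists M. intros q Hq Hq0. destruct (wt_bounds q Hq0) as (_ & W & _). lra.
Qed.

(** * Kummer's and Euler's transformations *)

(** The second exponent is a free parameter [r] in place of [b - a - 1]: in these terms Kummer's
    transformation simply exchanges [a] and [- r]. *)
Definition tricomi_fun (a r z : C) (t : R) : C := Cexp (- (z * RtoC t)) * rpow t (a - 1) * rpow (1 + t) r.
Definition tricomi_int (a r z : C) : C := Cint_0_oo (tricomi_fun a r z).

Lemma tricomi_fun_cont a r z : Ccont_pos (tricomi_fun a r z).
Proof. apply Ccont_pos_mult. apply Ccont_pos_mult. apply Ccont_pos_Cexp_linear. apply Ccont_pos_rpow. apply Ccont_pos_rpow1. Qed.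

Lemma Cmod_tricomi_fun a r z t : (0 < t)%R -> Cmod (tricomi_fun a r z t) = (Rpower t (Re a - 1) * Rpower (1 + t) (Re r) * exp (- (Re z * t)))%R.
Proof. intros Ht. unfold tricomi_fun. rewrite !Cmod_mult, Cmod_Cexp_linear, !Cmod_rpow by lra. replace (Re (a - 1)) with (Re a - 1)%R by reflexivity. ring. Qed.

Lemma is_CInt_tricomi a r z : (0 < Re a)%R -> (0 < Re z)%R -> is_CInt (tricomi_fun a r z) (tricomi_int a r z).
Proof.
  intros Ha Hz. destruct (rpow_exp_le_dsat (Re a) (Re r) (Re z) Ha Hz) as (K & HK & HD).
  destruct (dominated_ex_CInt (tricomi_fun a r z) (Re a) K) as [l Hl]; auto. apply tricomi_fun_cont.
  intros t Ht. rewrite Cmod_tricomi_fun by auto. auto.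
  unfold tricomi_int. rewrite (is_CInt_Cint _ _ Hl). auto.
Qed.

(** A positive factor does not change the argument, so no branch correction arises. *)
Lemma Cpower_scale (z : C) (r : R) (a : C) : z <> 0 -> (0 < r)%R -> Cpower (z * RtoC r) a = Cpower z a * rpow r a.
Proof.
  intros Hz Hr. unfold Cpower, rpow. rewrite <- Cexp_add. f_equal.
  assert (E : Clog (z * RtoC r) = Clog z + RtoC (ln r)).
  { assert (Hm : (0 < Cmod z)%R) by (apply (proj1 (Cmod_gt_0 z)); auto).
    assert (Em : Cmod (z * RtoC r) = (Cmod z * r)%R) by (rewrite Cmod_mult, Cmod_R, Rabs_pos_eq; lra).
    assert (Er : (Re (z * RtoC r) = Re z * r)%R) by (unfold Re; simpl; ring).
    assert (Ei : (Im (z * RtoC r) = Im z * r)%R) by (unfold Im; simpl; ring).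
    apply C_ext; unfold Clog; simpl.
    - rewrite Em, ln_mult; auto.
    - unfold Carg. rewrite Em, Er, Ei. replace (Re z * r / (Cmod z * r))%R with (Re z / Cmod z)%R by (field; lra).
      destruct (Rle_dec 0 (Im z * r)), (Rle_dec 0 (Im z)); try lra; exfalso; nra. }
  rewrite E. ring.
Qed.

(** As [t + s + t s = t + (1 + t) s], the integral in [s] is a Laplace integral with parameter
    [z (1 + t)]. *)
Lemma kummer_inner a q z t : (0 < Re q)%R -> (0 < Re z)%R -> (0 < t)%R ->
  is_CInt (fun s => Cexp (- (z * RtoC (t + s + t * s))) * rpow t (a - 1) * rpow s (q - 1))
       (Gamma_Euler q * Cpower z (- q) * tricomi_fun a (- q) z t).
Proof.
  intros Hq Hz Ht.
  assert (Hz1 : (0 < Re (z * RtoC (1 + t)))%R). { replace (Re (z * RtoC (1 + t))) with (Re z * (1 + t))%R by (unfold Re; simpl; ring). nra. }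
  pose proof (is_CInt_scal (Cexp (- (z * RtoC t)) * rpow t (a - 1)) _ _ (laplace_fun_cont q (z * RtoC (1 + t))) (is_CInt_laplace q _ Hq Hz1)) as H.
  rewrite laplace_Gamma, Cpower_scale in H by (auto; try lra; apply Re_pos_neq_0; auto).
  replace (Gamma_Euler q * Cpower z (- q) * tricomi_fun a (- q) z t) with
    (Cexp (- (z * RtoC t)) * rpow t (a - 1) * (Gamma_Euler q * (Cpower z (- q) * rpow (1 + t) (- q)))) by (unfold tricomi_fun; ring).
  eapply is_CInt_ext; [|exact H]. intros s Hs. unfold laplace_fun. 
  replace (- (z * RtoC (t + s + t * s))) with (- (z * RtoC t) + - (z * RtoC (1 + t) * RtoC s)) by (rewrite !RtoC_plus, RtoC_mult; ring).
  rewrite Cexp_add. ring.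
Qed.

(** The double integrand [e^{-z (t + s + t s)} t^{a-1} s^{q-1}] is unchanged when the pairs [t, a]
    and [s, q] are exchanged; the two orders of integration give the two sides. *)
Lemma kummer a q z : (0 < Re a)%R -> (0 < Re q)%R -> (0 < Re z)%R ->
  Gamma_Euler q * Cpower z (- q) * tricomi_int a (- q) z = Gamma_Euler a * Cpower z (- a) * tricomi_int q (- a) z.
Proof.
  intros Ha Hq Hz. set (f := fun t s : R => Cexp (- (z * RtoC (t + s + t * s))) * rpow t (a - 1) * rpow s (q - 1)).
  destruct (rpow_exp_le_dsat (Re a) 0 (Re z) Ha Hz) as (K1 & HK1 & HD1).
  destruct (rpow_exp_le_dsat (Re q) 0 (Re z) Hq Hz) as (K2 & HK2 & HD2).
  apply (is_CInt_fubini f (fun t => Gamma_Euler q * Cpower z (- q) * tricomi_fun a (- q) z t) (fun s => Gamma_Euler a * Cpower z (- a) * tricomi_fun q (- a) z s)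
    _ _ (Re a) (Re q) (K1 * K2)); auto.
  - intros t s Ht Hs. 
    pose proof (continuous_fst (U:=R_UniformSpace) (V:=R_UniformSpace) t s) as C1.
    pose proof (continuous_snd (U:=R_UniformSpace) (V:=R_UniformSpace) t s) as C2.
    apply Ccont_mult. apply Ccont_mult.
    + apply Ccont_Cexp, Ccont_opp. apply Ccont_mult. apply Ccont_const. 
      apply (Ccont_RtoC (T:=prod_UniformSpace R_UniformSpace R_UniformSpace) (fun p : R * R => (fst p + snd p + fst p * snd p)%R)).
      apply (continuous_plus (V:=R_NormedModule) (fun p : R * R => (fst p + snd p)%R) (fun p : R * R => (fst p * snd p)%R)).
      apply (continuous_plus (V:=R_NormedModule) (fun p : R * R => fst p) (fun p : R * R => snd p)); auto.
      apply (continuous_mult (K:=R_AbsRing) (fun p : R * R => fst p) (fun p : R * R => snd p)); auto.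
    + apply (Ccont_comp (T:=prod_UniformSpace R_UniformSpace R_UniformSpace) (fun t => rpow t (a - 1)) (fun p : R * R => fst p)); auto. apply Ccont_rpow; auto.
    + apply (Ccont_comp (T:=prod_UniformSpace R_UniformSpace R_UniformSpace) (fun t => rpow t (q - 1)) (fun p : R * R => snd p)); auto. apply Ccont_rpow; auto.
  - intros t s Ht Hs. unfold f. rewrite !Cmod_mult, Cmod_Cexp_linear, !Cmod_rpow by auto.
    specialize (HD1 t Ht). specialize (HD2 s Hs). rewrite Rpower_O, Rmult_1_r in HD1, HD2 by lra.
    apply Rle_trans with ((Rpower t (Re a - 1) * exp (- (Re z * t))) * (Rpower s (Re q - 1) * exp (- (Re z * s))))%R.
    2:{ replace (K1 * K2 * dsat (Re a) t * dsat (Re q) s)%R with ((K1 * dsat (Re a) t) * (K2 * dsat (Re q) s))%R by ring.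
        apply Rmult_le_compat; auto; apply Rmult_le_pos; left; try apply Rpower_pos; apply exp_pos. }
    replace (Re (a - 1)) with (Re a - 1)%R by reflexivity. replace (Re (q - 1)) with (Re q - 1)%R by reflexivity.
    replace (Rpower t (Re a - 1) * exp (- (Re z * t)) * (Rpower s (Re q - 1) * exp (- (Re z * s))))%R
      with (exp (- (Re z * t) + - (Re z * s)) * Rpower t (Re a - 1) * Rpower s (Re q - 1))%R by (rewrite exp_plus; ring).
    apply Rmult_le_compat_r. left; apply Rpower_pos. apply Rmult_le_compat_r. left; apply Rpower_pos.
    (* The factor [e^{- t s Re z}], at most 1, is dropped, which separates the variables. *)
    apply exp_le. assert (0 < t * s)%R by nra. nra.
  - apply Ccont_pos_scal, tricomi_fun_cont.
  - intros t Ht. apply kummer_inner; auto.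
  - apply is_CInt_scal. apply tricomi_fun_cont. apply is_CInt_tricomi; auto.
  - apply Ccont_pos_scal, tricomi_fun_cont.
  - intros s Hs. eapply is_CInt_ext; [|apply (kummer_inner q a z s); auto].
    intros t Ht. unfold f. replace (s + t + s * t)%R with (t + s + t * s)%R by ring. ring.
  - apply is_CInt_scal. apply tricomi_fun_cont. apply is_CInt_tricomi; auto.
Qed.

(** The factor by which the integrand changes when [a] is raised and [r] lowered by one; it is the
    variable of all hypergeometric series below. *)
Definition tfrac (t : R) : R := (t / (1 + t))%R.

Lemma tfrac_bounds t : (0 < t)%R -> (0 < tfrac t < 1)%R /\ (1 - tfrac t = / (1 + t))%R.
Proof.
  intros Ht. assert (E : (1 - tfrac t = / (1 + t))%R) by (unfold tfrac; field; lra).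
  assert (0 < / (1 + t))%R by (apply Rinv_0_lt_compat; lra).
  assert (0 < tfrac t)%R by (unfold tfrac; apply Rdiv_lt_0_compat; lra). split; auto. lra.
Qed.

Lemma tfrac_cont t : (0 < t)%R -> continuous tfrac t.
Proof. intros Ht. apply (ex_derive_continuous (K:=R_AbsRing) (V:=R_NormedModule)). unfold tfrac. auto_derive. lra. Qed.

Lemma tricomi_fun_shift a r z i t : (0 < t)%R -> tricomi_fun (a + natC i) (r - natC i) z t = tricomi_fun a r z t * RtoC (tfrac t ^ i).
Proof.
  intros Ht. unfold tricomi_fun. replace (a + natC i - 1) with (a - 1 + natC i) by ring. rewrite rpow_add, rpow_natC, rpow_natmul by lra.
  unfold tfrac, Rdiv. rewrite Rpow_mult_distr, RtoC_mult. ring.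
Qed.

Lemma tfrac_mono p t q : (0 < p)%R -> (p <= t <= q)%R -> (tfrac t <= tfrac q)%R.
Proof.
  intros Hp Ht. destruct (tfrac_bounds t ltac:(lra)) as [_ E1]. destruct (tfrac_bounds q ltac:(lra)) as [_ E2].
  assert (/ (1 + q) <= / (1 + t))%R by (apply Rinv_le_contravar; lra). lra.
Qed.

(** The binomial majorant sums to [(1 - tfrac t)^(-P) = (1 + t)^P], a polynomial growth that the
    exponential absorbs. *)
Lemma tricomi_series_swap (q : nat -> C) P a r z : (0 < P)%R -> (forall i, (Cmod (q i) <= binom_coefR P i)%R) -> (0 < Re a)%R -> (0 < Re z)%R ->
  exists m, is_CInt (fun t => tricomi_fun a r z t * CPSeries q (tfrac t)) m /\ is_Cseries (fun i => q i * tricomi_int (a + natC i) (r - natC i) z) m.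
Proof.
  intros HP Hq Ha Hz.
  assert (Hcps : CPS_summable q 1). { apply (CPS_summable_le _ (binom_coefR P)); auto. intros x Hx. apply ex_series_binom_coefR; auto. }
  assert (Hxa : forall t, (0 < t)%R -> (Rabs (tfrac t) < 1)%R). { intros t Ht. destruct (tfrac_bounds t Ht). apply Rabs_def1; lra. }
  destruct (rpow_exp_le_dsat (Re a) (Re r + P) (Re z) Ha Hz) as (K & HK & HD).
  assert (HS : forall t, (0 < t)%R -> Rpower (1 - tfrac t) (- P) = Rpower (1 + t) P).
  { intros t Ht. destruct (tfrac_bounds t Ht) as [_ E]. rewrite E. unfold Rpower. rewrite ln_Rinv by lra. f_equal. ring. }
  assert (Hh : forall t, (0 < t)%R -> (Cmod (tricomi_fun a r z t) * Rpower (1 - tfrac t) (- P) <= K * dsat (Re a) t)%R).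
  { intros t Ht. rewrite HS by auto. eapply Rle_trans; [|apply HD; auto]. rewrite Cmod_tricomi_fun, Rpower_plus by auto. right. ring. }
  apply (is_CInt_series_swap q (binom_coefR P) (tricomi_fun a r z) tfrac (fun t => CPSeries q (tfrac t)) (fun t => Rpower (1 - tfrac t) (- P)) _ (Re a) K); auto.
  - apply tricomi_fun_cont.
  - intros t Ht. apply (Ccont_comp (CPSeries q) tfrac). apply tfrac_cont; auto. apply (Ccont_CPSeries _ 1); auto.
  - intros t Ht. apply tfrac_cont; auto.
  - intros t Ht. left; apply tfrac_bounds; auto.
  - intros t Ht. apply binomial_series_R; auto.
  - intros t Ht. eapply Rle_trans; [|apply Hh; auto]. rewrite HS by auto.
    assert (1 <= Rpower (1 + t) P)%R. { apply Rle_trans with (Rpower (1 + t) 0). rewrite Rpower_O; lra. apply Rle_Rpower; lra. }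
    pose proof (Cmod_ge_0 (tricomi_fun a r z t)). nra.
  - intros p q0 Hp. exists (tfrac q0), (Rpower (1 - tfrac q0) (- P)). split. intros t Ht. apply (tfrac_mono p); auto; lra. apply binomial_series_R. apply Hxa; lra.
  - intros t Ht. apply (CPSeries_is_series _ 1); auto.
  - intros i. eapply is_CInt_ext; [|apply (is_CInt_tricomi (a + natC i) (r - natC i) z)]; auto.
    intros t Ht. apply tricomi_fun_shift; auto. rewrite Re_plus, Re_natC. pose proof (pos_INR i). lra.
Qed.

Lemma rpow_tfrac t a : (0 < t)%R -> rpow (1 - tfrac t) a = rpow (1 + t) (- a).
Proof. intros Ht. destruct (tfrac_bounds t Ht) as [_ E]. rewrite E. apply rpow_inv_base. lra. Qed.

(** Since [Gamma(c + i) = (c)_i Gamma(c)], the integral of this function is [Gamma(c) S(c)], with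
    [J] and [S] as in the overview. *)
Definition hyp_fun (c : R) (nu z : C) (t : R) : C :=
  tricomi_fun (RtoC c) (nu - 1 / 2) z t * CPSeries (hyp_coef (RtoC c - 1 / 2 - nu) (1 / 2 - nu) c) (tfrac t).

Lemma is_CInt_hyp_series c nu z : (0 < c)%R -> (0 < Re z)%R ->
  exists m, is_CInt (hyp_fun c nu z) m /\
   is_Cseries (fun i => hyp_coef (RtoC c - 1 / 2 - nu) (1 / 2 - nu) c i * tricomi_int (RtoC c + natC i) (nu - 1 / 2 - natC i) z) m.
Proof.
  intros Hc Hz. apply (tricomi_series_swap _ (hyp_maj (RtoC c - 1 / 2 - nu) (1 / 2 - nu) c)); auto.
  pose proof (hyp_maj_ge_1 (RtoC c - 1 / 2 - nu) (1 / 2 - nu) c Hc). lra. intros; apply hyp_coef_le; auto.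
Qed.

Lemma Cpower_opp z a : Cpower z (- a) = / Cpower z a.
Proof. unfold Cpower. rewrite <- Cexp_inv. f_equal. ring. Qed.

Lemma Cpower_neq_0 z a : Cpower z a <> 0.
Proof. apply Cexp_neq_0. Qed.

(** With [q = 1/2 - nu], Kummer's transformation sends [J(c+i, -(q+i))] to [J(q+i, -(c+i))]. The
    Gamma quotients cancel [(q)_i] and [(c)_i], so that the coefficients [(A)_i / i!] of a binomial
    series remain. Its sum is [(1 + t)^A], and the exponent [A - c = q - 1] of [1 + t] no longer
    contains [c]. *)
Lemma hyp_fun_kummer c nu z m : (0 < c)%R -> (0 < Re z)%R -> (0 < Re (1 / 2 - nu))%R -> is_CInt (hyp_fun c nu z) m ->
  Gamma_Euler (1 / 2 - nu) * Cpower z (RtoC c) * m = Gamma_Euler (RtoC c) * Cpower z (1 / 2 - nu) * tricomi_int (1 / 2 - nu) (1 / 2 - nu - 1) z.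
Proof.
  intros Hc Hz Hq Hm. destruct (is_CInt_hyp_series c nu z Hc Hz) as (m' & Hm' & Hs).
  rewrite <- (is_CInt_unique _ _ _ Hm Hm') in Hs. 
  set (q := 1 / 2 - nu) in *. set (A := RtoC c - 1 / 2 - nu) in *.
  assert (HP : (0 < Cmod A + 1)%R) by (pose proof (Cmod_ge_0 A); lra).
  destruct (tricomi_series_swap (binom_coef A) (Cmod A + 1) q (- RtoC c) z HP) as (k & Hk & Hks); auto.
  { intros i. apply binom_coef_le; auto. lra. }
  assert (Ek : k = tricomi_int q (q - 1) z).
  { symmetry. apply is_CInt_Cint. eapply is_CInt_ext; [|exact Hk]. intros t Ht. cbv beta.
    destruct (tfrac_bounds t Ht) as [X _]. rewrite binomial_series by (apply Rabs_def1; lra). rewrite rpow_tfrac by auto.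
    unfold tricomi_fun. rewrite <- !Cmult_assoc, <- rpow_add. do 3 f_equal. unfold q, A. field. }
  rewrite <- Ek. 
  assert (S1 : is_Cseries (fun i => hyp_coef A q c i * tricomi_int (RtoC c + natC i) (nu - 1 / 2 - natC i) z)
                (Gamma_Euler (RtoC c) / Gamma_Euler q * (Cpower z q / Cpower z (RtoC c)) * k)).
  { eapply is_Cseries_ext; [|apply (is_Cseries_scal (Gamma_Euler (RtoC c) / Gamma_Euler q * (Cpower z q / Cpower z (RtoC c)))); exact Hks].
    intros i. cbv beta.
    assert (Ha' : (0 < Re (RtoC c + natC i))%R) by (rewrite Re_plus, Re_natC; simpl Re; pose proof (pos_INR i); lra).
    assert (Hq' : (0 < Re (q + natC i))%R) by (rewrite Re_plus, Re_natC; pose proof (pos_INR i); lra).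
    pose proof (kummer (RtoC c + natC i) (q + natC i) z Ha' Hq' Hz) as KM.
    replace (nu - 1 / 2 - natC i) with (- (q + natC i)) by (unfold q; ring).
    replace (- RtoC c - natC i) with (- (RtoC c + natC i)) by ring.
    rewrite !Gamma_Euler_poch in KM by (auto; simpl; lra). rewrite !Cpower_opp, !Cpower_add in KM.
    unfold binom_coef, hyp_coef. rewrite Cpoch_RtoC in KM.
    set (L1 := tricomi_int (RtoC c + natC i) (- (q + natC i)) z) in *. set (L2 := tricomi_int (q + natC i) (- (RtoC c + natC i)) z) in *.
    assert (N1 : Cpochhammer q i <> 0). { apply Cpoch_neq_0. intros j _. apply not_pole_Re_pos; auto. }
    assert (N2 : RtoC (Rpoch c i) <> 0) by (apply RtoC_neq_0; pose proof (Rpoch_pos c i Hc); lra).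
    assert (N3 : Gamma_Euler q <> 0) by (apply Gamma_Euler_neq_0; auto).
    pose proof (fact_neq_0_C i). pose proof (Cpower_neq_0 z q). pose proof (Cpower_neq_0 z (RtoC c)). pose proof (Cpower_neq_0 z (natC i)).
    assert (E2 : L2 * Gamma_Euler (RtoC c) = (Cpochhammer q i * Gamma_Euler q * / (Cpower z q * Cpower z (natC i)) * L1) * (Cpower z (RtoC c) * Cpower z (natC i)) / RtoC (Rpoch c i)).
    { rewrite KM. field. auto. }
    transitivity (/ Gamma_Euler q * (Cpower z q / Cpower z (RtoC c)) * (Cpochhammer A i / RtoC (INR (fact i))) * (L2 * Gamma_Euler (RtoC c))).
    field. auto. rewrite E2. field. repeat split; auto. }
  rewrite (is_Clim_unique _ _ _ Hs S1).
  pose proof (Cpower_neq_0 z (RtoC c)). assert (N3 : Gamma_Euler q <> 0) by (apply Gamma_Euler_neq_0; auto).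
  field. auto.
Qed.

Lemma hyp_fun_c_indep c c' nu z m m' : (0 < c)%R -> (0 < c')%R -> (0 < Re z)%R -> (0 < Re (1 / 2 - nu))%R ->
  is_CInt (hyp_fun c nu z) m -> is_CInt (hyp_fun c' nu z) m' ->
  Gamma_Euler (RtoC c') * Cpower z (RtoC c) * m = Gamma_Euler (RtoC c) * Cpower z (RtoC c') * m'.
Proof.
  intros Hc Hc' Hz Hq Hm Hm'. pose proof (hyp_fun_kummer c nu z m Hc Hz Hq Hm) as E. pose proof (hyp_fun_kummer c' nu z m' Hc' Hz Hq Hm') as E'.
  assert (N3 : Gamma_Euler (1 / 2 - nu) <> 0) by (apply Gamma_Euler_neq_0; auto).
  set (q := 1 / 2 - nu) in *.
  transitivity (Gamma_Euler (RtoC c') / Gamma_Euler q * (Gamma_Euler q * Cpower z (RtoC c) * m)). field; auto.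
  rewrite E. transitivity (Gamma_Euler (RtoC c) / Gamma_Euler q * (Gamma_Euler q * Cpower z (RtoC c') * m')). rewrite E'. field; auto. field; auto.
Qed.

(** * The Pfaff-Saalschuetz sum and Euler's transformation of 2F1 *)

Lemma sum_f_minus (f g : nat -> R) n : (sum_f_R0 f n - sum_f_R0 g n)%R = sum_n (fun k => (f k - g k)%R) n.
Proof. rewrite <- !sum_n_Reals. induction n. rewrite !sum_O. reflexivity. rewrite !sum_Sn, <- IHn. unfold plus; simpl. ring. Qed.
Lemma sum_f_plus (f g : nat -> R) n : (sum_f_R0 f n + sum_f_R0 g n)%R = sum_n (fun k => (f k + g k)%R) n.
Proof. rewrite <- !sum_n_Reals. induction n. rewrite !sum_O. reflexivity. rewrite !sum_Sn, <- IHn. unfold plus; simpl. ring. Qed.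

Lemma cauchy_product (a b : nat -> C) la lb : is_Cseries a la -> is_Cseries b lb ->
  ex_series (fun n => Cmod (a n)) -> ex_series (fun n => Cmod (b n)) ->
  is_Cseries (fun n => Csum (fun k => a k * b (n - k)%nat) (S n)) (la * lb).
Proof.
  intros Ha Hb Aa Ab.
  assert (AR : forall f, ex_series (fun n => Cmod (f n)) -> ex_series (fun n => Rabs (Re (f n)))).
  { intros f Hf. apply (ex_series_le (V:=R_CompleteNormedModule) _ (fun n => Cmod (f n))); auto.
    intros n. rewrite Rabs_Rabsolu. apply re_le_Cmod. }
  assert (AI : forall f, ex_series (fun n => Cmod (f n)) -> ex_series (fun n => Rabs (Im (f n)))).
  { intros f Hf. apply (ex_series_le (V:=R_CompleteNormedModule) _ (fun n => Cmod (f n))); auto.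
    intros n. rewrite Rabs_Rabsolu. apply im_le_Cmod. }
  pose proof (is_Cseries_Re _ _ Ha) as R1. pose proof (is_Cseries_Im _ _ Ha) as I1.
  pose proof (is_Cseries_Re _ _ Hb) as R2. pose proof (is_Cseries_Im _ _ Hb) as I2.
  pose proof (is_series_mult _ _ _ _ R1 R2 (AR _ Aa) (AR _ Ab)) as P1.
  pose proof (is_series_mult _ _ _ _ I1 I2 (AI _ Aa) (AI _ Ab)) as P2.
  pose proof (is_series_mult _ _ _ _ R1 I2 (AR _ Aa) (AI _ Ab)) as P3.
  pose proof (is_series_mult _ _ _ _ I1 R2 (AI _ Aa) (AR _ Ab)) as P4.
  apply is_Cseries_parts.
  - eapply is_series_ext; [|exact (is_series_minus _ _ _ _ P1 P2)]. intros n. rewrite Csum_Re. apply sum_f_minus.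
  - eapply is_series_ext; [|exact (is_series_plus _ _ _ _ P3 P4)]. intros n. rewrite Csum_Im. apply sum_f_plus.
Qed.

Lemma hyp_coef_0 A B c : hyp_coef A B c 0 = 1.
Proof. unfold hyp_coef. simpl. field. Qed.

Lemma binom_coef_0 d : binom_coef d 0 = 1.
Proof. unfold binom_coef. simpl. field. Qed.

(* Zeilberger-type certificate for the recurrence in [n] of the Pfaff-Saalschuetz sum. *)
Lemma saalschutz_telescope A B c n k : (0 < c)%R -> (k <= n)%nat ->
  let d := RtoC c - A - B in let N := natC n in
  (N + 1) * (N + RtoC c) * (hyp_coef A B c k * binom_coef d (S n - k)) - (N + RtoC c - A) * (N + RtoC c - B) * (hyp_coef A B c k * binom_coef d (n - k)) =
  - (natC (S k) * (natC k + RtoC c) * (hyp_coef A B c (S k) * binom_coef d (n - k))) - - (natC k * (natC k + RtoC c - 1) * (hyp_coef A B c k * binom_coef d (S n - k))).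
Proof.
  intros Hc Hk d N. replace (S n - k)%nat with (S (n - k)) by lia. rewrite binom_coef_S, hyp_coef_S by auto.
  assert (EN : N = natC (n - k) + natC k) by (unfold N; rewrite <- natC_plus; f_equal; lia).
  pose proof (natC_neq_0 k) as H1. pose proof (natC_neq_0 (n - k)) as H2. rewrite natC_S in H1, H2. rewrite !natC_S.
  assert (H3 : RtoC (c + INR k) <> 0) by (apply RtoC_neq_0; pose proof (pos_INR k); lra).
  rewrite RtoC_plus in *. fold (natC k) in *. rewrite EN. unfold d. field. auto.
Qed.

Lemma Csum_telescope (R : nat -> C) n : Csum (fun k => R (S k) - R k) n = R n - R O.
Proof. induction n; simpl. ring. rewrite IHn. ring. Qed.

(** The identity between coefficients of [x^n] in Euler's transformation. Summing the telescoping
    certificate over [k] gives a first-order recurrence in [n], which is that of the right-hand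
    side. *)
Lemma saalschutz A B c n : (0 < c)%R ->
  Csum (fun k => hyp_coef A B c k * binom_coef (RtoC c - A - B) (n - k)) (S n) = hyp_coef (RtoC c - A) (RtoC c - B) c n.
Proof.
  intros Hc. set (d := RtoC c - A - B). induction n.
  - simpl Csum. rewrite !hyp_coef_0. replace (0 - 0)%nat with O by lia. rewrite binom_coef_0. ring.
  - set (H0 := Csum (fun k => hyp_coef A B c k * binom_coef d (n - k)) (S n)) in *.
    (* The sum for [n + 1] without its last term: at [k = n + 1] the subtraction [n - k] is
       truncated and the certificate does not apply. *)
    set (H1 := Csum (fun k => hyp_coef A B c k * binom_coef d (S n - k)) (S n)).
    set (N := natC n).
    assert (T : (N + 1) * (N + RtoC c) * H1 - (N + RtoC c - A) * (N + RtoC c - B) * H0 = - (natC (S n) * (natC n + RtoC c) * hyp_coef A B c (S n))).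
    { set (Rr := fun k => - (natC k * (natC k + RtoC c - 1) * (hyp_coef A B c k * binom_coef d (S n - k)))).
      transitivity (Rr (S n) - Rr O).
      - rewrite <- Csum_telescope. unfold H1, H0. rewrite <- !Csum_scal.
        transitivity (Csum (fun k => (N + 1) * (N + RtoC c) * (hyp_coef A B c k * binom_coef d (S n - k)) + - (1) * ((N + RtoC c - A) * (N + RtoC c - B) * (hyp_coef A B c k * binom_coef d (n - k)))) (S n)).
        rewrite Csum_plus, (Csum_scal (- (1))). ring.
        apply Csum_ext. intros k Hk. pose proof (saalschutz_telescope A B c n k Hc ltac:(lia)) as E. cbv zeta in E. fold d N in E.
        unfold Rr. replace (S n - S k)%nat with (n - k)%nat by lia.
        transitivity ((N + 1) * (N + RtoC c) * (hyp_coef A B c k * binom_coef d (S n - k)) - (N + RtoC c - A) * (N + RtoC c - B) * (hyp_coef A B c k * binom_coef d (n - k))). ring.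
        rewrite E. rewrite natC_S. ring.
      - unfold Rr. replace (S n - S n)%nat with O by lia. rewrite binom_coef_0, natC_S. replace (natC 0) with (RtoC 0) by reflexivity. ring. }
    change (Csum (fun k => hyp_coef A B c k * binom_coef d (S n - k)) (S (S n))) with (H1 + hyp_coef A B c (S n) * binom_coef d (S n - S n)).
    replace (S n - S n)%nat with O by lia. rewrite binom_coef_0. rewrite (hyp_coef_S (RtoC c - A)), <- IHn by auto.
    pose proof (natC_neq_0 n) as Nn. rewrite natC_S in *. fold N in T, Nn. 
    assert (H3 : RtoC (c + INR n) <> 0) by (apply RtoC_neq_0; pose proof (pos_INR n); lra).
    rewrite RtoC_plus in *. fold (natC n) in *. fold N in H3. fold N. rewrite (Cplus_comm (RtoC c) N) in *.
    transitivity (((N + 1) * (N + RtoC c) * H1 - (N + RtoC c - A) * (N + RtoC c - B) * H0 + (N + RtoC c - A) * (N + RtoC c - B) * H0 + (N + 1) * (N + RtoC c) * hyp_coef A B c (S n)) / ((N + 1) * (N + RtoC c))).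
    field; auto. rewrite T. field. auto.
Qed.

Lemma CPS_summable_abs a r x : CPS_summable a r -> (Rabs x < r)%R -> ex_series (fun n => Cmod (a n * RtoC (x ^ n))).
Proof.
  intros H Hx. pose proof (H (Rabs x) ltac:(split; [apply Rabs_pos|auto])) as S1. eapply ex_series_ext; [|exact S1].
  intros n. rewrite Cmod_mult, Cmod_R, <- RPow_abs. reflexivity.
Qed.

(** The Cauchy product of the hypergeometric and the binomial series has the Saalschuetz sums as
    coefficients. *)
Lemma euler_transform A B c x : (0 < c)%R -> (Rabs x < 1)%R ->
  CPSeries (hyp_coef (RtoC c - A) (RtoC c - B) c) x = CPSeries (hyp_coef A B c) x * rpow (1 - x) (- (RtoC c - A - B)).
Proof.
  intros Hc Hx. set (d := RtoC c - A - B). rewrite <- binomial_series by auto.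
  pose proof (cauchy_product _ _ _ _ (CPSeries_is_series _ 1 x (hyp_coef_summable A B c Hc) Hx) (CPSeries_is_series _ 1 x (binom_coef_summable d) Hx)
    (CPS_summable_abs _ _ _ (hyp_coef_summable A B c Hc) Hx) (CPS_summable_abs _ _ _ (binom_coef_summable d) Hx)) as P.
  apply (is_Clim_unique _ _ _ (CPSeries_is_series _ 1 x (hyp_coef_summable (RtoC c - A) (RtoC c - B) c Hc) Hx)).
  eapply is_Cseries_ext; [|exact P]. intros n. cbv beta. rewrite <- saalschutz by auto. fold d.
  rewrite Cmult_comm, <- Csum_scal. apply Csum_ext. intros k Hk.
  assert (E : RtoC (x ^ n) = RtoC (x ^ k) * RtoC (x ^ (n - k))).
  { rewrite <- RtoC_mult, <- pow_add. do 2 f_equal. lia. }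
  rewrite E. ring.
Qed.

Lemma hyp_coef_sym A B c n : hyp_coef A B c n = hyp_coef B A c n.
Proof. unfold hyp_coef. f_equal. ring. Qed.

(** For [A = c - 1/2 - nu] and [B = 1/2 - nu], the numbers [c - A] and [c - B] are the parameters
    for [- nu] in the opposite order. As [c - A - B = 2 nu], Euler's factor is [(1 + t)^(2 nu)],
    which is exactly the change of the power of [1 + t]. *)
Lemma hyp_fun_even c nu z t : (0 < c)%R -> (0 < t)%R -> hyp_fun c nu z t = hyp_fun c (- nu) z t.
Proof.
  intros Hc Ht. unfold hyp_fun. destruct (tfrac_bounds t Ht) as [X _].
  set (A := RtoC c - 1 / 2 - nu). set (B := 1 / 2 - nu).
  replace (CPSeries (hyp_coef (RtoC c - 1 / 2 - - nu) (1 / 2 - - nu) c) (tfrac t)) with (CPSeries (hyp_coef (RtoC c - A) (RtoC c - B) c) (tfrac t)).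
  2:{ apply CPSeries_ext. intros n. rewrite hyp_coef_sym. f_equal; unfold A, B; ring. }
  rewrite euler_transform by (auto; apply Rabs_def1; lra). rewrite rpow_tfrac by auto.
  unfold tricomi_fun. replace (- nu - 1 / 2) with ((nu - 1 / 2) + - (2 * nu)) by ring.
  rewrite (rpow_add _ (nu - 1 / 2)). replace (- - (RtoC c - A - B)) with (2 * nu) by (unfold A, B; field).
  rewrite rpow_opp. pose proof (rpow_neq_0 (1 + t) (2 * nu)). field. auto.
Qed.

(** Duplication of Pochhammer symbols: [(a)_i (a + 1/2)_i = (2a)_(2i) / 4^i] at [a = - nu], and in
    the denominator [i! (1/2)_i = (2i)! / 4^i]. *)
Lemma hyp_coef_half nu i : hyp_coef (- nu) (1 / 2 - nu) (1 / 2) i = binom_coef (- (2 * nu)) (2 * i).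
Proof.
  induction i. rewrite hyp_coef_0. rewrite binom_coef_0. reflexivity.
  replace (2 * S i)%nat with (S (S (2 * i))) by lia. rewrite !binom_coef_S, hyp_coef_S, IHi by lra.
  pose proof (natC_neq_0 i) as H1. pose proof (natC_neq_0 (2 * i)) as H2. pose proof (natC_neq_0 (S (2 * i))) as H3.
  assert (E2 : natC (2 * i) = 2 * natC i). { unfold natC. rewrite mult_INR. rewrite RtoC_mult. f_equal. }
  
  rewrite !natC_S in *. rewrite E2 in *.
  replace (RtoC (1 / 2 + INR i)) with ((2 * natC i + 1) / 2) in *. 2:{ unfold natC. rewrite RtoC_plus, RtoC_div by lra. field. }
  field. repeat split; auto. 
Qed.

Lemma binomial_even alpha y : (Rabs y < 1)%R ->
  is_Cseries (fun i => binom_coef alpha (2 * i) * RtoC ((y * y) ^ i)) ((CPSeries (binom_coef alpha) y + CPSeries (binom_coef alpha) (- y)) / 2).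
Proof.
  intros Hy. assert (Hy' : (Rabs (- y) < 1)%R) by (rewrite Rabs_Ropp; auto).
  pose proof (is_Cseries_scal (/ 2) _ _ (is_Cseries_plus _ _ _ _ (CPSeries_is_series _ 1 y (binom_coef_summable alpha) Hy) (CPSeries_is_series _ 1 (- y) (binom_coef_summable alpha) Hy'))) as S1.
  intros eps He. destruct (S1 eps He) as [N HN]. exists N. intros n Hn. specialize (HN (2 * n)%nat ltac:(lia)).
  replace (Csum (fun i => binom_coef alpha (2 * i) * RtoC ((y * y) ^ i)) n) with
    (Csum (fun n => / 2 * (binom_coef alpha n * RtoC (y ^ n) + binom_coef alpha n * RtoC ((- y) ^ n))) (2 * n)).
  replace ((CPSeries (binom_coef alpha) y + CPSeries (binom_coef alpha) (- y)) / 2) with (/ 2 * (CPSeries (binom_coef alpha) y + CPSeries (binom_coef alpha) (- y))) by (unfold Cdiv; ring). exact HN.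
  clear. induction n. reflexivity. replace (2 * S n)%nat with (S (S (2 * n))) by lia. 
  change (Csum ?f (S (S (2 * n)))) with (Csum f (2 * n) + f (2 * n)%nat + f (S (2 * n))). rewrite IHn.
  change (Csum ?f (S n)) with (Csum f n + f n). cbv beta.
  assert (E1 : ((- y) ^ (2 * n) = (y * y) ^ n)%R). { rewrite pow_mult. f_equal. simpl; ring. }
  assert (E2 : (y ^ (2 * n) = (y * y) ^ n)%R). { rewrite pow_mult. f_equal. simpl; ring. }
  change ((- y) ^ S (2 * n))%R with (- y * (- y) ^ (2 * n))%R. change (y ^ S (2 * n))%R with (y * y ^ (2 * n))%R.
  rewrite E1, E2, !RtoC_mult, RtoC_opp. field.
Qed.

(** Put [y = sqrt t / sqrt (1 + t)], so that [tfrac t = y^2]. The series is the even part of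
    [(1 - y)^(2 nu)], and [(1 + t) (1 +- y)^2 = (sqrt (1 + t) +- sqrt t)^2] is [wt t] or its
    inverse. *)
Lemma hyp_fun_half nu z t : (0 < t)%R -> hyp_fun (1 / 2) nu z t = Cexp (- (z * RtoC t)) * K_kernel nu t.
Proof.
  intros Ht. destruct (tfrac_bounds t Ht) as [X X1]. destruct (sqrt_facts t Ht) as (A & B & Sa & Sb). destruct (wt_bounds t Ht) as (W & _).
  unfold hyp_fun. set (a := sqrt t) in *. set (b := sqrt (1 + t)) in *. set (y := (a / b)%R).
  assert (Hab : (a < b)%R) by (apply sqrt_lt_1; lra).
  assert (Hy : (0 < y < 1)%R). { unfold y. split. apply Rdiv_lt_0_compat; lra. apply Rmult_lt_reg_r with b; auto. replace (a / b * b)%R with a by (field; lra). lra. }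
  assert (Eyx : tfrac t = (y * y)%R). { unfold y, tfrac. rewrite <- Sa at 1. rewrite <- Sb. field. lra. }
  assert (EC : CPSeries (hyp_coef (RtoC (1 / 2) - 1 / 2 - nu) (1 / 2 - nu) (1 / 2)) (tfrac t) = (rpow (1 - y) (2 * nu) + rpow (1 + y) (2 * nu)) / 2).
  { assert (Hc : (0 < 1 / 2)%R) by lra.
    pose proof (CPSeries_is_series _ 1 (tfrac t) (hyp_coef_summable (RtoC (1 / 2) - 1 / 2 - nu) (1 / 2 - nu) (1 / 2) Hc) ltac:(apply Rabs_def1; lra)) as S1.
    pose proof (binomial_even (- (2 * nu)) y ltac:(apply Rabs_def1; lra)) as S2.
    rewrite !binomial_series in S2 by (rewrite ?Rabs_Ropp; apply Rabs_def1; lra).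
    replace (1 - - y)%R with (1 + y)%R in S2 by ring. replace (- - (2 * nu)) with (2 * nu) in S2 by ring.
    apply (is_Clim_unique _ _ _ S1). eapply is_Cseries_ext; [|exact S2]. intros i. cbv beta. rewrite <- Eyx, <- hyp_coef_half. f_equal. f_equal. rewrite RtoC_div by lra. ring. }
  rewrite EC. unfold K_kernel. fold a b.
  assert (E1 : forall v, (0 < v)%R -> rpow (1 + t) nu * rpow v (2 * nu) = rpow (b * v * (b * v)) nu).
  { intros v Hv. replace (2 * nu) with (nu + nu) by ring. rewrite rpow_add, <- Sb, !rpow_mult_base by nra. ring. }
  assert (Wp : wt t = (b * (1 + y) * (b * (1 + y)))%R). { unfold wt. fold a b. unfold y. field. lra. }
  assert (Wm : (/ wt t = b * (1 - y) * (b * (1 - y)))%R).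
  { rewrite Wp. assert (E : (b * (1 - y) * (b * (1 + y)) = 1)%R). { unfold y. replace (b * (1 - a / b) * (b * (1 + a / b)))%R with (b * b - a * a)%R by (field; lra). lra. }
    apply Rmult_eq_reg_r with (b * (1 + y) * (b * (1 + y)))%R; [|nra]. rewrite Rinv_l by nra.
    replace (b * (1 - y) * (b * (1 - y)) * (b * (1 + y) * (b * (1 + y))))%R with ((b * (1 - y) * (b * (1 + y))) * (b * (1 - y) * (b * (1 + y))))%R by ring. rewrite E. ring. }
  unfold tricomi_fun. rewrite <- (rpow_inv_base (wt t)) by lra. rewrite Wm. rewrite Wp. rewrite <- !E1 by lra.
  assert (F1 : rpow t (RtoC (1 / 2) - 1) = RtoC (/ a)).
  { replace (RtoC (1 / 2) - 1) with (RtoC (- / 2)). 2:{ rewrite RtoC_opp, RtoC_div, RtoC_inv by lra. field. }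
    rewrite rpow_RtoC, Rpower_Ropp, Rpower_sqrt by lra. reflexivity. }
  assert (F2 : rpow (1 + t) (nu - 1 / 2) = rpow (1 + t) nu * RtoC (/ b)).
  { unfold Cminus. rewrite rpow_add. f_equal. replace (- (1 / 2)) with (RtoC (- / 2)). 2:{ rewrite RtoC_opp, RtoC_inv by lra. field. }
    rewrite rpow_RtoC, Rpower_Ropp, Rpower_sqrt by lra. reflexivity. }
  rewrite F1, F2, Rinv_mult, RtoC_mult. field.
Qed.

(** * Proof of the theorem *)

Lemma rpow_wt_le t nu B : (0 < t)%R -> (Rabs (Re nu) <= B)%R -> (Cmod (rpow (wt t) nu) <= Rpower (4 * (1 + t)) B)%R.
Proof.
  intros Ht HB. destruct (wt_bounds t Ht) as (W & _ & W4 & _). rewrite Cmod_rpow by lra.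
  pose proof (Rle_abs (Re nu)). pose proof (Rabs_pos (Re nu)).
  apply Rle_trans with (Rpower (wt t) B). apply Rle_Rpower; lra. apply Rpower_incr_base; lra.
Qed.

(** A bound common to a whole strip of orders, for the passage to integer orders. The exponent [1/2]
    comes from the singularity [t^(-1/2)], and the growth in [t] from [wt t <= 4 (1 + t)]. *)
Lemma K_fun_dominated u B : (0 < Re u)%R -> (0 <= B)%R -> exists K, forall nu, (Rabs (Re nu) <= B)%R -> dominated (1 / 2) K (K_fun nu u).
Proof.
  intros Hu HB. destruct (rpow_exp_le_dsat (1 / 2) B (Re u) ltac:(lra) Hu) as (K & HK & HD).
  exists (Rpower 4 B * K)%R. intros nu Hnu t Ht. specialize (HD t Ht). destruct (sqrt_facts t Ht) as (A & Bb & _ & _).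
  unfold K_fun, K_kernel. rewrite !Cmod_mult, Cmod_Cexp_linear, Cmod_R, Rabs_pos_eq by (left; apply Rinv_0_lt_compat; nra).
  pose proof (rpow_wt_le t nu B Ht Hnu) as B1. pose proof (rpow_wt_le t (- nu) B Ht ltac:(rewrite Re_opp, Rabs_Ropp; auto)) as B2.
  assert (B3 : (Cmod ((rpow (wt t) nu + rpow (wt t) (- nu)) / 2) <= Rpower (4 * (1 + t)) B)%R).
  { rewrite Cmod_div by (apply RtoC_neq_0; lra). rewrite Cmod_R, Rabs_pos_eq by lra.
    pose proof (Cmod_triangle (rpow (wt t) nu) (rpow (wt t) (- nu))). lra. }
  assert (E4 : (Rpower (4 * (1 + t)) B = Rpower 4 B * Rpower (1 + t) B)%R) by (symmetry; apply Rpower_mult_distr; lra).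
  rewrite E4 in B3.
  assert (E5 : (/ (sqrt t * sqrt (1 + t)) <= Rpower t (1 / 2 - 1))%R).
  { replace (1 / 2 - 1)%R with (- / 2)%R by field. rewrite Rpower_Ropp, Rpower_sqrt by auto.
    apply Rinv_le_contravar; auto. rewrite <- (Rmult_1_r (sqrt t)) at 1. apply Rmult_le_compat_l. lra.
    rewrite <- sqrt_1 at 1. apply sqrt_le_1; lra. }
  assert (E6 : (exp (- (Re u * (1 + 2 * t))) <= exp (- (Re u * t)))%R) by (apply exp_le; nra).
  pose proof (Rpower_pos 4 B). 
  pose proof (exp_pos (- (Re u * (1 + 2 * t)))). assert (0 < / (sqrt t * sqrt (1 + t)))%R by (apply Rinv_0_lt_compat; nra).
  pose proof (Cmod_ge_0 ((rpow (wt t) nu + rpow (wt t) (- nu)) / 2)).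
  apply Rle_trans with (exp (- (Re u * t)) * (Rpower t (1 / 2 - 1) * (Rpower 4 B * Rpower (1 + t) B)))%R.
  - apply Rmult_le_compat; try lra. apply Rmult_le_pos; lra. apply Rmult_le_compat; lra.
  - rewrite Rmult_assoc. replace (exp (- (Re u * t)) * (Rpower t (1 / 2 - 1) * (Rpower 4 B * Rpower (1 + t) B)))%R
      with (Rpower 4 B * (Rpower t (1 / 2 - 1) * Rpower (1 + t) B * exp (- (Re u * t))))%R by ring.
    apply Rmult_le_compat_l; lra.
Qed.

(* [C_lim] samples the order at [x + 1/(n+1)]; the index is shifted because for integer [x]
   the first of these orders is an integer. *)
Lemma BesselK_seq (x : R) u : (0 < Re u)%R -> (forall n, ~ is_Zint (RtoC (x + / (INR (S n) + 1)))) ->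
  exists m, is_CInt (K_fun (RtoC x) u) m /\ is_Clim (fun n => BesselK_nonint (RtoC (x + / (INR (S n) + 1))) u) m.
Proof.
  intros Hu Hn. set (nun := fun n => RtoC (x + / (INR (S n) + 1))).
  assert (Hinv : forall n, (0 < / (INR (S n) + 1) <= 1)%R).
  { intros n. pose proof (pos_INR (S n)). split. apply Rinv_0_lt_compat; lra. apply Rle_trans with (/ 1)%R; [apply Rinv_le_contravar; lra|rewrite Rinv_1; lra]. }
  set (B := (Rabs x + 1)%R).
  assert (HB : (0 <= B)%R) by (unfold B; pose proof (Rabs_pos x); lra).
  assert (HnB : forall n, (Rabs (Re (nun n)) <= B)%R).
  { intros n. unfold nun, B. rewrite Re_RtoC. eapply Rle_trans. apply Rabs_triang. specialize (Hinv n). rewrite (Rabs_pos_eq (/ _)); lra. }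
  destruct (K_fun_dominated u B Hu HB) as (K & HK).
  apply (is_CInt_dominated_cvg (fun n => K_fun (nun n) u) (K_fun (RtoC x) u) _ (1 / 2) K); try lra.
  - intros n. apply K_fun_cont. - apply K_fun_cont. - intros n. apply HK; auto.
  (* On [[p, q]] the logarithm of [wt t] is at most [L], and a change of the order from [x] by [e]
     changes the integrand by at most [e * Q]. *)
  - intros p q eps Hp He. set (L := ln (4 * (1 + q))). set (Q := (/ sqrt p * (L * exp (B * L)))%R).
    assert (HL : (0 <= L)%R). { rewrite <- ln_1. apply Rlt_le, ln_increasing; lra. }
    assert (Hsp : (0 < / sqrt p)%R) by (apply Rinv_0_lt_compat, sqrt_lt_R0; lra).
    assert (HQ : (0 <= Q)%R). { pose proof (exp_pos (B * L)). apply Rmult_le_pos. lra. apply Rmult_le_pos; lra. }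
    destruct (nfloor_ex (Q / eps)) as [N HN]. { apply Rdiv_le_0_compat; auto. }
    exists N. intros n t Hn' Ht. assert (Ht0 : (0 < t)%R) by lra.
    destruct (wt_bounds t Ht0) as (W & _ & W4 & _). destruct (sqrt_facts t Ht0) as (A & Bb & _ & _).
    assert (Hlw : (0 <= ln (wt t) <= L)%R).
    { split. rewrite <- ln_1. apply Rlt_le, ln_increasing; lra. unfold L. destruct (Req_dec (wt t) (4 * (1 + q))) as [->|]. lra. apply Rlt_le, ln_increasing; lra. }
    set (e := (/ (INR (S n) + 1))%R). specialize (Hinv n). fold e in Hinv.
    (* The sign [s] treats the exponents [nu] and [- nu] together. *)
    assert (D : forall s : R, (Rabs s = 1)%R -> (Cmod (rpow (wt t) (RtoC s * nun n) - rpow (wt t) (RtoC s * RtoC x)) <= e * (L * exp (B * L)))%R).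
    { intros s Hs. 
      assert (Hm : forall y, (Rabs y <= B)%R -> (Re (RtoC s * RtoC y * RtoC (ln (wt t))) <= B * L)%R).
      { intros y Hy. rewrite <- !RtoC_mult. simpl Re. eapply Rle_trans. apply Rle_abs. rewrite !Rabs_mult, Hs, Rmult_1_l, (Rabs_pos_eq (ln (wt t))) by lra.
        apply Rmult_le_compat; try lra. apply Rabs_pos. }
      eapply Rle_trans. apply (Cexp_lipschitz _ _ (B * L)). apply Hm. unfold B. lra. apply (Hm (x + e)%R). apply (HnB n).
      replace (RtoC s * nun n * RtoC (ln (wt t)) - RtoC s * RtoC x * RtoC (ln (wt t))) with (RtoC (s * e * ln (wt t))).
      2:{ unfold nun. fold e. rewrite RtoC_plus, !RtoC_mult. ring. }
      rewrite Cmod_R, !Rabs_mult, Hs, (Rabs_pos_eq e), (Rabs_pos_eq (ln (wt t))) by lra.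
      rewrite Rmult_1_l, Rmult_assoc. apply Rmult_le_compat_l. lra. apply Rmult_le_compat_r. left; apply exp_pos. lra. }
    pose proof (D 1%R ltac:(apply Rabs_R1)) as D1. pose proof (D (-1)%R ltac:(rewrite Rabs_left; lra)) as D2.
    replace (RtoC 1 * nun n) with (nun n) in D1 by ring. replace (RtoC 1 * RtoC x) with (RtoC x) in D1 by ring.
    replace (RtoC (-1) * nun n) with (- nun n) in D2 by (rewrite RtoC_m1; ring). replace (RtoC (-1) * RtoC x) with (- RtoC x) in D2 by (rewrite RtoC_m1; ring).
    replace (K_fun (nun n) u t - K_fun (RtoC x) u t) with (Cexp (- (u * RtoC (1 + 2 * t))) * (RtoC (/ (sqrt t * sqrt (1 + t))) *
      (((rpow (wt t) (nun n) - rpow (wt t) (RtoC x)) + (rpow (wt t) (- nun n) - rpow (wt t) (- RtoC x))) / 2))).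
    2:{ unfold K_fun, K_kernel. field. }
    rewrite !Cmod_mult, Cmod_Cexp_linear, Cmod_R, Rabs_pos_eq by (left; apply Rinv_0_lt_compat; nra).
    assert (E1 : (exp (- (Re u * (1 + 2 * t))) <= 1)%R) by (apply Rle_trans with (exp 0); [apply exp_le; nra|rewrite exp_0; lra]).
    assert (E2 : (/ (sqrt t * sqrt (1 + t)) <= / sqrt p)%R).
    { apply Rinv_le_contravar. apply sqrt_lt_R0; lra. assert (sqrt p <= sqrt t)%R by (apply sqrt_le_1; lra).
      assert (1 <= sqrt (1 + t))%R by (apply Rle_trans with (sqrt 1); [rewrite sqrt_1; lra|apply sqrt_le_1; lra]). nra. }
    assert (E3 : (Cmod (((rpow (wt t) (nun n) - rpow (wt t) (RtoC x)) + (rpow (wt t) (- nun n) - rpow (wt t) (- RtoC x))) / 2) <= e * (L * exp (B * L)))%R).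
    { rewrite Cmod_div by (apply RtoC_neq_0; lra). rewrite Cmod_R, Rabs_pos_eq by lra.
      pose proof (Cmod_triangle (rpow (wt t) (nun n) - rpow (wt t) (RtoC x)) (rpow (wt t) (- nun n) - rpow (wt t) (- RtoC x))). lra. }
    apply Rle_trans with (1 * (/ sqrt p * (e * (L * exp (B * L)))))%R.
    + apply Rmult_le_compat; auto. left; apply exp_pos. apply Rmult_le_pos; [left; apply Rinv_0_lt_compat; nra|apply Cmod_ge_0].
      apply Rmult_le_compat; auto. left; apply Rinv_0_lt_compat; nra. apply Cmod_ge_0.
    + replace (1 * (/ sqrt p * (e * (L * exp (B * L)))))%R with (e * Q)%R by (unfold Q; ring).
      apply le_INR in Hn'. unfold e. rewrite S_INR.
      assert (HQe : (Q < eps * (INR n + 1 + 1))%R).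
      { assert (X : (Q / eps < INR n + 1 + 1)%R) by lra. apply (Rmult_lt_compat_l eps) in X; auto. replace (eps * (Q / eps))%R with Q in X by (field; lra). auto. }
      pose proof (pos_INR n). apply Rmult_le_reg_l with (INR n + 1 + 1)%R. lra. rewrite <- Rmult_assoc, Rinv_r, Rmult_1_l by lra. lra.
  - intros n. apply K_nonint_int; auto.
Qed.

(** The definition by a limit at integers agrees with the integral there because the integral is the
    limit along the sampled orders, which lie strictly between [k] and [k + 1]. *)
Lemma BesselK_int nu u : (0 < Re u)%R -> is_CInt (K_fun nu u) (BesselK nu u).
Proof.
  intros Hu. unfold BesselK. destruct (excluded_middle_informative (exists k : Z, nu = RtoC (IZR k))) as [[k Hk]|H].
  - subst nu. destruct (BesselK_seq (IZR k) u Hu) as (m & Hm & Hc).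
    { intros n [j Hj]. apply RtoC_inj in Hj. pose proof (lt_0_INR (S n) ltac:(lia)).
      assert (A : (0 < / (INR (S n) + 1) < 1)%R). { split. apply Rinv_0_lt_compat; lra. rewrite <- Rinv_1. apply Rinv_lt_contravar; lra. }
      assert (B1 : (IZR k < IZR j)%R) by lra. assert (B2 : (IZR j < IZR (k + 1))%R) by (rewrite plus_IZR; lra).
      apply lt_IZR in B1. apply lt_IZR in B2. lia. }
    replace (C_lim (fun nu' => BesselK_nonint nu' u) (RtoC (IZR k))) with m; auto.
    apply C_ext; unfold C_lim, Lim; simpl Re; simpl Im; simpl fst; simpl snd.
    + symmetry. rewrite (is_lim_seq_unique _ (Re m)). reflexivity. apply is_lim_seq_incr_1. apply (is_Clim_Re _ _ Hc).
    + symmetry. rewrite (is_lim_seq_unique _ (Im m)). reflexivity. apply is_lim_seq_incr_1. apply (is_Clim_Im _ _ Hc).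
  - apply K_nonint_int; auto.
Qed.

Lemma hyp_fun_half_K nu u : (0 < Re u)%R -> is_CInt (hyp_fun (1 / 2) nu (2 * u)) (Cexp u * BesselK nu u).
Proof.
  intros Hu. pose proof (is_CInt_scal (Cexp u) _ _ (K_fun_cont nu u) (BesselK_int nu u Hu)) as H.
  eapply is_CInt_ext; [|exact H]. intros t Ht. cbv beta. rewrite hyp_fun_half by auto. unfold K_fun.
  rewrite Cmult_assoc, <- Cexp_add. f_equal. f_equal. rewrite RtoC_plus, RtoC_mult. ring.
Qed.

Lemma Re_2 u : Re (2 * u) = (2 * Re u)%R.
Proof. unfold Re; simpl; ring. Qed.

Lemma BesselK_hyp_left c nu u m : (0 < c)%R -> (0 < Re u)%R -> (Re nu < 1 / 2)%R -> is_CInt (hyp_fun c nu (2 * u)) m ->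
  Gamma_Euler (RtoC c) * Cpower (2 * u) (1 / 2) * (Cexp u * BesselK nu u) = Gamma_Euler (1 / 2) * Cpower (2 * u) (RtoC c) * m.
Proof.
  intros Hc Hu Hn Hm. 
  assert (E : RtoC (1 / 2) = 1 / 2) by (rewrite RtoC_div by lra; reflexivity).
  rewrite <- E. apply (hyp_fun_c_indep (1 / 2) c nu (2 * u)); auto; try lra. rewrite Re_2; lra.
  unfold Cminus. rewrite Re_plus, Re_opp, <- E. simpl Re. lra. apply hyp_fun_half_K; auto.
Qed.

(** For [Re nu >= 1/2] the order [- nu] is admissible, and both [hyp_fun] and [K_fun] are even in
    the order. *)
Lemma BesselK_hyp c nu u m : (0 < c)%R -> (0 < Re u)%R -> is_CInt (hyp_fun c nu (2 * u)) m ->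
  Gamma_Euler (RtoC c) * Cpower (2 * u) (1 / 2) * (Cexp u * BesselK nu u) = Gamma_Euler (1 / 2) * Cpower (2 * u) (RtoC c) * m.
Proof.
  intros Hc Hu Hm. destruct (Rlt_le_dec (Re nu) (1 / 2)) as [H|H]. apply BesselK_hyp_left; auto.
  replace (BesselK nu u) with (BesselK (- nu) u).
  - apply BesselK_hyp_left; auto. rewrite Re_opp; lra.
    eapply is_CInt_ext; [|exact Hm]. intros t Ht. apply hyp_fun_even; auto.
  - apply (is_CInt_unique (K_fun nu u)); [|apply BesselK_int; auto].
    eapply is_CInt_ext; [|apply BesselK_int; auto]. intros t Ht. unfold K_fun, K_kernel. replace (- - nu) with nu by ring. field.
Qed.

(** * The value of Gamma at 1/2 *)

Lemma CRInt_real_nonneg (g : R -> R) p q : (0 < p <= q)%R -> (forall t, (0 < t)%R -> continuous g t) -> (forall t, (0 < t)%R -> (0 <= g t)%R) ->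
  exists r, (0 <= r)%R /\ CRInt (fun t => RtoC (g t)) p q = RtoC r.
Proof.
  intros Hp Hg Hpos. exists (RInt g p q). split.
  - apply RInt_ge_0. lra. apply (ex_RInt_continuous (V:=R_CompleteNormedModule)). intros z Hz. rewrite Rmin_left, Rmax_right in Hz by lra. apply Hg; lra.
    intros; apply Hpos; lra.
  - rewrite CRInt_parts by (try lra; intros t Ht; apply Ccont_RtoC; auto). apply C_ext; simpl. reflexivity.
    rewrite RInt_const. unfold scal; simpl; unfold mult; simpl. ring.
Qed.

Lemma is_CInt_real_nonneg g l : (forall t, (0 < t)%R -> continuous g t) -> (forall t, (0 < t)%R -> (0 <= g t)%R) ->
  is_CInt (fun t => RtoC (g t)) l -> exists r, (0 <= r)%R /\ l = RtoC r.
Proof.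
  intros Hg Hpos Hl. assert (Hc : Ccont_pos (fun t => RtoC (g t))) by (intros t Ht; apply Ccont_RtoC; auto).
  assert (Happ : forall eps, (0 < eps)%R -> exists r, (0 <= r)%R /\ (Cmod (RtoC r - l) < eps)%R).
  { intros eps He. destruct (is_CInt_elim _ _ Hc Hl eps He) as (d & M & Hd & HM).
    pose proof (Rmin_l (d/2) 1). pose proof (Rmin_r (d/2) 1). pose proof (Rmax_l (M+1) 1). pose proof (Rmax_r (M+1) 1).
    assert (0 < Rmin (d/2) 1)%R by (apply Rmin_glb_lt; lra).
    destruct (CRInt_real_nonneg g (Rmin (d/2) 1) (Rmax (M+1) 1) ltac:(lra) Hg Hpos) as (r & Hr & Er).
    exists r. split; auto. rewrite <- Er. apply HM; lra. }
  exists (Re l). split.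
  - apply Rnot_lt_le; intros Hlt. destruct (Happ (- Re l)%R ltac:(lra)) as (r & Hr & Hd).
    pose proof (re_le_Cmod (RtoC r - l)) as R1. replace (Re (RtoC r - l)) with (r - Re l)%R in R1 by reflexivity.
    rewrite Rabs_pos_eq in R1 by lra. lra.
  - apply C_ext; destruct (Req_dec (Im l) 0) as [E|E]; auto. exfalso.
    destruct (Happ (Rabs (Im l)) ltac:(apply Rabs_pos_lt; auto)) as (r & Hr & Hd).
    pose proof (im_le_Cmod (RtoC r - l)) as R1. replace (Im (RtoC r - l)) with (- Im l)%R in R1 by (unfold Im; simpl; ring).
    rewrite Rabs_Ropp in R1. lra.
Qed.

(** The reflection formula at [- 1/2] gives the square, namely [PI]; that the root is the positive
    one follows from the positivity of the integrand. *)
Lemma Gamma_half : Gamma_Euler (1 / 2) = Cpower (RtoC PI) (1 / 2).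
Proof.
  assert (E : RtoC (1 / 2) = 1 / 2) by (rewrite RtoC_div by lra; reflexivity).
  pose proof PI_RGT_0 as HPI.
  rewrite Cpower_RtoC by auto. rewrite <- E, rpow_RtoC by auto. replace (1 / 2)%R with (/ 2)%R by field. rewrite Rpower_sqrt by auto.
  replace (/ 2)%R with (1 / 2)%R by field. rewrite E.
  assert (Hre : (0 < Re (1 / 2))%R) by (rewrite <- E; simpl; lra).
  assert (Hsq : Gamma_Euler (1 / 2) * Gamma_Euler (1 / 2) = RtoC PI).
  { pose proof (reflection_strip (- (1 / 2))) as R1. 
    assert (S : Csin (- (1 / 2) * RtoC PI) = - (1)).
    { unfold Csin, Cexp. rewrite <- E, <- RtoC_opp, <- RtoC_mult.
      replace (Ci * RtoC (- (1 / 2) * PI)) with ((0, - (PI / 2))%R : C) by (apply C_ext; unfold Re, Im; simpl; field).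
      replace (- ((0, - (PI / 2))%R : C)) with ((0, PI / 2)%R : C) by (apply C_ext; unfold Re, Im; simpl; field).
      simpl Re. simpl Im. rewrite exp_0, cos_neg, sin_neg, cos_PI2, sin_PI2.
      replace ((1 * 0, 1 * - (1))%R : C) with (- Ci) by (apply C_ext; unfold Re, Im; simpl; ring).
      replace ((1 * 0, 1 * 1)%R : C) with Ci by (apply C_ext; unfold Re, Im; simpl; ring).
      field. apply Ci_neq_0. }
    rewrite S in R1. replace (1 + - (1 / 2)) with (1 / 2) in R1 by field. replace (1 - - (1 / 2)) with (1 / 2 + 1) in R1 by field.
    rewrite Gamma_Euler_rec in R1 by auto.
    transitivity (- (2) * (Gamma_Euler (1 / 2) * (1 / 2 * Gamma_Euler (1 / 2)) * - (1))). field. rewrite R1. field.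
    rewrite Re_opp, <- E. simpl Re. rewrite Rabs_left; lra.
    intros [k Hk]. rewrite <- E, <- RtoC_opp in Hk. apply RtoC_inj in Hk.
    assert (B1 : (IZR (-1) < IZR k)%R) by (simpl; lra). assert (B2 : (IZR k < IZR 0)%R) by (simpl; lra).
    apply lt_IZR in B1. apply lt_IZR in B2. lia. }
  destruct (is_CInt_real_nonneg (fun t => exp (- t) * Rpower t (- / 2))%R (Gamma_Euler (1 / 2))) as (r & Hr & Er).
  - intros t Ht. apply (continuous_mult (K:=R_AbsRing)). 2: apply Rpower_cont; auto.
    apply (ex_derive_continuous (K:=R_AbsRing) (V:=R_NormedModule)). auto_derive. auto.
  - intros t Ht. apply Rmult_le_pos. left; apply exp_pos. left; apply Rpower_pos.
  - rewrite Gamma_Euler_laplace by auto. eapply is_CInt_ext; [|apply (is_CInt_laplace (1 / 2) 1); auto; simpl; lra].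
    intros t Ht. unfold laplace_fun. replace (- (1 * RtoC t)) with (RtoC (- t)) by (rewrite RtoC_opp; ring). rewrite Cexp_RtoC.
    replace (1 / 2 - 1) with (RtoC (- / 2)). rewrite rpow_RtoC by auto. rewrite RtoC_mult. reflexivity.
    rewrite RtoC_opp, RtoC_inv by lra. field.
  - rewrite Er in *. rewrite <- RtoC_mult in Hsq. apply RtoC_inj in Hsq. f_equal. rewrite <- Hsq. rewrite sqrt_square; auto.
Qed.

Theorem theorem3p1 : forall (n : nat) (sigma u : C),
  (0 < n)%nat -> Nat.Even n -> (0 < Re u)%R ->
  exists s : C,
    is_series (fun i : nat =>
      Cpochhammer (- sigma) i * Cpochhammer (1 - sigma - natC n / 2) i
      / RtoC (INR (fact i))
      * WhittakerW (sigma / 2 - natC i) ((sigma + natC n - 1) / 2) (2 * u)) s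
    /\ BesselK (sigma + (natC n - 1) / 2) u
       = Cpower (2 * u) (- ((sigma + 1) / 2)) * Cpower (RtoC PI) (1 / 2) * s.
Proof.
  (* With [c = m = n/2] and this [nu], the hypergeometric parameters become [c - 1/2 - nu = - sigma]
     and [1/2 - nu = 1 - sigma - n/2]. *)
  intros n sigma u Hn [m Hm] Hu. set (z := 2 * u). set (nu := sigma + (natC n - 1) / 2). set (c := INR m).
  assert (Hm0 : (0 < m)%nat) by lia. assert (Hc : (0 < c)%R) by (apply lt_0_INR; auto).
  assert (En : natC n = 2 * RtoC c). { rewrite Hm. unfold natC, c. rewrite mult_INR, RtoC_mult. reflexivity. }
  assert (Hz : (0 < Re z)%R) by (unfold z; rewrite Re_2; lra).
  destruct (is_CInt_hyp_series c nu z Hc Hz) as (I & HI & HS).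
  pose proof (BesselK_hyp c nu u I Hc Hu HI) as E. rewrite Gamma_half in E. fold z in E.
  assert (G0 : Gamma_Euler (RtoC c) <> 0) by (apply Gamma_Euler_neq_0; simpl; auto).
  (* The second index of the Whittaker functions does not depend on [i], so the factors [w] and
     [e^{-z/2} = e^{-u}] come out of the sum. *)
  set (w := Cpower z ((sigma + natC n - 1) / 2 + 1 / 2)).
  exists (w * Cexp (- u) / Gamma_Euler (RtoC c) * I). split.
  - apply is_Cseries_is_series. eapply is_Cseries_ext; [|apply (is_Cseries_scal (w * Cexp (- u) / Gamma_Euler (RtoC c))); exact HS].
    intros i. cbv beta. unfold WhittakerW. fold z w. unfold TricomiPsi.
    replace (1 / 2 - (sigma / 2 - natC i) + (sigma + natC n - 1) / 2) with (RtoC c + natC i) by (rewrite En; field).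
    replace (2 * ((sigma + natC n - 1) / 2) + 1 - (RtoC c + natC i) - 1) with (nu - 1 / 2 - natC i) by (unfold nu; rewrite En; field).
    replace (- z / 2) with (- u) by (unfold z; field).
    rewrite Gamma_pos by (rewrite Re_plus, Re_natC; simpl; pose proof (pos_INR i); lra).
    rewrite Gamma_Euler_poch, Cpoch_RtoC by (simpl; auto).
    rewrite (is_CInt_Cint _ (tricomi_int (RtoC c + natC i) (nu - 1 / 2 - natC i) z)).
    + unfold hyp_coef. replace (RtoC c - 1 / 2 - nu) with (- sigma) by (unfold nu; rewrite En; field).
      replace (1 / 2 - nu) with (1 - sigma - natC n / 2) by (unfold nu; rewrite En; field).
      pose proof (fact_neq_0_C i). assert (RtoC (Rpoch c i) <> 0) by (apply RtoC_neq_0; pose proof (Rpoch_pos c i Hc); lra).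
      field. auto.
    + eapply is_CInt_ext; [|apply is_CInt_tricomi; auto].
      * intros t Ht. rewrite Cpower_RtoC by auto. rewrite <- RtoC_plus, Cpower_RtoC by lra. reflexivity.
      * rewrite Re_plus, Re_natC. simpl. pose proof (pos_INR i). lra.
  - rewrite Cexp_inv. pose proof (Cexp_neq_0 u). pose proof (Cpower_neq_0 z (1 / 2)) as N2.
    (* The exponents add up as [- (sigma + 1)/2 + (sigma + n)/2 + 1/2 = n/2 = c]. *)
    assert (Ew : Cpower z (- ((sigma + 1) / 2)) * w * Cpower z (1 / 2) = Cpower z (RtoC c)).
    { unfold w. rewrite <- !Cpower_add. f_equal. rewrite En. field. }
    transitivity (/ (Gamma_Euler (RtoC c) * Cpower z (1 / 2) * Cexp u) * (Gamma_Euler (RtoC c) * Cpower z (1 / 2) * (Cexp u * BesselK nu u))).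
    { field. auto. }
    rewrite E, <- Ew. field. auto.
Qed.
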